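(* Let $(\mathcal M,g)$ be a $d$-dimensional Riemannian manifold, $x\in\mathcal M$, and let $d>\ell+1$. Let $B\subset\mathrm T_x\mathcal M$ be an $\ell$-dimensional subspace, $\mathcal F$ a random linear map from $B$ into $\mathrm T_x\mathcal M$, and $\Xi=\mathrm{range}(\mathcal F)$. If the sketching operator $\mathcal P_{x,B,\Xi}=\mathcal F\,\Pi_B$ satisfies the Gaussian sketching condition, then it satisfies the Haar--Grassmann sketching condition.
   Context: $\langle\cdot,\cdot\rangle_x$ is the inner product on $\mathrm T_x\mathcal M$ given by $g_x$; self-adjointness, isometries and operator norms are with respect to it; $\Pi_B$ is the $g_x$-orthogonal projection onto $B$. The subspace $B$ is fixed (all probabilities and expectations are conditional on $B$). Gaussian sketching condition: the family of real random variables $\{\langle\mathcal F[u],w\rangle_x: u\in B,\ w\in\mathrm T_x\mathcal M\}$ is jointly Gaussian, with $\mathbb E[\langle\mathcal F[u],w\rangle_x]=0$ and $\mathbb E[\langle\mathcal F[u],w\rangle_x\langle\mathcal F[v],z\rangle_x]=\langle u,v\rangle_x\langle w,z\rangle_x$ for all $u,v\in B$ and $w,z\in\mathrm T_x\mathcal M$. Haar--Grassmann sketching condition: write the polar decomposition $\mathcal F=\mathcal U\mathcal R$ (for $\mathcal F$ of rank $\ell$), with $\mathcal U:B\to\Xi$ a linear isometry and $\mathcal R:B\to B$ $g_x$-self-adjoint positive definite. The condition requires: (i) $\Xi$ is Haar-uniform on the Grassmannian $\mathrm{Gr}(\ell,\mathrm T_x\mathcal M)$ of $\ell$-dimensional subspaces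 (its law is the unique probability measure invariant under all $g_x$-isometries of $\mathrm T_x\mathcal M$); (ii) almost surely $\operatorname{rank}(\mathcal F)=\ell$, and conditionally on $\Xi$ the isometry $\mathcal U$ is Haar-uniform on the set of all linear isometries from $B$ to $\Xi$ (the unique probability law invariant under right composition with orthogonal operators of $B$), and $\mathcal U$ is independent of $\mathcal R$; (iii) $\mathbb E[\mathcal R^2]=d\,\mathrm{Id}_B$ and $\mathbb E[\|\mathcal R^{-1}\|_{\mathrm{op}}^2]<\infty$. *)

(* Defs.v *)
(* The tangent space T_x M with its inner product g_x is rendered as a vectType
   [V] over a realType with a form [g : {dot V for idfun}] (symmetric, bilinear,
   positive definite): M enters the statement only through the pair
   (T_x M, g_x), and the dimension of M is [\dim {:V}].  The subspace B, seen as
   an inner product space of its own, is [subvs_of B] with [dot_sub g B]. *)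
From HB Require Import structures.
From mathcomp Require Import all_boot all_order all_algebra.
From mathcomp Require Import all_classical all_reals all_analysis.

Set Implicit Arguments.
Unset Strict Implicit.
Unset Printing Implicit Defensive.

Import Order.TTheory GRing.Theory Num.Theory.

Local Open Scope classical_set_scope.
Local Open Scope ring_scope.

Section InnerProduct.
Variables (R : realType) (V : vectType R) (g : {dot V for idfun}).
Implicit Types (f : 'End(V)) (W : {vspace V}).

Definition dnorm (u : V) : R := Num.sqrt (g u u).

Definition orthogonal_ops : set 'End(V) := [set Q : 'End(V) | isometry g g Q].

Definition self_adjoint f := forall u v, g (f u) v = g u (f v).

Definition positive_definite f := forall u, u != 0 -> 0 < g (f u) u.

Definition op_norm f : R := sup [set dnorm (f u) | u in [set u | dnorm u <= 1]].

Definition ortho_proj W : 'End(V) := daddv_pi W (orthov g W).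

(* Gr(l, V) *)
Definition grassmannian (l : nat) : set {vspace V} := [set W | \dim W = l].

End InnerProduct.

Section InducedInnerProduct.
Variables (R : realType) (V : vectType R) (g : {dot V for idfun}).
Variable B : {vspace V}.

Definition dot_sub (u v : subvs_of B) : R := g (vsval u) (vsval v).

Fact dot_sub_bilinear : bilinear_for *%R (idfun \; *%R) dot_sub.
Proof.
split=> w a u v; rewrite /dot_sub linearP //.
by rewrite linearDl linearZl_LR.
Qed.
HB.instance Definition _ := @bilinear_isBilinear.Build R (subvs_of B)
  (subvs_of B) R *%R (idfun \; *%R) dot_sub dot_sub_bilinear.

Fact dot_sub_sym u v : dot_sub u v = (-1) ^+ false * idfun (dot_sub v u).
Proof. exact: hermC. Qed.
HB.instance Definition _ :=
  @isHermitianSesquilinear.Build R (subvs_of B) false idfun dot_sub dot_sub_sym.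

Fact dot_sub_gt0 u : u != 0 -> 0 < dot_sub u u.
Proof.
move=> u0; apply: neq0_dnorm_gt0; apply: contra u0 => /eqP u0.
by apply/eqP/val_inj.
Qed.
HB.instance Definition _ :=
  @isDotProduct.Build R (subvs_of B) dot_sub dot_sub_gt0.

End InducedInnerProduct.

Arguments dot_sub {R V} g B.

Section Sketch.
Variables (R : realType) (V : vectType R) (g : {dot V for idfun}).
Variable B : {vspace V}.

(* P_{x,B,Xi} = F Pi_B *)
Definition sketching_operator (F : 'Hom(subvs_of B, V)) : 'End(V) :=
  (F \o (linfun (vsproj B) \o ortho_proj g B))%VF.

(* Recovers F from F Pi_B: see [sketching_operatorK]. *)
Definition restr (S : 'End(V)) : 'Hom(subvs_of B, V) :=
  (S \o linfun (@vsval _ _ B))%VF.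

Lemma sketching_operatorK : cancel sketching_operator restr.
Proof.
move=> F; apply/lfunP => u; rewrite !comp_lfunE !lfunE /=.
have dB : (B :&: orthov g B)%VS = 0%VS.
  apply/eqP; rewrite -subv0; apply/subvP => v; rewrite memv_cap => /andP[vB].
  move=> /mem_orthovP /(_ v vB) gv; rewrite memv0; apply/negPn/negP => v0.
  by have := @neq0_dnorm_gt0 _ _ _ g v v0; rewrite gv ltxx.
by rewrite /ortho_proj daddv_pi_id ?subvsP// vsvalK.
Qed.

Definition isometries_into (W : {vspace V}) : set 'Hom(subvs_of B, V) :=
  [set U : 'Hom(subvs_of B, V) |
     isometry g (dot_sub g B) U /\ (limg U <= W)%VS].

Record polar_decomposition (F U : 'Hom(subvs_of B, V))
    (A : 'End(subvs_of B)) : Prop := PolarDecomposition {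
  polar_comp : F = (U \o A)%VF ;
  polar_isometry : isometries_into (limg F) U ;
  polar_self_adjoint : self_adjoint (dot_sub g B) A ;
  polar_positive_definite : positive_definite (dot_sub g B) A }.

End Sketch.

Arguments isometries_into {R V} g B W.

Section BorelStructures.
Variable R : realType.

HB.instance Definition _ (U V : vectType R) := isPointed.Build 'Hom(U, V) 0.
HB.instance Definition _ (V : vectType R) := isPointed.Build {vspace V} 0%VS.

(* The Borel sigma-algebra of the finite-dimensional space Hom(U, V): the one
   generated by the coordinates f |-> phi (f u), phi a linear functional. *)
Definition hom_generators (U V : vectType R) : set (set 'Hom(U, V)) :=
  [set A | exists (u : U) (phi : 'Hom(V, R^o)) (Y : set R),
     measurable Y /\ A = [set f : 'Hom(U, V) | Y (phi (f u))]].

Definition borel_hom (U V : vectType R) :=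
  g_sigma_algebraType (@hom_generators U V).

(* The Borel sigma-algebra of the Grassmannians: the topology on subspaces is
   that of their orthogonal projections. *)
Definition vspace_generators (V : vectType R) (g : {dot V for idfun}) :
    set (set {vspace V}) :=
  preimage_set_system setT (ortho_proj g)
    (measurable : set (set (borel_hom V V))).

Definition borel_vspace (V : vectType R) (g : {dot V for idfun}) :=
  g_sigma_algebraType (vspace_generators g).

HB.instance Definition _ (U V : vectType R) :=
  Measurable.on (borel_hom U V).
HB.instance Definition _ (V : vectType R) (g : {dot V for idfun}) :=
  Measurable.on (borel_vspace g).

End BorelStructures.

Section HaarUniform.
Context {d} {T : measurableType d} {R : realType}.

Definition invariant_law (D : set T) (act : set (T -> T))
    (mu : {measure set T -> \bar R}) : Prop :=
  [/\ mu setT = 1%E,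
      {ae mu, forall t, D t} &
      forall h A, act h -> measurable A -> mu (h @^-1` A) = mu A].

(* The uniqueness that makes the Haar law meaningful is part of the notion. *)
Definition haar_uniform (D : set T) (act : set (T -> T))
    (mu : {measure set T -> \bar R}) : Prop :=
  invariant_law D act mu /\
  forall nu : {measure set T -> \bar R}, invariant_law D act nu ->
    forall A, measurable A -> nu A = mu A.

End HaarUniform.

Section Actions.
Variables (R : realType) (V : vectType R) (g : {dot V for idfun}).
Variable B : {vspace V}.

Definition image_action : set (borel_vspace g -> borel_vspace g) :=
  [set h | exists2 Q, orthogonal_ops g Q &
     h = fun W : {vspace V} => (Q @: W)%VS].

Definition right_composition :
    set (borel_hom (subvs_of B) V -> borel_hom (subvs_of B) V) :=
  [set h | exists2 O, orthogonal_ops (dot_sub g B) O &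
     h = fun U : 'Hom(subvs_of B, V) => (U \o O)%VF].

End Actions.

Arguments image_action {R V} g.
Arguments right_composition {R V} g B.

Section Probability.
Local Open Scope ereal_scope.
Context {d} {Omega : measurableType d} {R : realType}.
Variable P : probability Omega R.

(* The library's [normal_prob m 0] is not the degenerate Gaussian law. *)
Definition gaussian_law (m s : R) (A : set R) : \bar R :=
  if s == 0%R then \d_m A else normal_prob m s A.

Definition gaussian (X : Omega -> R) : Prop :=
  measurable_fun setT X /\
  exists m s : R, forall A : set R, measurable A ->
    P (X @^-1` A) = gaussian_law m s A.

Definition jointly_gaussian (I : Type) (X : I -> Omega -> R) : Prop :=
  forall (n : nat) (i : 'I_n -> I) (a : 'I_n -> R),
    gaussian (fun w => \sum_(k < n) a k * X (i k) w)%R.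

Definition independent_RV d1 d2 (T1 : measurableType d1)
    (T2 : measurableType d2) (X : Omega -> T1) (Y : Omega -> T2) : Prop :=
  forall A1 A2, measurable A1 -> measurable A2 ->
    P (X @^-1` A1 `&` Y @^-1` A2) = P (X @^-1` A1) * P (Y @^-1` A2).

Definition conditional_law d1 d2 (T1 : measurableType d1)
    (T2 : measurableType d2) (X : Omega -> T1) (Y : Omega -> T2)
    (k : R.-pker T1 ~> T2) : Prop :=
  forall A1 A2, measurable A1 -> measurable A2 ->
    P (X @^-1` A1 `&` Y @^-1` A2) = \int[P]_(w in X @^-1` A1) k (X w) A2.

(* [E[X] = M] for a random operator [X], read entrywise. *)
Definition has_op_expectation (V : vectType R) (g : {dot V for idfun})
    (X : Omega -> 'End(V)) (M : 'End(V)) : Prop :=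
  forall u v : V, 'E_P[fun w => g (X w u) v] = (g (M u) v)%:E.

End Probability.

Section SketchingConditions.
Context {d} {Omega : measurableType d} {R : realType}.
Variable P : probability Omega R.
Variables (V : vectType R) (g : {dot V for idfun}) (B : {vspace V}).
(* The random sketching operator F Pi_B. *)
Variable S : Omega -> 'End(V).

Let F w : 'Hom(subvs_of B, V) := restr B (S w).
Let gB : {dot (subvs_of B) for idfun} := dot_sub g B.

Definition gaussian_sketching : Prop :=
  let X (p : subvs_of B * V) (w : Omega) : R := g (F w p.1) p.2 in
  [/\ jointly_gaussian P X,
      forall p, ('E_P[X p] = 0)%E &
      forall (u v : subvs_of B) (y z : V),
        ('E_P[(fun w => X (u, y) w * X (v, z) w)%R] = (gB u v * g y z)%R%:E)%E].

(* [Xi], [U] and [A] are the range and the polar factors of F; the latter are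
   determined almost surely. *)
Definition haar_grassmann_sketching : Prop :=
  exists (Xi : {RV P >-> borel_vspace g})
         (U : {RV P >-> borel_hom (subvs_of B) V})
         (A : {RV P >-> borel_hom (subvs_of B) (subvs_of B)}),
  [/\ (forall w, Xi w = limg (F w)) /\
      {ae P, forall w, polar_decomposition g (F w) (U w) (A w)},
      haar_uniform (T := borel_vspace g) (grassmannian (\dim B)) (image_action g)
        (distribution P Xi),
      [/\ {ae P, forall w, \dim (limg (F w)) = \dim B},
          exists k : R.-pker borel_vspace g ~> borel_hom (subvs_of B) V,
            conditional_law P Xi U k /\
            {ae P, forall w, haar_uniform (T := borel_hom (subvs_of B) V)
                               (isometries_into g B (Xi w))
                               (right_composition g B) (k (Xi w))} &
          independent_RV P U A] &
      has_op_expectation P gB (fun w => (A w \o A w)%VF)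
        ((\dim {:V})%:R *: \1%VF) /\
      ('E_P[(fun w => op_norm gB (A w)^-1%VF ^+ 2)%R] < +oo)%E].

End SketchingConditions.

(* Main.v *)
(* Write F = U A with A = (F^* F)^(1/2) and U = F A^-1. Square roots, projections
   on kernels and inverses are limits of polynomials in operators, so U and A are
   measurable functions of F, with U(Q F O) = Q U(F) O for orthogonal Q, O and
   A(Q F) = A(F). Cosine transforms determine laws, hence the law of F is
   invariant under F |-> Q F and F |-> F O.
   An invariant law for a transitive action by isometries is unique (compare the
   measures of small balls, after Christensen). This gives the Haar law of the
   range. Conditioning on an event of A leaves the law of U invariant under
   O(V), whence independence. The conditional law given the range W is the law
   of U(Pi_W F): mixing these laws over W = range F yields an O(V)-invariant law
   on isometries, which is therefore the law of U.
   Finally |A^-1|^2 <= sum_j delta_j^-2, where delta_j is the distance from the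
   j-th column of F to the span of the others. Resampling that column shows
   P(delta_j < eps) = O(eps^(d-l+1)) with d - l + 1 >= 3, so that the second
   moment of |A^-1| is finite. *)

From HB Require Import structures.
Require Import Defs.
From mathcomp Require Import all_boot all_order all_algebra.
From mathcomp Require Import all_classical all_reals all_analysis.
From mathcomp Require Import measurable_realfun.
From mathcomp Require Import ring lra zify.

Set Implicit Arguments.
Unset Strict Implicit.
Unset Printing Implicit Defensive.

Import Order.TTheory GRing.Theory Num.Theory.
Import numFieldNormedType.Exports.
Local Open Scope classical_set_scope.
Local Open Scope ring_scope.

(** * Uniqueness of invariant laws *)

(** [haar_uniform] demands uniqueness among invariant laws, and that same uniqueness does the work
    of independence and of conditioning: two laws are identified by showing both invariant. To make
    it available without a group measure, each space is described by finitely many real coordinates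
    in which the group acts by Euclidean isometries, transitively on the set that carries the law.
    The delicate clause is the conditional law of [U] given the range. An identity for the law of
    [U] alone is enough to obtain it: almost surely the range of [U] is that of F, and the kernel at
    W charges only isometries with range W, so every condition on the range is already a condition
    on [U]. Independence of Gaussian entries appears only as multiplicativity of the cosine
    transform: replacing some entries by those of an independent copy leaves the law unchanged. The
    bound d > l + 1 enters through the exponent 3. Where delta_j is about 2 ^ - k, delta_j ^ -2 is
    about 4 ^ k with probability of order 8 ^ - k, which is summable; an exponent 2 would give terms
    that do not decay. *)

Section Boxes.
Context d (T : measurableType d) (R : realType) (I : finType).
Variable e : I -> T -> R.

Definition open_box (a b : I -> R) : set T :=
  [set t | forall i, a i < e i t < b i].

Definition generated_by : Prop :=
  @measurable d T =
  <<s [set A | exists i (Y : set R), measurable Y /\ A = e i @^-1` Y] >>.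

Lemma measurable_forall_fin (A : I -> set T) :
  (forall i, measurable (A i)) -> measurable [set t | forall i, A i t].
Proof.
move=> mA; rewrite (_ : [set t | _] = \bigcap_(i in [set: I]) A i).
  exact: fin_bigcap_measurable.
by apply/seteqP; split=> [t At i _|t At i]; exact: At.
Qed.

Hypothesis me : forall i, measurable_fun setT (e i).

Lemma measurable_open_box a b : measurable (open_box a b).
Proof.
apply: measurable_forall_fin => i.
have := me i measurableT (@measurable_itv R `]a i, b i[).
by rewrite setTI; congr (measurable _); apply/seteqP; split=> t /=; rewrite in_itv.
Qed.

Hypothesis gen : generated_by.

(** Open boxes are stable under intersection, generate the sigma-algebra and, with bounds -k and k,
    exhaust the space. *)
Lemma eq_measure_open_box (mu nu : {measure set T -> \bar R}) :
  (mu setT < +oo)%E -> (forall a b, mu (open_box a b) = nu (open_box a b)) ->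
  forall A, measurable A -> mu A = nu A.
Proof.
move=> mufin munu.
pose G := [set A | exists a b, A = open_box a b].
apply: (measure_unique G (fun k => open_box (fun=> - k%:R) (fun=> k%:R))).
- apply/seteqP; split; last first.
    apply: smallest_sub; first exact: sigma_algebra_measurable.
    by move=> _ [a [b ->]]; exact: measurable_open_box.
  rewrite gen; apply: smallest_sub; first exact: smallest_sigma_algebra.
  move=> _ [i [Y [mY ->]]].
  have : @measurable_fun _ _ (g_sigma_algebraType G) R setT (e i).
    apply: (measurability (@RGenOInfty.G R)); first exact: RGenOInfty.measurableE.
    move=> _ [_ [x ->] <-].
    (* A half-line condition on one coordinate is an increasing union of boxes whose remaining
       bounds are -k and k. *)
    rewrite (_ : _ `&` _ = \bigcup_k open_box
        (fun j => if j == i then x else - k%:R) (fun=> k%:R)).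
      by apply: bigcupT_measurable => k; apply: sub_sigma_algebra; do 2 eexists.
    apply/seteqP; split=> t /=.
      rewrite in_itv/= andbT => -[_ xt].
      have [k tk] : exists k : nat, forall j, `|e j t| < k%:R.
        (* The sum dominates every coordinate at once, so one bound serves all of them. *)
        exists (Num.bound (\sum_j `|e j t|)) => j.
        apply: (le_lt_trans _ (archi_boundP _)); last exact: sumr_ge0.
        by rewrite (bigD1 j)//= lerDl sumr_ge0.
      exists k => // j; have := tk j; rewrite ltr_norml => /andP[k1 k2].
      by case: eqP => [->|_]; rewrite ?xt ?k1 /=; have := tk i;
        rewrite ltr_norml => /andP[].
    by move=> [k _ /(_ i)]; rewrite eqxx in_itv/= andbT => /andP[].
  by move=> /(_ measurableT Y mY); rewrite setTI.
- move=> _ _ [a [b ->]] [a' [b' ->]].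
  exists (fun i => Num.max (a i) (a' i)), (fun i => Num.min (b i) (b' i)).
  apply/seteqP; split=> t /=.
    by move=> [tab ta'b'] i; rewrite gt_max lt_min -!andbA;
      move: (tab i) (ta'b' i) => /andP[-> ->] /andP[-> ->].
  move=> h; split=> i; move: (h i); rewrite gt_max lt_min.
    by move=> /andP[/andP[-> _] /andP[-> _]].
  by move=> /andP[/andP[_ ->] /andP[_ ->]].
- by move=> k; do 2 eexists.
- apply/seteqP; split=> // t _.
  exists (Num.bound (\sum_j `|e j t|)) => // j; rewrite -ltr_norml.
  apply: (le_lt_trans _ (archi_boundP _)); last exact: sumr_ge0.
  by rewrite (bigD1 j)//= lerDl sumr_ge0.
- by move=> _ [a [b ->]].
- move=> k; apply: le_lt_trans mufin; apply: le_measure; rewrite ?inE//.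
  exact: measurable_open_box.
Qed.

End Boxes.

Lemma not_negligible_setT d (T : measurableType d) (R : realType)
  (P : probability T R) : ~ P.-negligible [set: T].
Proof.
move=> /negligibleP => /(_ measurableT) P0.
have /eqP := etrans (esym P0) (@probability_setT _ _ _ P).
by rewrite eq_sym eqe oner_eq0.
Qed.

Section UnitMeasure.
Context d (T : measurableType d) (R : realType) (mu : {measure set T -> \bar R}).
Hypothesis mu1 : mu setT = 1%E.

(** An alias of [mu] indexed by the proof of total mass one, to which the probability structure can
    be attached; invariant laws come as bare measures. *)
Definition unit_measure (_ : mu setT = 1%E) : set T -> \bar R := mu.

HB.instance Definition _ := Measure.copy (unit_measure mu1) mu.
HB.instance Definition _ := Measure_isProbability.Build _ _ _ (unit_measure mu1) mu1.

End UnitMeasure.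

Section InvariantLawUnique.
Context d (T : measurableType d) (R : realType) (I : finType).
Variable e : I -> T -> R.
Hypothesis me : forall i, measurable_fun setT (e i).
Hypothesis gen : generated_by e.

(** Squared Euclidean distance of the coordinates; comparing it with [r ^+ 2] keeps the condition
    polynomial, hence measurable. *)
Let rho x y := \sum_i (e i x - e i y) ^+ 2.
Let ball x (r : R) : set T := [set y | rho x y < r ^+ 2].

Variables (D : set T) (act : set (T -> T)).
Hypothesis act_iso : forall h, act h -> forall x y, rho (h x) (h y) = rho x y.
Hypothesis act_trans :
  forall x y, D x -> D y -> exists2 h, act h & h x = y.

Let rhoC x y : rho x y = rho y x.
Proof. by apply: eq_bigr => i _; rewrite -opprB sqrrN. Qed.

Let measurable_rho : measurable_fun setT (fun z : T * T => rho z.1 z.2).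
Proof.
apply: measurable_sum => i; apply: measurable_funX; apply: measurable_funB.
  by apply: measurableT_comp (me i) _; exact: measurable_fst.
by apply: measurableT_comp (me i) _; exact: measurable_snd.
Qed.

Let near_set (r : R) : measurable [set z : T * T | rho z.1 z.2 < r ^+ 2].
Proof.
have := measurable_rho measurableT (@measurable_itv R `]-oo, (r ^+ 2)[).
by rewrite setTI; congr (measurable _); apply/seteqP; split=> z /=; rewrite in_itv.
Qed.

Let measurable_ball x r : measurable (ball x r).
Proof.
have := measurable_xsection x (near_set r).
by congr measurable; apply/seteqP; split=> y /=; rewrite /xsection/= inE.
Qed.

(** An isometry taking [x] to [y] pulls the ball at [y] back to the ball at [x]. *)
Let ball_const (mu : {measure set T -> \bar R}) : invariant_law D act mu ->
  forall x y r, D x -> D y -> mu (ball x r) = mu (ball y r).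
Proof.
move=> [_ _ muact] x y r Dx Dy; have [h hact <-] := act_trans Dx Dy.
rewrite -(muact h (ball (h x) r))//; congr (mu _).
by apply/seteqP; split=> z; rewrite /ball/= act_iso.
Qed.

Let near_set_in (U : set T) (r : R) : measurable U ->
  measurable [set z : T * T | [/\ U z.1, U z.2 & rho z.1 z.2 < r ^+ 2]].
Proof.
move=> mU; rewrite (_ : [set _ | _] =
  (U `*` U) `&` [set z : T * T | rho z.1 z.2 < r ^+ 2]).
  by apply: measurableI; [exact: measurableX|exact: near_set].
by apply/seteqP; split=> z /=; [case|case=> -[]].
Qed.

(* Tonelli for the set of pairs in [U] at distance less than [r]. *)
Let cross_le (P1 P2 : probability T R) (U U' : set T) (r : R) (c1 c2 : \bar R) :
  measurable U -> measurable U' -> U' `<=` U ->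
  (forall x y, U' x -> rho x y < r ^+ 2 -> U y) ->
  {ae P1, forall t, D t} -> {ae P2, forall t, D t} ->
  (0 <= c1)%E -> (0 <= c2)%E ->
  (forall x, D x -> P1 (ball x r) = c1) ->
  (forall x, D x -> P2 (ball x r) = c2) -> (c1 * P2 U' <= c2 * P1 U)%E.
Proof.
move=> mU mU' U'U U'ball D1 D2 c10 c20 Pc1 Pc2.
pose A := [set z : T * T | [/\ U z.1, U z.2 & rho z.1 z.2 < r ^+ 2]].
have mA : measurable A by exact: near_set_in.
have := indic_fubini_tonelli P2 P1 mA.
rewrite indic_fubini_tonelli_FE// indic_fubini_tonelli_GE//= => PA.
have cU (Q : probability T R) (c : \bar R) V : (0 <= c)%E -> measurable V ->
    (\int[Q]_x (c * (\1_V x)%:E) = c * Q V)%E.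
  move=> c0 mV; rewrite ge0_integralZl//; last first.
    by apply/measurable_EFinP; exact: measurable_indic.
  by rewrite integral_indic// setIT.
(* The product measure of [A] is computed in both orders: sections at points of [U'] are whole
   balls, while sections in the other direction lie in balls and are empty off [U]. *)
apply: (@le_trans _ _ (\int[P2]_x P1 (xsection A x))%E).
  rewrite -cU//; apply: ae_ge0_le_integral => //.
  - by move=> x _; apply: mule_ge0 => //; rewrite lee_fin.
  - apply: emeasurable_funM => //.
    by apply/measurable_EFinP; exact: measurable_indic.
  - exact: measurable_fun_xsection.
  - apply: filterS D2 => x Dx _; rewrite indicE.
    have [|_] := boolP (x \in U'); last by rewrite mule0.
    rewrite inE mule1 -(Pc1 _ Dx) => U'x; apply: le_measure; rewrite ?inE//.
      exact: measurable_xsection.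
    by move=> y /= xy; rewrite /xsection/= inE; split; [exact: U'U|exact: U'ball xy|].
rewrite PA -cU//; apply: ae_ge0_le_integral => //.
- exact: measurable_fun_ysection.
- by move=> x _; apply: mule_ge0 => //; rewrite lee_fin.
- apply: emeasurable_funM => //.
  by apply/measurable_EFinP; exact: measurable_indic.
- apply: filterS D1 => y Dy _; rewrite indicE.
  have [|Uy] := boolP (y \in U); rewrite ?mule1 ?mule0.
    rewrite -(Pc2 _ Dy) => _; apply: le_measure; rewrite ?inE//.
      exact: measurable_ysection.
    by move=> x; rewrite /ysection/= inE => -[_ _]; rewrite /= rhoC.
  rewrite (_ : ysection A y = set0) ?measure0//.
  apply/seteqP; split=> // x; rewrite /ysection/= inE => -[_ /= Uy' _].
  by move: Uy; rewrite notin_setE; apply.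
Qed.

(** If one ball were null, all balls centred in [D] would be. A coordinate grid has countably many
    cells, and each cell meeting [D] lies in such a ball, so [D] would be null. *)
Let ball_gt0 (P : probability T R) x (r : R) : {ae P, forall t, D t} -> 0 < r ->
  (forall y, D y -> P (ball y r) = P (ball x r)) -> (0 < P (ball x r))%E.
Proof.
move=> PD r0 Pr; rewrite lt0e measure_ge0 andbT; apply/negP => /eqP Px0.
(* The squared diameter of a cell is at most n * delta ^ 2 with n = #|I|, which is below r ^ 2
   because n < (n + 1) ^ 2. *)
pose delta := r / #|I|.+1%:R.
have delta0 : 0 < delta by rewrite divr_gt0.
pose cell (z : {ffun I -> int}) :=
  [set t | forall i, (z i)%:~R <= e i t / delta < (z i)%:~R + 1].
have cell_null z : P.-negligible (cell z).
  have [[y [Dy zy]]|noD] := pselect (exists y, D y /\ cell z y).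
    apply: (@negligibleS _ _ _ P (ball y r)); last first.
      by apply/negligibleP; [exact: measurable_ball|exact: etrans (Pr _ Dy) Px0].
    move=> t zt; rewrite /ball/=.
    have dI i : (e i y - e i t) ^+ 2 <= delta ^+ 2.
      move: (zy i) (zt i) => /andP[y1 y2] /andP[t1 t2].
      rewrite -(real_normK (num_real (e i y - e i t))).
      rewrite ler_pXn2r ?nnegrE ?normr_ge0 ?(ltW delta0)//.
      have : `|e i y / delta - e i t / delta| <= 1 by rewrite ler_norml; lra.
      by rewrite -mulrBl normrM normfV (gtr0_norm delta0) ler_pdivrMr// mul1r.
    apply: (@le_lt_trans _ _ (\sum_(i : I) delta ^+ 2)).
      by apply: ler_sum => i _; exact: dI.
    rewrite sumr_const /delta expr_div_n -mulrnAr -mulr_natr.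
    rewrite gtr_pMr ?exprn_gt0// mulrC ltr_pdivrMr ?exprn_gt0// mul1r.
    apply: (@lt_le_trans _ _ #|I|.+1%:R); first by rewrite ltr_nat ltnSn.
    by rewrite -natrX ler_nat expnS expn1 leq_pmulr.
  apply: negligibleS PD => t zt Dt; apply: noD; by exists t.
have : P.-negligible [set: T].
  apply: (@negligibleS _ _ _ P
    (\bigcup_n if unpickle n is Some z then cell z else set0)).
    move=> t _; exists (pickle [ffun i => Num.floor (e i t / delta)]) => //.
    rewrite pickleK => i; rewrite ffunE.
    by rewrite -[X in _ + X]/(1%:~R) -intrD floor_itv ?num_real.
  by apply: negligible_bigcup => n; case: unpickle => // ; exact: negligible_set0.
exact: not_negligible_setT.
Qed.

(** Compare the box with its erosion by the radius, cancel the common positive measure of balls, and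
    let the radius tend to zero. *)
Let invariant_prob_le (P1 P2 : probability T R) :
  invariant_law D act P1 -> invariant_law D act P2 ->
  forall a b, (P2 (open_box e a b) <= P1 (open_box e a b))%E.
Proof.
move=> inv1 inv2 a b.
have [_ D1 _] := inv1; have [_ D2 _] := inv2.
have [[x Dx]|noD] := pselect (exists x, D x); last first.
  have : P1.-negligible setT.
    by apply: negligibleS D1 => t _ Dt; apply: noD; exists t.
  by move=> /not_negligible_setT.
(* On the whole space the comparison needs no margin, so both laws give the same measure to
   balls. *)
have cE r : P1 (ball x r) = P2 (ball x r).
  apply/eqP; rewrite eq_le; apply/andP; split.
    have := @cross_le P1 P2 setT setT r (P1 (ball x r)) (P2 (ball x r)).
    rewrite !probability_setT !mule1; apply=> // y Dy; exact: ball_const.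
  have := @cross_le P2 P1 setT setT r (P2 (ball x r)) (P1 (ball x r)).
  rewrite !probability_setT !mule1; apply=> // y Dy; exact: ball_const.
pose U k := [set t | forall i, a i + k.+1%:R^-1 <= e i t <= b i - k.+1%:R^-1].
have mU k : measurable (U k).
  apply: measurable_forall_fin => i.
  have := me i measurableT
    (@measurable_itv R `[a i + k.+1%:R^-1, b i - k.+1%:R^-1]).
  by rewrite setTI; congr (measurable _); apply/seteqP; split=> t /=; rewrite in_itv.
have UU k : U k `<=` open_box e a b.
  move=> t Ut i; move: (Ut i) => /andP[t1 t2].
  have k0 : 0 < k.+1%:R^-1 :> R by rewrite invr_gt0.
  by move: k0 t1 t2; move: (k.+1%:R^-1) => r *; apply/andP; split; lra.
have PU k : (P2 (U k) <= P1 (open_box e a b))%E.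
  have k0 : 0 < k.+1%:R^-1 :> R by rewrite invr_gt0.
  have := @cross_le P1 P2 (open_box e a b) (U k) k.+1%:R^-1
    (P1 (ball x k.+1%:R^-1)) (P1 (ball x k.+1%:R^-1))
    (measurable_open_box me a b) (mU k) (UU k).
  move=> /(_ _ D1 D2); rewrite lee_pmul2l; first apply => //.
  - move=> y t Uy yt i; move: (Uy i) => /andP[y1 y2].
    suff : `|e i y - e i t| < k.+1%:R^-1.
      move: y1 y2; rewrite ltr_norml; move: (k.+1%:R^-1) => r y1 y2 /andP[? ?].
      by apply/andP; split; lra.
    rewrite -(@ltr_pXn2r _ 2)// ?nnegrE ?ltW// real_normK ?num_real//.
    apply: le_lt_trans yt; rewrite /rho (bigD1 i)//= lerDl.
    by apply: sumr_ge0 => j _; exact: sqr_ge0.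
  - by move=> y Dy; exact: ball_const.
  - by move=> y Dy; rewrite cE; exact: ball_const.
  - exact: fin_num_measure.
  - by apply: ball_gt0 => // y Dy; exact: ball_const.
have Uup : \bigcup_k U k = open_box e a b.
  apply/seteqP; split=> [t [k _ /UU]//|t tab].
  (* An index beyond the sum of the inverse distances to all faces puts [t] in the eroded box. *)
  pose m := \sum_i ((e i t - a i)^-1 + (b i - e i t)^-1).
  have ge0 i : 0 <= (e i t - a i)^-1 + (b i - e i t)^-1.
    by move: (tab i) => /andP[? ?]; rewrite addr_ge0// invr_ge0; lra.
  have m0 : 0 <= m by apply: sumr_ge0.
  exists (Num.bound m) => // i; move: (tab i) => /andP[t1 t2].
  have mb : m < (Num.bound m).+1%:R.
    by apply: lt_trans (archi_boundP m0) _; rewrite ltr_nat.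
  have mi : (e i t - a i)^-1 + (b i - e i t)^-1 <= m.
    by rewrite /m (bigD1 i)//= lerDl sumr_ge0.
  have p1 : 0 < (e i t - a i)^-1 by rewrite invr_gt0; lra.
  have p2 : 0 < (b i - e i t)^-1 by rewrite invr_gt0; lra.
  have q1 : (Num.bound m).+1%:R^-1 <= e i t - a i.
    by rewrite -[leRHS]invrK lef_pV2 ?posrE//; lra.
  have q2 : (Num.bound m).+1%:R^-1 <= b i - e i t.
    by rewrite -[leRHS]invrK lef_pV2 ?posrE//; lra.
  by move: q1 q2; move: (_^-1) => r *; apply/andP; split; lra.
have ndU : nondecreasing_seq U.
  move=> k k' kk'; apply/subsetPset => t Ut i; move: (Ut i) => /andP[t1 t2].
  have : k'.+1%:R^-1 <= k.+1%:R^-1 :> R by rewrite lef_pV2 ?posrE// ler_nat.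
  move: t1 t2; move: (k.+1%:R^-1) (k'.+1%:R^-1) => r r' *.
  by apply/andP; split; lra.
have := nondecreasing_cvg_mu mU (bigcupT_measurable _ mU) ndU.
move=> /(_ R P2); rewrite Uup => cvgU.
rewrite -(cvg_lim _ cvgU)//; apply: lime_le; first by apply/cvg_ex; eexists; exact: cvgU.
exact: nearW.
Qed.

Lemma invariant_law_unique (mu nu : {measure set T -> \bar R}) :
  invariant_law D act mu -> invariant_law D act nu ->
  forall A, measurable A -> nu A = mu A.
Proof.
move=> imu inu.
have mu1 : mu setT = 1%E by case: imu.
have nu1 : nu setT = 1%E by case: inu.
pose P1 : probability T R := unit_measure mu1.
pose P2 : probability T R := unit_measure nu1.
apply: (eq_measure_open_box me gen).
  by rewrite nu1 ltry.
move=> a b; apply/eqP; rewrite eq_le; apply/andP; split.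
  exact: (@invariant_prob_le P1 P2).
exact: (@invariant_prob_le P2 P1).
Qed.

End InvariantLawUnique.

(** * Cosine transforms determine laws *)

Section TrigonometricPolynomials.
Variables (R : realType) (I : finType).
Implicit Types p q : (I -> R) -> R.

(** The real span of the cosines; the phase [b] brings in the sines, and the product-to-sum formula
    makes the span an algebra. *)
Inductive trigpoly : ((I -> R) -> R) -> Prop :=
| trig_cos a b : trigpoly (fun x => cos (\sum_i a i * x i + b))
| trig_lin c p q : trigpoly p -> trigpoly q ->
    trigpoly (fun x => c * p x + q x).

Lemma eq_trigpoly p q : p =1 q -> trigpoly p -> trigpoly q.
Proof. by move=> /funext ->. Qed.

Lemma trigpoly_cst c : trigpoly (fun=> c).
Proof.
have T1 : trigpoly (fun=> 1).
  apply: eq_trigpoly (trig_cos (fun=> 0) 0) => x.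
  by rewrite big1 ?add0r ?cos0// => i _; rewrite mul0r.
apply: eq_trigpoly (trig_lin (c - 1) T1 T1) => x; ring.
Qed.

Lemma trigpolyD p q : trigpoly p -> trigpoly q -> trigpoly (fun x => p x + q x).
Proof. by move=> tp tq; apply: eq_trigpoly (trig_lin 1 tp tq) => x; rewrite mul1r. Qed.

Lemma trigpolyZ c p : trigpoly p -> trigpoly (fun x => c * p x).
Proof.
by move=> tp; apply: eq_trigpoly (trig_lin c tp (trigpoly_cst 0)) => x; rewrite addr0.
Qed.

Lemma trigpolyM p q : trigpoly p -> trigpoly q -> trigpoly (fun x => p x * q x).
Proof.
move=> tp tq; elim: tp => [a b|c p1 p2 _ h1 _ h2]; last first.
  by apply: eq_trigpoly (trig_lin c h1 h2) => x; ring.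
elim: tq => [a' b'|c q1 q2 _ h1 _ h2]; last first.
  by apply: eq_trigpoly (trig_lin c h1 h2) => x; ring.
have := trigpolyD (trigpolyZ 2^-1 (trig_cos (fun i => a i + a' i) (b + b')))
  (trigpolyZ 2^-1 (trig_cos (fun i => a i - a' i) (b - b'))).
apply: eq_trigpoly => x.
set A := \sum_i a i * x i + b; set B := \sum_i a' i * x i + b'.
have -> : \sum_i (a i + a' i) * x i + (b + b') = A + B.
  rewrite /A /B addrACA -big_split/=; congr (_ + _).
  by apply: eq_bigr => i _; rewrite mulrDl.
have -> : \sum_i (a i - a' i) * x i + (b - b') = A - B.
  rewrite /A /B opprD addrACA -sumrB; congr (_ + _).
  by apply: eq_bigr => i _; rewrite mulrBl.
by rewrite cosD cosB; field.
Qed.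

Lemma trigpolyX n p : trigpoly p -> trigpoly (fun x => p x ^+ n).
Proof.
move=> tp; elim: n => [|n IH]; first exact: trigpoly_cst.
by apply: eq_trigpoly (trigpolyM tp IH) => x; rewrite exprS.
Qed.

Lemma trigpoly_prod (J : finType) (p : J -> (I -> R) -> R) :
  (forall j, trigpoly (p j)) -> trigpoly (fun x => \prod_j p j x).
Proof.
move=> tp; rewrite /index_enum; elim: (Finite.enum J) => [|j s IH].
  by apply: eq_trigpoly (trigpoly_cst 1) => x; rewrite big_nil.
by apply: eq_trigpoly (trigpolyM (tp j) IH) => x; rewrite big_cons.
Qed.

Lemma trigpoly_bounded p : trigpoly p -> exists M, forall x, `|p x| <= M.
Proof.
elim=> [a b|c p1 p2 _ [M1 h1] _ [M2 h2]].
  by exists 1 => x; rewrite ler_norml cos_geN1 cos_le1.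
exists (`|c| * M1 + M2) => x; apply: le_trans (ler_normD _ _) _.
by rewrite normrM lerD// ler_wpM2l.
Qed.

Lemma measurable_trigpoly d (T : measurableType d) (e : I -> T -> R) p :
  (forall i, measurable_fun setT (e i)) -> trigpoly p ->
  measurable_fun setT (fun t => p (e^~ t)).
Proof.
move=> me; elim=> [a b|c p1 p2 _ h1 _ h2].
  apply: measurableT_comp; first exact: continuous_measurable_fun (@continuous_cos R).
  apply: measurable_funD => //.
  by apply: measurable_sum => i; exact: measurable_funM.
by apply: measurable_funD => //; exact: measurable_funM.
Qed.

End TrigonometricPolynomials.

(** * Polynomial approximation of a step function *)

Section Step.
Variable R : realType.
Implicit Types t x : R.

Lemma bernoulli_ge n x : 0 <= x -> 1 + n%:R * x <= (1 + x) ^+ n.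
Proof.
move=> x0; elim: n => [|n IH]; first by rewrite mul0r addr0 expr0.
rewrite exprS; apply: le_trans (_ : (1 + x) * (1 + n%:R * x) <= _).
  have : 0 <= n%:R * x * x by rewrite !mulr_ge0.
  rewrite -natr1; move: (n%:R) => k h; lra.
by rewrite ler_wpM2l// addr_ge0.
Qed.

Lemma bernoulli_le n x : 0 <= x <= 1 -> 1 - n%:R * x <= (1 - x) ^+ n.
Proof.
move=> /andP[x0 x1]; elim: n => [|n IH]; first by rewrite mul0r subr0 expr0.
rewrite exprS; apply: le_trans (_ : (1 - x) * (1 - n%:R * x) <= _).
  have : 0 <= n%:R * x * x by rewrite !mulr_ge0.
  rewrite -natr1; move: (n%:R) => k h; lra.
by rewrite ler_wpM2l// subr_ge0.
Qed.

(* Polynomials in [t] converging on [0, 1] to the indicator of [t < 1/2],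
   including at [t = 1/2]. *)
Definition step_poly m t := (1 - t ^+ m.*2) ^+ (m * 4 ^ m).

Lemma step_poly_itv m t : 0 <= t <= 1 -> 0 <= step_poly m t <= 1.
Proof.
move=> /andP[t0 t1]; have h0 : 0 <= t ^+ m.*2 by exact: exprn_ge0.
have h1 : t ^+ m.*2 <= 1 by exact: exprn_ile1.
apply/andP; split; first by rewrite exprn_ge0// subr_ge0.
by rewrite exprn_ile1// ?subr_ge0// lerBlDr lerDl.
Qed.

(** With x = t ^ (2m) and N = m * 4 ^ m one has N * x = m * (2t) ^ (2m). Below 1/2 this tends to 0
    and Bernoulli gives the lower bound 1 - N * x; from 1/2 on it is at least m, and (1 - x) ^ N <=
    1 / (1 + N * x). *)
Lemma cvg_step_poly t : 0 <= t <= 1 ->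
  step_poly ^~ t @ \oo --> ((t < 2^-1)%R%:R : R).
Proof.
move=> t01; have /andP[t0 t1] := t01.
have NE m : (m * 4 ^ m)%:R * t ^+ m.*2 = m%:R * (2 * t) ^+ m.*2.
  rewrite natrM natrX -!mul2n [in RHS]exprM [in LHS]exprM -mulrA -exprMn.
  by congr (_ * _ ^+ _); ring.
have h0 m : 0 <= t ^+ m.*2 <= 1 by rewrite exprn_ge0// exprn_ile1.
have [t2|t2] := ltP t 2^-1; last first.
  apply: (@squeeze_cvgr _ _ _ _ (fun=> 0) (fun m => m.+1%:R^-1)); last 2 first.
  - exact: cvg_cst.
  - exact: cvg_harmonic.
  apply: nearW => m; have /andP[-> _] := step_poly_itv m t01.
  rewrite /=; set x := t ^+ m.*2.
  have /andP[x0 x1] : 0 <= x <= 1 by exact: h0.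
  rewrite -[leRHS]div1r ler_pdivlMr ?ltr0n// /step_poly -/x.
  apply: (@le_trans _ _ ((1 - x) ^+ (m * 4 ^ m) * (1 + x) ^+ (m * 4 ^ m))).
    rewrite ler_wpM2l ?exprn_ge0 ?subr_ge0//.
    apply: le_trans (bernoulli_ge _ x0).
    rewrite NE -natr1 addrC lerD2l -[leLHS]mulr1 ler_wpM2l//.
    by rewrite exprn_ege1//; lra.
  rewrite -exprMn exprn_ile1//; first by nra.
  by have : 0 <= x * x by [exact: mulr_ge0]; nra.
have [->|tn0] := eqVneq t 0.
  apply: (cvg_near_cst); exists 1%N => // m /= m1.
  by rewrite /step_poly expr0n double_eq0 eqn0Ngt m1 subr0 expr1n.
have tp : 0 < t by rewrite lt_neqAle eq_sym tn0.
pose q := 2 * t; have q0 : 0 < q by rewrite /q; lra.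
have q1 : q < 1 by rewrite /q; lra.
(* Bernoulli for (1 + h) ^ m = q ^ (- m) bounds m * q ^ m; the other factor q ^ m tends to zero. *)
pose h := q^-1 - 1.
have hp : 0 < h by rewrite subr_gt0 invf_gt1.
have mq m : m%:R * q ^+ m <= h^-1.
  rewrite -(ler_pM2r hp) mulVf ?gt_eqF// mulrAC -ler_pdivlMr ?exprn_gt0//.
  rewrite div1r -exprVn (_ : q^-1 = 1 + h); last by rewrite /h; ring.
  by apply: le_trans (bernoulli_ge _ (ltW hp)); lra.
apply: (@squeeze_cvgr _ _ _ _ (fun m => 1 - h^-1 * q ^+ m) (fun=> 1)); last 2 first.
- rewrite -[X in _ --> X]subr0; apply: cvgB; first exact: cvg_cst.
  rewrite -[X in _ --> X](mulr0 h^-1); apply: cvgM; first exact: cvg_cst.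
  by apply: cvg_expr; rewrite ger0_norm// ltW.
- exact: cvg_cst.
apply: nearW => m; have /andP[_ ->] := step_poly_itv m t01.
rewrite andbT; apply: le_trans (bernoulli_le _ (h0 m)); rewrite NE.
rewrite lerD2l lerN2 -/q -addnn exprD mulrA ler_wpM2r// exprn_ge0//.
exact: ltW.
Qed.

End Step.

Section CosineUniqueness.
Context d1 d2 (T1 : measurableType d1) (T2 : measurableType d2) (R : realType).
Context (I : finType) (P1 : probability T1 R) (P2 : probability T2 R).
Variables (e1 : I -> T1 -> R) (e2 : I -> T2 -> R).
Hypotheses (me1 : forall i, measurable_fun setT (e1 i))
  (me2 : forall i, measurable_fun setT (e2 i)).

Let same (p : (I -> R) -> R) :=
  (\int[P1]_t (p (e1^~ t))%:E = \int[P2]_t (p (e2^~ t))%:E)%E.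

Hypothesis cos_eq : forall a b, same (fun x => cos (\sum_i a i * x i + b)).

Let integrable_trig d (T : measurableType d) (P : probability T R)
  (e : I -> T -> R) p : (forall i, measurable_fun setT (e i)) -> trigpoly p ->
  P.-integrable setT (EFin \o (fun t => p (e^~ t))).
Proof.
move=> me tp; apply: measurable_bounded_integrable => //.
- exact: le_lt_trans (probability_le1 P measurableT) (ltry _).
- exact: measurable_trigpoly.
- have [M pM] := trigpoly_bounded tp.
  exists M; split; first exact: num_real.
  by move=> x Mx t _; exact: le_trans (pM _) (ltW Mx).
Qed.

Let same_trig p : trigpoly p -> same p.
Proof.
move=> tp; elim: tp => [a b|c p1 p2 tp1 h1 tp2 h2]; first exact: cos_eq.
rewrite /same; under eq_integral do rewrite EFinD EFinM.
under [RHS]eq_integral do rewrite EFinD EFinM.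
rewrite !integralD//=; last 4 first.
- by apply: integrableZl => //; exact: integrable_trig.
- exact: integrable_trig.
- by apply: integrableZl => //; exact: integrable_trig.
- exact: integrable_trig.
rewrite !integralZl//; try exact: integrable_trig.
by congr (_ * _ + _)%E.
Qed.

Let same_lim (f_ : nat -> (I -> R) -> R) f :
  (forall n, same (f_ n)) -> (forall n x, `|f_ n x| <= 1) ->
  (forall n, measurable_fun setT (fun t => f_ n (e1^~ t))) ->
  (forall n, measurable_fun setT (fun t => f_ n (e2^~ t))) ->
  (forall x, f_ ^~ x @ \oo --> f x) -> same f.
Proof.
move=> sf f1 m1 m2 ff.
have cvgI d (T : measurableType d) (P : probability T R) (e : I -> T -> R) :
    (forall n, measurable_fun setT (fun t => f_ n (e^~ t))) ->
    (\int[P]_t (f_ n (e^~ t))%:E @[n --> \oo] --> \int[P]_t (f (e^~ t))%:E)%E.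
  move=> me; apply: (@dominated_cvg _ _ _ _ _ _ _ _ (cst 1%E)) => //.
  - by move=> n; apply/measurable_EFinP; exact: me.
  - by move=> t _; apply: cvg_EFin; [exact: nearW|exact: ff].
  - exact: finite_measure_integrable_cst.
  - by move=> n t _; rewrite lee_fin; exact: f1.
have c1 := cvgI _ _ P1 _ m1; have c2 := cvgI _ _ P2 _ m2.
have E : (fun n => \int[P1]_t (f_ n (e1^~ t))%:E)%E =
         (fun n => \int[P2]_t (f_ n (e2^~ t))%:E)%E.
  by apply/funext => n; exact: sf.
by move: c1; rewrite E => c1; exact: (cvg_unique _ c1 c2).
Qed.

Let prod_bool (s : I -> bool) : \prod_i (s i)%:R = [forall i, s i]%:R :> R.
Proof.
have [/forallP h|/forallPn[i /negbTE si]] := boolP [forall i, s i].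
  by rewrite big1// => i _; rewrite h.
by rewrite (bigD1 i)//= si mul0r.
Qed.

(** The affine map in [u] reverses the order, sends the threshold [c i] to 1/2 and keeps the values
    in [0, 1], where the step polynomials converge. *)
Let same_cos_gt (th y c : I -> R) : (forall i, `|c i| <= 1) ->
  same (fun x => \prod_i (c i < cos (th i * (x i - y i)))%R%:R).
Proof.
move=> c1; pose u i (x : I -> R) :=
  2^-1 + (c i - cos (th i * (x i - y i))) / 4.
have u01 i x : 0 <= u i x <= 1.
  have := c1 i; rewrite ler_norml /u => /andP[h1 h2].
  have := cos_le1 (th i * (x i - y i)).
  have := cos_geN1 (th i * (x i - y i)).
  by move: (cos _) => z *; apply/andP; split; lra.
have tu i : trigpoly (u i).
  have := trig_cos (fun j => if j == i then th i else 0) (- th i * y i).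
  move=> /(trigpolyZ (- 4^-1)) /(trigpolyD (trigpoly_cst I (2^-1 + c i / 4))).
  apply: eq_trigpoly => x; rewrite /u (bigD1 i)//= eqxx big1 => [|j /negbTE ->].
    by rewrite addr0 (_ : th i * x i + _ = th i * (x i - y i)); [field|ring].
  by rewrite mul0r.
have tf n : trigpoly (fun x => \prod_i step_poly n (u i x)).
  apply: trigpoly_prod => i; apply: trigpolyX.
  apply: eq_trigpoly (trigpolyD (trigpoly_cst I 1)
    (trigpolyZ (-1) (trigpolyX n.*2 (tu i)))) => x.
  by rewrite mulN1r.
apply: (same_lim (f_ := fun n x => \prod_i step_poly n (u i x))).
- by move=> n; exact: same_trig.
- move=> n x; rewrite ger0_norm; first last.
    by apply: prodr_ge0 => i _; case/andP: (step_poly_itv n (u01 i x)).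
  by apply: prodr_ile1 => i _; exact: step_poly_itv.
- by move=> n; exact: measurable_trigpoly (tf n).
- by move=> n; exact: measurable_trigpoly (tf n).
- move=> x; apply: cvg_big => [|i _]; first exact: mul_continuous.
  rewrite (_ : (c i < _)%R = (u i x < 2^-1)%R); first exact: cvg_step_poly.
  by rewrite /u; move: (cos _) => z; apply/idP/idP; lra.
Qed.

(** Cosine decreases on [0, pi], so at a small frequency |x - y| < r is a comparison of cosines;
    along the frequencies 1 / (n + 1) the indicators are eventually constant. *)
Let same_ball (y r : I -> R) : (forall i, 0 < r i) ->
  same (fun x => \prod_i (`|x i - y i| < r i)%R%:R).
Proof.
move=> r0; pose th n : R := n.+1%:R^-1.
have mf d (T : measurableType d) (e : I -> T -> R) n :
    (forall i, measurable_fun setT (e i)) -> measurable_fun setT (fun t =>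
      \prod_i (cos (th n * r i) < cos (th n * (e i t - y i)))%R%:R : R).
  move=> me; apply: measurable_prod => i _.
  apply: (measurableT_comp (f := fun b : bool => b%:R : R)) => //.
  apply: measurable_fun_ltr => //.
  apply: measurableT_comp; first exact: continuous_measurable_fun (@continuous_cos R).
  by apply: measurable_funM => //; exact: measurable_funB.
apply: (same_lim (f_ := fun n x =>
  \prod_i (cos (th n * r i) < cos (th n * (x i - y i)))%R%:R)).
- by move=> n; apply: same_cos_gt => i; rewrite ler_norml cos_geN1 cos_le1.
- by move=> n x; rewrite prod_bool; case: [forall _, _]; rewrite ?normr1 ?normr0.
- by move=> n; exact: mf.
- by move=> n; exact: mf.
have big (M : R) : \forall n \near \oo, `|M| < n.+1%:R.
  exists (Num.bound `|M|) => // n /= bn; apply: lt_trans (archi_boundP _) _ => //.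
  by rewrite ltr_nat.
move=> x; apply: cvg_big => [|i _]; first exact: mul_continuous.
apply: cvg_near_cst; near=> n.
have thr (z : R) : (`|z| < n.+1%:R)%R -> 0 <= th n * `|z| <= pi.
  move=> zn; rewrite mulr_ge0 ?invr_ge0//=.
  apply: (@le_trans _ _ 1); last by have := @pi_ge2 R; lra.
  by rewrite mulrC ler_pdivrMr ?ltr0n// mul1r ltW.
have b1 : `|r i| < n.+1%:R by near: n; exact: big.
have b2 : `|x i - y i| < n.+1%:R by near: n; exact: big.
have th0 : 0 < th n by rewrite invr_gt0.
have -> : cos (th n * (x i - y i)) = cos (th n * `|x i - y i|).
  by have [_|_] := ger0P (x i - y i) => //; rewrite mulrN cosN.
rewrite ltr_cos ?in_itv//= ?thr//; last by have := thr _ b1; rewrite gtr0_norm.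
by rewrite ltr_pM2l.
Unshelve. all: end_near. Qed.

Theorem cos_box_eq a b : P1 (open_box e1 a b) = P2 (open_box e2 a b).
Proof.
have [/forallP ab|/forallPn[i]] := boolP [forall i, a i < b i]; last first.
  rewrite -leNgt => ba; have e0 d (T : measurableType d) (e : I -> T -> R) : open_box e a b = set0.
    apply/seteqP; split=> // t /(_ i)/andP[at_ tb].
    by have := lt_le_trans (lt_trans at_ tb) ba; rewrite ltxx.
  by rewrite !e0 !measure0.
pose y i := (a i + b i) / 2; pose r i := (b i - a i) / 2.
have r0 i : 0 < r i by have := ab i; rewrite /r; lra.
have intE d (T : measurableType d) (P : probability T R) (e : I -> T -> R) :
    (forall i, measurable_fun setT (e i)) ->
    (\int[P]_t (\prod_i (`|e i t - y i| < r i)%R%:R)%:E = P (open_box e a b))%E.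
  move=> me; transitivity (\int[P]_t (\1_(open_box e a b) t)%:E)%E; last first.
    by rewrite integral_indic ?setIT//; exact: measurable_open_box.
  apply: eq_integral => t _; rewrite prod_bool indicE.
  suff -> : [forall i, `|e i t - y i| < r i] = (t \in open_box e a b) by [].
  apply/idP/idP.
    move=> /forallP h; rewrite inE => i; have := h i; rewrite ltr_norml /y /r.
    by move=> /andP[? ?]; apply/andP; split; lra.
  rewrite inE => h; apply/forallP => i; have /andP[? ?] := h i.
  by rewrite ltr_norml /y /r; apply/andP; split; lra.
by rewrite -!intE//; exact: same_ball.
Qed.

End CosineUniqueness.

(** * Gaussian variables *)

Section Density.
Import HBNNSimple.
Context d (T : measurableType d) (R : realType).
Variables (mu nu : {measure set T -> \bar R}) (p : T -> R).
Hypotheses (mp : measurable_fun setT p) (p0 : forall x, 0 <= p x).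
Hypothesis nuE : forall A, measurable A -> nu A = (\int[mu]_(x in A) (p x)%:E)%E.

Let integral_density_indic E : measurable E ->
  (\int[nu]_x (\1_E x)%:E = \int[mu]_x ((\1_E x)%:E * (p x)%:E))%E.
Proof.
move=> mE; rewrite integral_indic// setIT nuE// integral_mkcond.
apply: eq_integral => x _; rewrite patchE indicE.
by case: ifPn; rewrite ?mul1e ?mul0e.
Qed.

Let integral_density_nnsfun (f : {nnsfun T >-> R}) :
  (\int[nu]_x (f x)%:E = \int[mu]_x ((f x)%:E * (p x)%:E))%E.
Proof.
under [LHS]eq_integral do rewrite fimfunE -fsumEFin//.
rewrite [LHS]ge0_integral_fsum//; last 2 first.
  - by move=> r; exact/measurable_EFinP/measurableT_comp.
  - by move=> n x _; rewrite EFinM nnfun_muleindic_ge0.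
under [RHS]eq_integral.
  move=> x xD; rewrite fimfunE -fsumEFin// ge0_mule_fsuml; last first.
    by move=> r; rewrite EFinM nnfun_muleindic_ge0.
  over.
rewrite [RHS]ge0_integral_fsum//; last 2 first.
  - move=> r; apply: emeasurable_funM; apply/measurable_EFinP => //.
    exact/measurableT_comp.
  - by move=> n x _; rewrite EFinM mule_ge0 ?nnfun_muleindic_ge0// lee_fin.
apply: eq_fsbigr => r _.
under [RHS]eq_integral do rewrite EFinM -muleA.
have mI : measurable_fun setT (fun x => (\1_(f @^-1` [set r]) x)%:E : \bar R).
  exact/measurable_EFinP.
have [r0|r0] := ltP r 0.
  have fr0 : f @^-1` [set r] = set0 by exact: preimage_nnfun0.
  rewrite fr0 indic0 !integral0_eq// => x _; rewrite ?mulr0 ?mul0e ?mule0//.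
rewrite ge0_integralZl//; last first.
- by move=> x _; rewrite mule_ge0 ?lee_fin.
- by apply: emeasurable_funM => //; exact/measurable_EFinP.
rewrite -integral_density_indic// -ge0_integralZl//.
Qed.

Lemma ge0_integral_density (f : T -> \bar R) :
  measurable_fun setT f -> (forall x, 0 <= f x)%E ->
  (\int[nu]_x f x = \int[mu]_x (f x * (p x)%:E))%E.
Proof.
move=> mf f0; pose f_ := nnsfun_approx measurableT mf.
have cf x : (f_ n x)%:E @[n --> \oo] --> f x by exact: cvg_nnsfun_approx.
have ndf x : {homo (fun n => f_ n x) : m n / (m <= n)%N >-> m <= n}.
  by move=> m n mn; exact/lefP/nd_nnsfun_approx.
transitivity (lim (\int[nu]_x (f_ n x)%:E @[n --> \oo])%E).
  rewrite -monotone_convergence//=.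
  - by apply: eq_integral => x _; apply/esym/cvg_lim => //; exact: cf.
  - by move=> n; exact/measurable_EFinP.
  - by move=> n x _; rewrite lee_fin.
  - by move=> x _ m n mn; rewrite lee_fin; exact: ndf.
transitivity (lim (\int[mu]_x ((f_ n x)%:E * (p x)%:E) @[n --> \oo])%E).
  by apply: congr_lim; apply/funext => n /=; exact: integral_density_nnsfun.
rewrite -monotone_convergence//=.
- apply: eq_integral => x _; apply/cvg_lim => //.
  by apply: cvgeMr => //; exact: cf.
- by move=> n; apply: emeasurable_funM; exact/measurable_EFinP.
- by move=> n x _; rewrite mule_ge0 ?lee_fin.
- by move=> x _ m n mn; rewrite lee_wpmul2r ?lee_fin//; exact: ndf.
Qed.

End Density.

(** * Moments, convolution and characteristic function of normal laws *)

Section NormalIntegrals.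
Variable R : realType.
Local Notation mu := (@lebesgue_measure R).
Implicit Types (h : R -> R) (m s t : R).

(** The scale [s] of a [gaussian_law] may be negative; this reduces it to a positive one. *)
Lemma normal_pdf_abs m s : normal_pdf m `|s| = normal_pdf m s.
Proof.
apply/funext => x; rewrite /normal_pdf normr_eq0; case: ifP => // _.
by rewrite /normal_peak /normal_fun real_normK ?num_real.
Qed.

Let mpdf m s : measurable_fun setT (fun x : R => (normal_pdf m s x)%:E).
Proof. by apply/measurable_EFinP; exact: measurable_normal_pdf. Qed.

Lemma integral_normal_prob m s (f : R -> \bar R) :
  measurable_fun setT f -> (forall x, 0 <= f x)%E ->
  (\int[normal_prob m s]_x f x = \int[mu]_x (f x * (normal_pdf m s x)%:E))%E.
Proof.
move=> mf f0; apply: ge0_integral_density => //.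
- exact: measurable_normal_pdf.
- by move=> x; exact: normal_pdf_ge0.
Qed.

Let gam : probability (measurableTypeR R) R := normal_prob (0 : R) 1.

Lemma normal_pdf_affine m s (y : R) : 0 < s ->
  normal_pdf m s (s * y + m) * s = normal_pdf 0 1 y.
Proof.
move=> s0; have sN0 : s != 0 by rewrite gt_eqF.
rewrite !normal_pdfE// /normal_peak /normal_fun addrK mulrAC; congr (_ * _).
  rewrite expr1n mul1r -mulrnAr sqrtrM ?sqr_ge0// sqrtr_sqr gtr0_norm//.
  by rewrite invfM mulrAC mulVf// mul1r.
congr expR; rewrite subr0 expr1n exprMn -mulrN -[s ^+ 2 *+ 2]mulr_natr invfM.
by rewrite mulrACA mulfV ?mul1r// sqrf_eq0.
Qed.

Let sqrt2_neq0 : Num.sqrt 2 != 0 :> R.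
Proof. by rewrite sqrtr_eq0 -ltNge. Qed.

(** With z = x ^ 2 / 4 this is z <= exp z; it bounds the second moment by a multiple of the mass of
    the normal law with scale sqrt 2. *)
Let sqr_normal_pdf_le (x : R) : x ^+ 2 * normal_pdf 0 1 x <=
  4 * normal_peak 1 / normal_peak (Num.sqrt 2) * normal_pdf 0 (Num.sqrt 2) x.
Proof.
rewrite !normal_pdfE//.
have p2 := @normal_peak_gt0 R _ sqrt2_neq0.
have p1 := @normal_peak_ge0 R 1.
have h : x ^+ 2 * normal_fun 0 1 x <= 4 * normal_fun 0 (Num.sqrt 2) x.
  rewrite /normal_fun subr0 sqr_sqrtr// expr1n.
  set z := x ^+ 2 / 4.
  have -> : - x ^+ 2 / (1 *+ 2) = - z - z by rewrite /z mulr2n; field.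
  have -> : - x ^+ 2 / (2 *+ 2) = - z by rewrite /z mulr2n; field.
  have -> : x ^+ 2 = 4 * z by rewrite /z; field.
  rewrite expRD mulrA ler_wpM2r ?expR_ge0// expRN.
  by rewrite ler_pdivrMr ?expR_gt0//; have := expR_ge1Dx z; lra.
move: h p2 p1; move: (normal_fun _ _ _) (normal_fun _ _ _) => u v.
move: (normal_peak _) (normal_peak _) => q p h p0 q0.
have -> : 4 * q / p * (p * u) = q * (4 * u).
  by rewrite (mulrA _ p) divfK ?gt_eqF// mulrAC mulrC.
by rewrite mulrCA; exact: ler_wpM2l.
Qed.

Lemma integral_normal_std m s h : 0 < s -> continuous h -> (forall x, 0 <= h x) ->
  (\int[normal_prob m s]_x (h x)%:E = \int[gam]_y (h (s * y + m))%:E)%E.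
Proof.
move=> s0 ch h0; have sN0 : s != 0 by rewrite gt_eqF.
have mh : measurable_fun setT h by exact: continuous_measurable_fun.
have mhE : measurable_fun setT (EFin \o h) by exact/measurable_EFinP.
have mhs : measurable_fun setT (EFin \o (fun y => h (s * y + m))).
  apply/measurable_EFinP/measurableT_comp => //.
  by apply: measurable_funD => //; exact: measurable_funM.
have h0E x : (0 <= (EFin \o h) x)%E by rewrite lee_fin.
have hs0E x : (0 <= (EFin \o (fun y : R => (h (s * y + m))%R)) x)%E by rewrite lee_fin.
rewrite (integral_normal_prob m s mhE h0E) (integral_normal_prob 0 1 mhs hs0E)/=.
under eq_integral do rewrite -EFinM.
have F'E : (fun y : R^o => y * s + m)^`()%classic = cst s.
  apply/funext => x; rewrite derive1E deriveD// deriveM// derive_cst.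
  by rewrite derive_id derive_cst scaler0 addr0 add0r /GRing.scale/= mulr1.
rewrite (@increasing_ge0_integration_by_substitutionT _
    (fun y => y * s + m) (fun x => h x * normal_pdf m s x)).
- apply: eq_integral => y _; rewrite F'E -EFinM; congr EFin.
  change (h ((y : R) * s + m) * normal_pdf m s ((y : R) * s + m) * s =
    h (s * (y : R) + m) * normal_pdf 0 1 y).
  by rewrite [(y : R) * s]mulrC -mulrA normal_pdf_affine.
- by move=> x y xy; rewrite ltrD2r ltr_pM2r.
- by rewrite F'E => x; exact: cvg_cst.
- by rewrite F'E; exact: is_cvg_cst.
- by rewrite F'E; exact: is_cvg_cst.
- by move=> x; exact: ex_derive.
- apply: cvg_comp (@cvg_addrr_Ny R m).
  by apply/gt0_cvgMlNy => //; exact: cvg_id.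
- apply: cvg_comp (@cvg_addrr R m).
  by apply/gt0_cvgMly => //; exact: cvg_id.
- by move=> x; apply: cvgM; [exact: ch|exact: continuous_normal_pdf].
- by move=> x; rewrite mulr_ge0// normal_pdf_ge0.
Qed.

Lemma integral_normal_sym h : measurable_fun setT h -> (forall x, 0 <= h x) ->
  (\int[gam]_x (h x)%:E = \int[gam]_x (h (- x))%:E)%E.
Proof.
move=> mh h0.
have mhN : measurable_fun setT (fun x : R => h (- x)) by exact: measurableT_comp.
have mhE : measurable_fun setT (EFin \o h) by exact/measurable_EFinP.
have mhNE : measurable_fun setT (EFin \o (fun x : R => h (- x))).
  exact/measurable_EFinP.
have h0E x : (0 <= (EFin \o h) x)%E by rewrite lee_fin.
have hN0E x : (0 <= (EFin \o (fun x : R => (h (- x))%R)) x)%E by rewrite lee_fin.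
rewrite (integral_normal_prob 0 1 mhE h0E) (integral_normal_prob 0 1 mhNE hN0E)/=.
transitivity (\int[pushforward mu (-%R : _ -> measurableTypeR R)]_x
    ((h x)%:E * (normal_pdf 0 1 x)%:E))%E.
  by apply: eq_measure_integral => //= A mA AS; exact/esym/lebesgue_measureN.
rewrite ge0_integral_pushforward.
- apply: eq_integral => x _; rewrite /= !normal_pdfE// /normal_fun !subr0 sqrrN.
  by [].
- exact: oppr_measurable.
- exact: measurableT.
- by apply: emeasurable_funM; [exact: mhE|exact: mpdf].
- by move=> x _; rewrite mule_ge0 ?lee_fin ?normal_pdf_ge0.
Qed.

(** The variance of the standard normal law, kept as a symbol: Gaussian laws are normalised through
    it, using that it is finite and positive. *)
Definition normal_var : R := fine (\int[gam]_x (x ^+ 2)%:E).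

Let msqr : measurable_fun setT (fun x : R => (x ^+ 2)%:E).
Proof. exact/measurable_EFinP/measurable_funX. Qed.

Let sqr0 (x : R) : (0 <= (x ^+ 2)%:E)%E.
Proof. by rewrite lee_fin sqr_ge0. Qed.

Let var_fin : (\int[gam]_x (x ^+ 2)%:E < +oo)%E.
Proof.
rewrite (integral_normal_prob 0 1 msqr sqr0).
pose c : R := 4 * normal_peak 1 / normal_peak (Num.sqrt 2).
apply: (@le_lt_trans _ _ (\int[mu]_x (c%:E * (normal_pdf 0 (Num.sqrt 2) x)%:E))%E).
  apply: ge0_le_integral => //.
  - by move=> x _; rewrite mule_ge0 ?lee_fin ?sqr_ge0 ?normal_pdf_ge0.
  - apply: emeasurable_funM => //.
    exact: mpdf.
  - by apply: emeasurable_funM => //; exact: mpdf.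
  - by move=> x _; rewrite -!EFinM lee_fin; exact: sqr_normal_pdf_le.
rewrite ge0_integralZl//.
- by rewrite integral_normal_pdf mule1 ltry.
- exact: mpdf.
- by move=> x _; rewrite lee_fin normal_pdf_ge0.
- by rewrite lee_fin divr_ge0 ?mulr_ge0 ?normal_peak_ge0.
Qed.

Lemma normal_varE : (\int[gam]_x (x ^+ 2)%:E = normal_var%:E)%E.
Proof.
rewrite fineK// ge0_fin_numE//; apply: integral_ge0 => x _.
by rewrite lee_fin sqr_ge0.
Qed.

(** Otherwise x ^ 2 times the density would vanish almost everywhere, whereas it vanishes only at
    0. *)
Lemma normal_var_gt0 : 0 < normal_var.
Proof.
rewrite lt_neqAle; apply/andP; split; last first.
  by rewrite fine_ge0// integral_ge0// => x _; rewrite lee_fin sqr_ge0.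
apply/negP => /eqP/esym v0; have := normal_varE; rewrite v0 => /eqP.
rewrite (integral_normal_prob 0 1 msqr sqr0).
have m1 : measurable_fun setT
    (fun x : R => (x ^+ 2)%:E * (normal_pdf 0 1 x)%:E : \bar R)%E.
  by apply: emeasurable_funM => //; exact: mpdf.
have f0 (x : R) : (0 <= (x ^+ 2)%:E * (normal_pdf 0 1 x)%:E)%E.
  by rewrite mule_ge0 ?lee_fin ?sqr_ge0 ?normal_pdf_ge0.
move=> /eqP int0; have : (\int[mu]_x `|(x ^+ 2)%:E * (normal_pdf 0 1 x)%:E| = 0)%E.
  by apply: etrans int0; apply: eq_integral => x _; rewrite gee0_abs.
move/(ae_eq_integral_abs mu measurableT m1).
move=> [N [mN N0 sN]].
have : (mu setT <= mu N + mu [set 0%R])%E.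
  have m0 : measurable [set 0 : R] by exact: measurable_set1.
  apply: (le_trans _ (measureU2 mu mN m0)).
  apply: le_measure; rewrite ?inE//; first exact: measurableU.
  move=> x _; have [->|x0] := eqVneq x 0; first by right.
  left; apply: sN => /= /(_ Logic.I) /eqP.
  rewrite -EFinM eqe mulf_eq0 sqrf_eq0 (negbTE x0)/= normal_pdfE// mulf_eq0.
  by rewrite gt_eqF ?normal_peak_gt0// gt_eqF// expR_gt0.
rewrite N0 lebesgue_measure_set1 adde0 -set_itvNyy lebesgue_measure_itv/=.
by rewrite leye_eq.
Qed.

(** Completing the square in [y]. *)
Let normal_exponent_conv s t (u y : R) : s != 0 -> s ^+ 2 + t ^+ 2 != 0 ->
  - (u - t * y) ^+ 2 / (s ^+ 2 * 2) + (- y ^+ 2 / 2) =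
  - u ^+ 2 / ((s ^+ 2 + t ^+ 2) * 2) +
  - (y - t * u / (s ^+ 2 + t ^+ 2)) ^+ 2 / (s ^+ 2 / (s ^+ 2 + t ^+ 2) * 2).
Proof. by move=> s0 D0; field; rewrite s0 D0. Qed.

(** For u = s x + t y with x, y independent standard normal, the joint density of (u, y) is the
    marginal of [u] times the conditional density of [y] given [u]. *)
Lemma normal_pdf_conv s t (u y : R) (r := Num.sqrt (s ^+ 2 + t ^+ 2)) :
  0 < s -> normal_pdf (t * y) s u * normal_pdf 0 1 y =
  normal_pdf 0 r u * normal_pdf (t * u / r ^+ 2) (s / r) y.
Proof.
move=> s0; have sN0 : s != 0 by rewrite gt_eqF.
have r2 : r ^+ 2 = s ^+ 2 + t ^+ 2 by rewrite sqr_sqrtr// addr_ge0 ?sqr_ge0.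
have r2p : 0 < r ^+ 2 by rewrite r2 ltr_wpDr ?sqr_ge0// exprn_gt0.
have rN0 : r != 0 by rewrite -sqrf_eq0 gt_eqF.
have srN0 : s / r != 0 by rewrite mulf_neq0 ?invr_eq0.
rewrite !normal_pdfE// /normal_peak /normal_fun.
rewrite mulrACA [RHS]mulrACA -!expRD -!invfM; congr (_^-1 * expR _).
  rewrite -!sqrtrM; do ?by rewrite mulrn_wge0// mulr_ge0 ?sqr_ge0 ?pi_ge0.
  congr Num.sqrt; rewrite expr_div_n expr1n mul1r mulrnAl [RHS]mulrnAl; congr (_ *+ 2).
  by rewrite !mulrnAr; congr (_ *+ 2); field.
rewrite expr_div_n r2 expr1n !subr0 -(mulr_natr (s ^+ 2)).
rewrite -(mulr_natr (s ^+ 2 + t ^+ 2)) -(mulr_natr (s ^+ 2 / _)).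
by rewrite normal_exponent_conv// -r2 gt_eqF.
Qed.

(** Substitute u = s x + t y in the inner integral, exchange the integrals, and integrate out [y]
    with the factorised joint density. *)
Lemma integral_normal_conv s t h : 0 < s ->
  continuous h -> (forall x, 0 <= h x) ->
  (\int[gam]_y \int[gam]_x (h (s * x + t * y))%:E =
   \int[gam]_x (h (Num.sqrt (s ^+ 2 + t ^+ 2) * x))%:E)%E.
Proof.
move=> s0 ch h0; set r := Num.sqrt _.
have r2p : 0 < s ^+ 2 + t ^+ 2 by rewrite ltr_wpDr ?sqr_ge0// exprn_gt0.
have r0 : 0 < r by rewrite sqrtr_gt0.
have mh : measurable_fun setT (fun x : R => (h x)%:E).
  by apply/measurable_EFinP; exact: continuous_measurable_fun.
have hE0 (x : R) : (0 <= (h x)%:E)%E by rewrite lee_fin.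
have pE0 m s' (x : R) : (0 <= (normal_pdf m s' x)%:E)%E.
  by rewrite lee_fin normal_pdf_ge0.
pose k (z : R * R) := ((h z.2)%:E * (normal_pdf (t * z.1) s z.2)%:E)%E.
have k0 z : (0 <= k z)%E by rewrite mule_ge0.
have mk : measurable_fun setT k.
  apply: emeasurable_funM; first exact: measurableT_comp mh measurable_snd.
  apply/measurable_EFinP.
  rewrite (_ : (fun z => _) = (fun z : R * R =>
      normal_peak s * expR (- (z.2 - t * z.1) ^+ 2 / (s ^+ 2 *+ 2)))); last first.
    by apply/funext => z; rewrite normal_pdfE// gt_eqF.
  apply: measurable_funM => //; apply: measurableT_comp => //.
  apply: measurable_funM => //; apply: measurableT_comp => //.
  apply: measurable_funX; apply: measurable_funB; first exact: measurable_snd.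
  by apply: measurable_funM => //; exact: measurable_fst.
transitivity (\int[gam]_y \int[mu]_u k (y, u))%E.
  apply: eq_integral => y _; rewrite -integral_normal_std// integral_normal_prob//.
have mF : measurable_fun setT (fun y => \int[mu]_u k (y, u))%E.
  exact: (measurable_fun_fubini_tonelli_F (m2 := mu)).
rewrite integral_normal_prob//; last by move=> y; exact: integral_ge0.
pose k' (z : R * R) := (k z * (normal_pdf 0 1 z.1)%:E)%E.
have mk' : measurable_fun setT k'.
  by apply: emeasurable_funM => //; exact: measurableT_comp (mpdf 0 1) measurable_fst.
have k'0 z : (0 <= k' z)%E by rewrite mule_ge0.
transitivity (\int[mu]_y \int[mu]_u k' (y, u))%E.
  apply: eq_integral => y _; rewrite -ge0_integralZr//.
  exact: measurableT_comp mk (pair1_measurable y).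
rewrite (fubini_tonelli (m1 := mu) (m2 := mu))//.
transitivity (\int[mu]_u ((h u)%:E * (normal_pdf 0 r u)%:E))%E.
  apply: eq_integral => u _; rewrite /k' /k/=.
  transitivity (\int[mu]_y ((h u)%:E * (normal_pdf 0 r u)%:E *
      (normal_pdf (t * u / r ^+ 2) (s / r) y)%:E))%E.
    by apply: eq_integral => y _; rewrite -!muleA -!EFinM normal_pdf_conv.
  rewrite ge0_integralZl//; first by rewrite integral_normal_pdf mule1.
    exact: mpdf.
  by rewrite mule_ge0.
rewrite -(integral_normal_prob 0 r mh hE0) (integral_normal_std 0 r0 ch h0).
by apply: eq_integral => x _; rewrite addr0.
Qed.

Lemma bounded_integrable d (T : measurableType d) (P : probability T R)
    (f : T -> R) M : measurable_fun setT f -> (forall x, `|f x| <= M) ->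
  P.-integrable setT (EFin \o f).
Proof.
move=> mf fM; apply: measurable_bounded_integrable => //.
  exact: le_lt_trans (probability_le1 P measurableT) (ltry _).
exists M; split; first exact: num_real.
by move=> x Mx t _; exact: le_trans (fM _) (ltW Mx).
Qed.

Lemma EFin_Rintegral d (T : measurableType d) (P : {measure set T -> \bar R})
    (f : T -> R) : P.-integrable setT (EFin \o f) ->
  (\int[P]_x (f x)%:E = (\int[P]_x f x)%R%:E)%E.
Proof. by move=> fi; rewrite fineK//; exact: integrable_fin_num. Qed.

(** The characteristic function, real by symmetry; [normal_charM] stands in for its exponential
    formula. *)
Definition normal_char s : R := \int[gam]_y cos (s * y).

Let mcos d (T : measurableType d) (f : T -> R) :
  measurable_fun setT f -> measurable_fun setT (cos \o f).
Proof.
by move=> mf; apply: (measurableT_comp _ mf); exact: continuous_measurable_fun (@continuous_cos R).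
Qed.

Let msin d (T : measurableType d) (f : T -> R) :
  measurable_fun setT f -> measurable_fun setT (sin \o f).
Proof.
by move=> mf; apply: (measurableT_comp _ mf); exact: continuous_measurable_fun (@continuous_sin R).
Qed.

Let icos d (T : measurableType d) (P : probability T R) (f : T -> R) :
  measurable_fun setT f -> P.-integrable setT (EFin \o (fun x => cos (f x))).
Proof.
move=> mf; apply: (@bounded_integrable _ _ _ _ 1); first exact: mcos.
by move=> x; rewrite ler_norml cos_geN1 cos_le1.
Qed.

Let isin d (T : measurableType d) (P : probability T R) (f : T -> R) :
  measurable_fun setT f -> P.-integrable setT (EFin \o (fun x => sin (f x))).
Proof.
move=> mf; apply: (@bounded_integrable _ _ _ _ 1); first exact: msin.
by move=> x; rewrite ler_norml sin_geN1 sin_le1.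
Qed.

Let i1 d (T : measurableType d) (P : probability T R) :
  P.-integrable setT (EFin \o (fun=> 1)).
Proof. exact: finite_measure_integrable_cst. Qed.

(** Shifting by one makes sines and cosines nonnegative, so that identities for nonnegative
    integrands carry over to them. *)
Lemma integral_1D d (T : measurableType d) (P : probability T R) (f : T -> R) :
  P.-integrable setT (EFin \o f) ->
  (\int[P]_x (1 + f x)%:E = (1 + (\int[P]_x f x)%R)%:E)%E.
Proof.
move=> fi; under eq_integral do rewrite EFinD.
rewrite integralD//; last exact: i1.
have int1 : (\int[P]__ 1 = 1%:E)%E.
  apply: etrans (integral_cst P measurableT 1%E) _.
  by rewrite mul1e; exact: probability_setT.
transitivity (1%:E + (\int[P]_x f x)%R%:E)%E => //.
by congr (_ + _)%E; [exact: int1|exact: EFin_Rintegral].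
Qed.

Let mlin s c : measurable_fun setT (fun x : R => s * x + c).
Proof. by apply: measurable_funD => //; exact: measurable_funM. Qed.

Let sin_int0 s : \int[gam]_y sin (s * y) = 0.
Proof.
have ms : measurable_fun setT (fun x : R => s * x) by exact: measurable_funM.
have isn := isin gam ms.
have isnN : gam.-integrable setT
    (EFin \o (fun x : measurableTypeR R => - sin (s * x))).
  by have := integrableN isn.
have m1s : measurable_fun setT (fun y : R => 1 + sin (s * y)).
  by apply: measurable_funD => //; exact: msin.
have s0 (x : R) : 0 <= 1 + sin (s * x) by have := sin_geN1 (s * x); lra.
have [] : ((1 + \int[gam]_x sin (s * x))%:E =
    (1 + \int[gam]_x (- sin (s * x)))%:E :> \bar R)%R.
  apply: etrans (esym (integral_1D isn)) _.
  apply: etrans (integral_normal_sym m1s s0) _; apply: etrans (integral_1D isnN).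
  by apply: eq_integral => x _; rewrite mulrN sinN.
under [in X in _ = X -> _]eq_Rintegral do rewrite -mulN1r.
by rewrite RintegralZl//; move: (Rintegral _ _ _) => S; lra.
Qed.

Lemma integral_normal_cos s c :
  (\int[gam]_x (1 + cos (s * x + c))%:E = (1 + normal_char s * cos c)%:E)%E.
Proof.
have ms : measurable_fun setT (fun x : R => s * x) by exact: measurable_funM.
apply: etrans (integral_1D (icos gam (mlin s c))) _; congr (_ + _)%:E.
under eq_Rintegral do rewrite cosD.
have ic := icos gam ms; have is_ := isin gam ms.
rewrite RintegralB//; last 2 first.
- by have := integrableZr measurableT (cos c) ic.
- by have := integrableZr measurableT (sin c) is_.
rewrite RintegralZr// RintegralZr//.
by rewrite sin_int0 mul0r subr0.
Qed.

Lemma normal_char0 : normal_char 0 = 1.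
Proof.
have := integral_normal_cos 0 0; rewrite cos0 mulr1.
under eq_integral do rewrite mul0r addr0 cos0.
move=> h; have [] : ((1 + 1)%:E = (1 + normal_char 0)%:E :> \bar R)%R.
  rewrite -h; apply/esym; apply: etrans (integral_cst gam measurableT (1 + 1)%:E) _.
  by rewrite -[RHS]mule1; congr (_ * _)%E; exact: (@probability_setT _ _ _ gam).
by lra.
Qed.

(** Two evaluations of the double integral of 1 + cos (s x + t y): by the addition formula and by
    convolution. The case s = 0 is set apart because the convolution has a positive scale. *)
Lemma normal_charM s t : 0 <= s -> 0 <= t ->
  normal_char s * normal_char t = normal_char (Num.sqrt (s ^+ 2 + t ^+ 2)).
Proof.
rewrite le_eqVlt => /predU1P[<- t0|s0 t0].
  by rewrite normal_char0 mul1r expr0n add0r sqrtr_sqr ger0_norm.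
have cont_cos : continuous (fun x : R => 1 + cos x).
  by move=> x; apply: cvgD; [exact: cvg_cst|exact: continuous_cos].
have cos_ge0 (x : R) : 0 <= 1 + cos x by have := cos_geN1 x; lra.
have mt : measurable_fun setT (fun x : R => t * x) by exact: measurable_funM.
have ic := icos gam mt.
have iZ : gam.-integrable setT
    (EFin \o (fun x : measurableTypeR R => normal_char s * cos (t * x))).
  by have := integrableZl measurableT (normal_char s) ic.
have [] : ((1 + normal_char s * normal_char t)%:E =
    (1 + normal_char (Num.sqrt (s ^+ 2 + t ^+ 2)) * cos 0)%:E :> \bar R)%R.
  rewrite -integral_normal_cos.
  transitivity (\int[gam]_y \int[gam]_x (1 + cos (s * x + t * y))%:E)%E.
    under [RHS]eq_integral do rewrite integral_normal_cos.
    apply/esym; apply: etrans (integral_1D iZ) _; congr (_ + _)%:E.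
    by rewrite RintegralZl.
  apply: etrans (integral_normal_conv t s0 cont_cos cos_ge0) _.
  by apply: eq_integral => x _; rewrite addr0.
by rewrite cos0 mulr1; lra.
Qed.

End NormalIntegrals.

Lemma integral_prob_cst d (T : measurableType d) (R : realType)
  (P : probability T R) (c : R) : (\int[P]__ c%:E = c%:E)%E.
Proof.
apply: etrans (integral_cst P measurableT c%:E) _.
by rewrite -[RHS]mule1; congr (_ * _)%E; exact: probability_setT.
Qed.

(** * Transforms and small balls of Gaussian variables *)

Section GaussianVariables.
Context d (Omega : measurableType d) (R : realType) (P : probability Omega R).
Implicit Types (Z : Omega -> R).
Let gam : probability (measurableTypeR R) R := normal_prob (0 : R) 1.

Lemma integral_gaussian_law Z m s (h : R -> R) : measurable_fun setT Z ->
  (forall A, measurable A -> P (Z @^-1` A) = gaussian_law m s A) ->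
  continuous h -> (forall x, 0 <= h x) ->
  (\int[P]_w (h (Z w))%:E = \int[gam]_y (h (`|s| * y + m))%:E)%E.
Proof.
move=> mZ lawZ ch h0.
have mh : measurable_fun setT (fun x : R => (h x)%:E).
  by apply/measurable_EFinP; exact: continuous_measurable_fun.
transitivity (\int[pushforward P (Z : Omega -> measurableTypeR R)]_x (h x)%:E)%E.
  by rewrite ge0_integral_pushforward// => x _; rewrite lee_fin.
have [s0|s0] := eqVneq s 0.
  transitivity (\int[\d_(m : measurableTypeR R)]_x (h x)%:E)%E.
    apply: eq_measure_integral => A mA _.
    by apply: etrans (lawZ A mA) _; rewrite /gaussian_law s0 eqxx.
  rewrite integral_dirac// diracT mul1e s0 normr0.
  under [RHS]eq_integral do rewrite mul0r add0r.
  exact/esym/integral_prob_cst.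
rewrite -integral_normal_std ?normr_gt0//.
apply: eq_measure_integral => A mA _.
apply: etrans (lawZ A mA) _; rewrite /gaussian_law (negbTE s0).
by rewrite /= /normal_prob normal_pdf_abs.
Qed.

(** Averaging over y and -y removes the cross term. *)
Let integral_gam_sqr (s a : R) : (\int[gam]_y ((s * y + a) ^+ 2)%:E =
  (s ^+ 2 * normal_var R + a ^+ 2)%:E)%E.
Proof.
have mf t : measurable_fun setT (fun y : R => (t * y + a) ^+ 2).
  by apply: measurable_funX; apply: measurable_funD => //; exact: measurable_funM.
have mfE t : measurable_fun setT (fun y : R => ((t * y + a) ^+ 2)%:E).
  exact/measurable_EFinP.
have f0 t (y : R) : 0 <= (t * y + a) ^+ 2 by exact: sqr_ge0.
have sym := integral_normal_sym (mf s) (f0 s).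
have sumE : (\int[gam]_y ((s * y + a) ^+ 2)%:E + \int[gam]_y ((s * y + a) ^+ 2)%:E =
    (2 * (s ^+ 2 * normal_var R + a ^+ 2))%:E)%E.
  rewrite [X in (_ + X)%E]sym; under [X in (_ + X)%E]eq_integral do rewrite mulrN -mulNr.
  rewrite -ge0_integralD//; try by move=> x _; rewrite lee_fin.
  - transitivity (\int[gam]_y ((2 * s ^+ 2)%:E * (y ^+ 2)%:E + cst (2 * a ^+ 2)%:E y))%E.
      by apply: eq_integral => y _; rewrite -!EFinM -!EFinD /=; congr EFin; ring.
    have mX : measurable_fun setT (fun y : R => (y ^+ 2)%:E).
      by apply/measurable_EFinP; exact: measurable_funX.
    have X0 (y : R) : (0 <= (y ^+ 2)%:E)%E by rewrite lee_fin sqr_ge0.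
    have c0 : (0 <= (2 * s ^+ 2)%:E)%E by rewrite lee_fin mulr_ge0// sqr_ge0.
    rewrite ge0_integralD//.
    + rewrite ge0_integralZl// normal_varE.
      have -> : (\int[gam]_x cst (2 * a ^+ 2)%:E x = (2 * a ^+ 2)%:E)%E.
        exact: integral_prob_cst.
      by rewrite -EFinM -EFinD; congr EFin; ring.
    + by move=> y _; exact: mule_ge0.
    + by apply: emeasurable_funM.
    + by move=> y _; rewrite lee_fin mulr_ge0// sqr_ge0.
  - exact: mfE.
  - exact: mfE.
move: sumE; case: (integral _ _ _) => [r| |]//.
by rewrite -EFinD => -[] h; congr EFin; lra.
Qed.

Section Moments.
Variables (Z : Omega -> R) (v : R).
Hypotheses (gZ : gaussian P Z) (EZ : (\int[P]_w (Z w)%:E = 0)%E)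
  (EZ2 : (\int[P]_w (Z w ^+ 2)%:E = v%:E)%E).

Let mZ : measurable_fun setT Z. Proof. by case: gZ. Qed.

Let iZ2 : P.-integrable setT (EFin \o (fun w => Z w ^+ 2)).
Proof.
apply/integrableP; split.
  by apply/measurable_EFinP; exact: measurable_funX.
under eq_integral do rewrite /= ger0_norm ?sqr_ge0//.
by rewrite EZ2 ltry.
Qed.

Let icst (c : R) : P.-integrable setT (EFin \o (fun=> c)).
Proof. exact: finite_measure_integrable_cst. Qed.

Let iZ : P.-integrable setT (EFin \o Z).
Proof.
apply: (@le_integrable _ _ _ _ _ _ _ (EFin \o (fun w => 1 + Z w ^+ 2))) => //.
- exact/measurable_EFinP.
- move=> w _; rewrite /= lee_fin [leRHS]ger0_norm ?addr_ge0 ?sqr_ge0//.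
  rewrite -(real_normK (num_real (Z w))); move: `|Z w| => z; nra.
- by have := integrableD measurableT (icst 1) iZ2.
Qed.

Let EZc c : c ^+ 2 = 1 -> (\int[P]_w ((Z w + c) ^+ 2)%:E = (v + 1)%:E)%E.
Proof.
move=> c1; have iZl : P.-integrable setT (EFin \o (fun w => 2 * c * Z w)).
  by have := integrableZl measurableT (2 * c) iZ.
transitivity (\int[P]_w ((Z w ^+ 2)%:E + (1 + 2 * c * Z w)%:E))%E.
  by apply: eq_integral => w _; rewrite -EFinD; congr EFin; rewrite sqrrD c1; ring.
rewrite integralD//; last by have := integrableD measurableT (icst 1) iZl.
rewrite EZ2 EFinD; congr (_ + _)%E.
apply: etrans (integral_1D iZl) _.
by rewrite RintegralZl// /Rintegral EZ mulr0 addr0.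
Qed.

(** The second moments of Z + 1 and Z - 1, each computed from the hypotheses and from the law, give
    two equations: their difference yields [m], then either yields [s]. *)
Let law_moments m s :
  (forall A, measurable A -> P (Z @^-1` A) = gaussian_law m s A) ->
  m = 0 /\ v = s ^+ 2 * normal_var R.
Proof.
move=> lawZ.
have h c : c ^+ 2 = 1 -> v + 1 = s ^+ 2 * normal_var R + (m + c) ^+ 2.
  move=> c1; have csqr : continuous (fun x : R => (x + c) ^+ 2).
    move=> x; apply: (@cvg_comp _ _ _ (fun x => x + c) (fun x => x ^+ 2)).
      by apply: (@cvgD _ R^o); [exact: cvg_id|exact: cvg_cst].
    exact: sqr_continuous.
  have sqr0 (x : R) : 0 <= (x + c) ^+ 2 by exact: sqr_ge0.
  have := integral_gaussian_law mZ lawZ csqr sqr0.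
  rewrite EZc//; under eq_integral do rewrite -addrA.
  by rewrite integral_gam_sqr real_normK ?num_real// => -[].
have h1 := h 1 (expr1n _ 2); have h2 := h (-1) (sqrr_sign _ 1).
have m0 : m = 0 by lra.
by split=> //; move: h1; rewrite m0 add0r expr1n; lra.
Qed.

(** The characteristic function at 1 of the centred Gaussian law of variance [u]. *)
Definition gaussian_char (u : R) := normal_char (Num.sqrt (u / normal_var R)).

Lemma gaussian_cos b :
  (\int[P]_w (cos (Z w + b))%:E = (gaussian_char v * cos b)%:E)%E.
Proof.
have [_ [m [s lawZ]]] := gZ.
have [m0 vE] := law_moments lawZ.
have cont : continuous (fun x : R => 1 + cos (x + b)).
  move=> x; apply: cvgD; first exact: cvg_cst.
  apply: (@cvg_comp _ _ _ (fun x => x + b) cos); last exact: continuous_cos.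
  by apply: (@cvgD _ R^o); [exact: cvg_id|exact: cvg_cst].
have cos0 (x : R) : 0 <= 1 + cos (x + b) by have := cos_geN1 (x + b); lra.
have := integral_gaussian_law mZ lawZ cont cos0.
rewrite m0; under [RHS]eq_integral do rewrite addr0.
rewrite integral_normal_cos.
have mcos : measurable_fun setT (fun w => cos (Z w + b)).
  apply: measurableT_comp; first exact: continuous_measurable_fun (@continuous_cos R).
  exact: measurable_funD.
have icos : P.-integrable setT (EFin \o (fun w => cos (Z w + b))).
  have cos1 w : `|cos (Z w + b)| <= 1 by rewrite ler_norml cos_geN1 cos_le1.
  exact: bounded_integrable mcos cos1.
have -> := integral_1D icos.
rewrite EFin_Rintegral// => -[] h; congr EFin.
rewrite /gaussian_char vE mulfK ?gt_eqF ?normal_var_gt0// sqrtr_sqr.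
by move: h; move: (Rintegral _ _ _) => I; lra.
Qed.

(** The density is bounded by its peak, and unit variance fixes the peak through s ^ 2 = 1 /
    [normal_var]. *)
Lemma gaussian_small_ball (eps : R) : v = 1 -> 0 < eps ->
  (P [set w | (- eps < Z w < eps)%R] <=
   (normal_peak (Num.sqrt (normal_var R)^-1) * (eps *+ 2))%:E)%E.
Proof.
move=> v1 e0; have [_ [m [s lawZ]]] := gZ.
have [m0 vE] := law_moments lawZ.
have s0 : s != 0.
  by apply/eqP => s0; move: vE; rewrite v1 s0 expr0n mul0r => /eqP; rewrite oner_eq0.
have pE : normal_peak s = normal_peak (Num.sqrt (normal_var R)^-1).
  rewrite /normal_peak; congr (Num.sqrt (_ * _ *+ _))^-1.
  rewrite sqr_sqrtr ?invr_ge0 ?ltW ?normal_var_gt0//.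
  by apply: (mulIf (lt0r_neq0 (normal_var_gt0 R))); rewrite -vE v1 mulVf ?gt_eqF ?normal_var_gt0.
rewrite (_ : [set w | _] = Z @^-1` `](- eps), eps[%classic); last first.
  by apply/seteqP; split=> w /=; rewrite in_itv.
rewrite lawZ// /gaussian_law (negbTE s0) /normal_prob -pE.
apply: (@le_trans _ _ (\int[lebesgue_measure]_(x in `](- eps)%R, eps[) (normal_peak s)%:E)%E).
  apply: ge0_le_integral => //.
  - by move=> x _; rewrite lee_fin normal_pdf_ge0.
  - by apply/measurable_EFinP; apply: measurable_funTS; exact: measurable_normal_pdf.
  - by move=> x _; rewrite lee_fin normal_pdf_ub.
have h := integral_cst (@lebesgue_measure R)
  (@measurable_itv R `](- eps), eps[) (normal_peak s)%:E.
have h2 : (lebesgue_measure `](- eps)%R, eps[%classic = (eps *+ 2)%:E :> \bar R)%E.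
  by rewrite lebesgue_measure_itv/= lte_fin gtrN// -EFinD opprK -mulr2n.
rewrite (_ : (\int[_]_(x in _) _)%E = ((normal_peak s)%:E * (eps *+ 2)%:E)%E).
  by rewrite -EFinM.
exact: etrans h (congr1 (fun z => (normal_peak s)%:E * z)%E h2).
Qed.

End Moments.

Lemma gaussian_charM (u v : R) : 0 <= u -> 0 <= v ->
  gaussian_char (u + v) = gaussian_char u * gaussian_char v.
Proof.
move=> u0 v0; rewrite /gaussian_char normal_charM ?sqrtr_ge0//.
have k0 := normal_var_gt0 R.
by rewrite !sqr_sqrtr ?divr_ge0 ?(ltW k0)// mulrDl.
Qed.

End GaussianVariables.

(** * Standard Gaussian families and independent copies *)

Section StandardGaussianFamily.
Context d (Omega : measurableType d) (R : realType) (P : probability Omega R).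

(* [X] is a standard Gaussian family: its characteristic function is that of
   independent centred Gaussian variables of variance one. *)
Definition standard_gaussian (I : finType) (X : I -> Omega -> R) : Prop :=
  (forall i, measurable_fun setT (X i)) /\
  forall (a : I -> R) b, (\int[P]_w (cos (\sum_i a i * X i w + b))%:E =
    (gaussian_char (\sum_i a i ^+ 2) * cos b)%:E)%E.

Lemma standard_gaussian_box (d' : _) (Omega' : measurableType d')
    (P' : probability Omega' R) (I : finType) (X : I -> Omega -> R)
    (X' : I -> Omega' -> R) : standard_gaussian X ->
  (forall i, measurable_fun setT (X' i)) ->
  (forall (a : I -> R) b, (\int[P']_w (cos (\sum_i a i * X' i w + b))%:E =
    (gaussian_char (\sum_i a i ^+ 2) * cos b)%:E)%E) ->
  forall a b, P (open_box X a b) = P' (open_box X' a b).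
Proof.
move=> [mX gX] mX' gX' a b; apply: cos_box_eq => // {}a {}b.
by rewrite gX gX'.
Qed.

(** The second component of [w] is an independent copy; equality of laws before and after the
    replacement is how independence of coordinates is used. *)
Definition resample (I : finType) (J : pred I) (X : I -> Omega -> R) i
  (w : Omega * Omega) : R := if J i then X i w.2 else X i w.1.

Lemma measurable_resample (I : finType) (J : pred I) (X : I -> Omega -> R) i :
  measurable_fun setT (X i) -> measurable_fun setT (resample J X i).
Proof.
move=> mX; rewrite /resample; case: (J i).
  exact: measurableT_comp mX measurable_snd.
exact: measurableT_comp mX measurable_fst.
Qed.

(** For a fixed first copy the integral over the second factors, and [gaussian_charM] glues the sums
    of squares over [J] and its complement. *)
Lemma resample_cos (I : finType) (J : pred I) (X : I -> Omega -> R) :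
  standard_gaussian X -> forall (a : I -> R) b,
  (\int[P \x P]_w (cos (\sum_i a i * resample J X i w + b))%:E =
    (gaussian_char (\sum_i a i ^+ 2) * cos b)%:E)%E.
Proof.
move=> [mX gX] a b.
pose aJ i := if J i then a i else 0; pose aN i := if J i then 0 else a i.
have split_sum w : \sum_i a i * resample J X i w + b =
    \sum_i aJ i * X i w.2 + (\sum_i aN i * X i w.1 + b).
  rewrite addrA -big_split/=; congr (_ + _); apply: eq_bigr => i _.
  by rewrite /resample /aJ /aN; case: (J i); rewrite ?mul0r ?addr0 ?add0r.
have ms : measurable_fun setT (fun w => \sum_i a i * resample J X i w + b).
  apply: measurable_funD => //; apply: measurable_sum => i.
  by apply: measurable_funM => //; exact: measurable_resample.
have mcos : measurable_fun setT
    (fun w => cos (\sum_i a i * resample J X i w + b)).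
  by apply: measurableT_comp ms; exact: continuous_measurable_fun (@continuous_cos R).
have cos1 w : `|cos (\sum_i a i * resample J X i w + b)| <= 1.
  by rewrite ler_norml cos_geN1 cos_le1.
have icos : (P \x P)%E.-integrable setT
    (EFin \o (fun w => cos (\sum_i a i * resample J X i w + b))).
  exact: bounded_integrable mcos cos1.
apply: etrans (esym (integral12_prod_meas1 icos)) _.
rewrite /fubini_F/=.
under eq_integral do under eq_integral do rewrite split_sum/=.
under eq_integral do rewrite gX EFinM.
have mA : measurable_fun setT (fun w => cos (\sum_i aN i * X i w + b)).
  apply: measurableT_comp; first exact: continuous_measurable_fun (@continuous_cos R).
  apply: measurable_funD => //; apply: measurable_sum => i.
  exact: measurable_funM.
have cosA w : `|cos (\sum_i aN i * X i w + b)| <= 1.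
  by rewrite ler_norml cos_geN1 cos_le1.
have iA := bounded_integrable P mA cosA.
rewrite integralZl// gX -EFinM mulrA -gaussian_charM; last 2 first.
- by apply: sumr_ge0 => i _; exact: sqr_ge0.
- by apply: sumr_ge0 => i _; exact: sqr_ge0.
congr (gaussian_char _ * _)%:E; rewrite -big_split/=; apply: eq_bigr => i _.
by rewrite /aJ /aN; case: (J i); rewrite expr0n ?addr0 ?add0r.
Qed.

Lemma standard_gaussian_lift n (X : 'I_n.+1 -> Omega -> R) :
  standard_gaussian X -> standard_gaussian (fun i => X (lift ord0 i)).
Proof.
move=> [mX gX]; split=> [i|a b]; first exact: mX.
pose a' i := if unlift ord0 i is Some j then a j else 0.
have := gX a' b; rewrite big_ord_recl /a' unlift_none expr0n add0r.
under eq_bigr do rewrite liftK.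
move=> <-; apply: eq_integral => w _; congr (cos (_ + _))%:E.
rewrite big_ord_recl unlift_none mul0r add0r.
by under [RHS]eq_bigr do rewrite liftK.
Qed.

(** Resampling the first coordinate turns the box into a product set, whose measure factors;
    induction treats the rest. *)
Lemma standard_gaussian_small_ball n (X : 'I_n -> Omega -> R) (p eps : R) :
  standard_gaussian X -> 0 <= p ->
  (forall i, P [set w | (- eps < X i w < eps)%R] <= p%:E)%E ->
  (P (open_box X (fun=> (- eps)%R) (fun=> eps)) <= (p ^+ n)%:E)%E.
Proof.
move=> + p0; elim: n X => [|n IH] X gX pX.
  exact: probability_le1 (measurable_open_box gX.1 _ _).
pose J : pred 'I_n.+1 := pred1 ord0.
have mJ i : measurable_fun setT (resample J X i).
  by apply: measurable_resample; exact: gX.1.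
rewrite (standard_gaussian_box gX mJ (resample_cos J gX)).
pose X' i := X (lift ord0 i).
have gX' : standard_gaussian X' by exact: standard_gaussian_lift.
have mB : measurable (open_box X' (fun=> - eps) (fun=> eps)).
  exact: measurable_open_box gX'.1 _ _.
have m0 : measurable [set w | - eps < X ord0 w < eps].
  have := gX.1 ord0 measurableT _ (@measurable_itv R `](- eps), eps[).
  by rewrite setTI; congr (measurable _); apply/seteqP; split=> t /=; rewrite in_itv.
rewrite (_ : open_box _ _ _ = open_box X' (fun=> - eps) (fun=> eps) `*`
    [set w | - eps < X ord0 w < eps]); last first.
  apply/seteqP; split=> [[w w'] /= h|[w w'] /= [h1 h2] i].
    by split=> [i|]; [have := h (lift ord0 i)|have := h ord0]; rewrite /resample.
  rewrite /resample /J/=; case: (unliftP ord0 i) => [j ->|->]//.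
  exact: h1.
rewrite /= (product_measure1E P P mB m0) exprSr EFinM.
apply: lee_pmul; [exact: measure_ge0|exact: measure_ge0| |exact: pX].
by apply: IH => // i; exact: pX.
Qed.

End StandardGaussianFamily.

(** * Inner product spaces *)

Lemma exists_lfun (R : realType) (U V : vectType R) (f : U -> V) :
  linear f -> exists F : 'Hom(U, V), F =1 f.
Proof.
move=> lf; pose f' : {linear U -> V} := HB.pack f (GRing.isLinear.Build _ _ _ _ f lf).
by exists (linfun f') => u; rewrite (lfunE f').
Qed.

Lemma isometryP (R : realType) (U V : vectType R) (gU : {dot U for idfun})
    (gV : {dot V for idfun}) (f : 'Hom(U, V)) :
  isometry gV gU f <-> forall u v, gV (f u) (f v) = gU u v.
Proof. by split=> h u v; exact: h. Qed.

Section DotTheory.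
Variables (R : realType) (V : vectType R) (g : {dot V for idfun}).
Implicit Types (u v w : V) (W : {vspace V}).

Lemma dotC u v : g u v = g v u.
Proof. by rewrite hermC expr0 mul1r. Qed.

Lemma dotDl u v w : g (u + v) w = g u w + g v w. Proof. exact: linearDl. Qed.
Lemma dotDr u v w : g u (v + w) = g u v + g u w. Proof. exact: linearDr. Qed.
Lemma dotZl a u w : g (a *: u) w = a * g u w. Proof. exact: linearZl_LR. Qed.
Lemma dotZr a u w : g u (a *: w) = a * g u w.
Proof. by rewrite dotC dotZl dotC. Qed.
Lemma dotNl u w : g (- u) w = - g u w. Proof. exact: linearNl. Qed.
Lemma dotNr u w : g u (- w) = - g u w. Proof. exact: linearNr. Qed.
Lemma dotBl u v w : g (u - v) w = g u w - g v w. Proof. exact: linearBl. Qed.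
Lemma dotBr u v w : g u (v - w) = g u v - g u w. Proof. exact: linearBr. Qed.
Lemma dot0l w : g 0 w = 0. Proof. exact: linear0l. Qed.
Lemma dot0r w : g w 0 = 0. Proof. exact: linear0r. Qed.
Lemma dot_suml I (r : seq I) (P : pred I) (F : I -> V) w :
  g (\sum_(i <- r | P i) F i) w = \sum_(i <- r | P i) g (F i) w.
Proof. exact: linear_sumlz. Qed.
Lemma dot_sumr I (r : seq I) (P : pred I) (F : I -> V) w :
  g w (\sum_(i <- r | P i) F i) = \sum_(i <- r | P i) g w (F i).
Proof. exact: linear_sumr. Qed.

Lemma dot_gt0 u : (0 < g u u) = (u != 0).
Proof.
apply/idP/idP; last exact: neq0_dnorm_gt0.
by apply: contraTneq => ->; rewrite dot0l ltxx.
Qed.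

Lemma dot_eq0 u : (g u u == 0) = (u == 0).
Proof.
have [->|u0] := eqVneq u 0; first by rewrite dot0l eqxx.
by rewrite gt_eqF// dot_gt0.
Qed.

Lemma dot_ge0 u : 0 <= g u u.
Proof. by rewrite le_eqVlt dot_gt0 eq_sym dot_eq0; case: eqP. Qed.

Lemma dot_inj u v : (forall w, g u w = g v w) -> u = v.
Proof.
by move=> uv; apply/eqP; rewrite -subr_eq0 -dot_eq0 dotBl uv subrr.
Qed.

Definition onb n (b : 'I_n -> V) W : Prop :=
  [/\ forall i, b i \in W, forall i j, g (b i) (b j) = (i == j)%:R &
      forall v, v \in W -> v = \sum_i g v (b i) *: b i].

(** Normalise a vector of [W] and continue in its orthogonal complement within [W]. *)
Lemma exists_onb n W : \dim W = n -> exists b : 'I_n -> V, onb b W.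
Proof.
elim: n W => [|n IH] W dW.
  exists (fun=> 0); split=> [[]//|[]//|v].
  move/eqP: dW; rewrite dimv_eq0 => /eqP ->; rewrite memv0 => /eqP ->.
  by rewrite big_ord0.
have W0 : W != 0%VS by rewrite -dimv_eq0 dW.
pose u := vpick W.
have uW : u \in W by exact: memv_pick.
have u0 : u != 0 by rewrite vpick0.
have guu : 0 < g u u by rewrite dot_gt0.
have uN : u \notin orthov g W.
  by apply/mem_orthovPn; exists u => //; rewrite gt_eqF.
have dW' := eq_dim_orthov1 uN; rewrite dW/= in dW'.
have [b [bW bb bE]] := IH _ (esym dW').
pose e := (Num.sqrt (g u u))^-1 *: u.
have s2 : Num.sqrt (g u u) != 0 by rewrite gt_eqF// sqrtr_gt0.
have gee : g e e = 1.
  by rewrite dotZl dotZr mulrA -invfM -expr2 sqr_sqrtr ?dot_ge0// mulVf ?gt_eqF.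
have orthoP v : (v \in (W :&: orthov g <[u]>)%VS) = (v \in W) && (g v u == 0).
  by rewrite memv_cap mem_orthov1.
have be i : g (b i) e = 0.
  by have := bW i; rewrite orthoP dotZr => /andP[_ /eqP ->]; rewrite mulr0.
exists (fun i => if unlift ord0 i is Some j then b j else e); split.
- move=> i; case: unliftP => [j _|_]; last by rewrite memvZ.
  by have := bW j; rewrite orthoP => /andP[].
- move=> i j; case: unliftP => [i' ->|->]; case: unliftP => [j' ->|->].
  + by rewrite bb (inj_eq (@lift_inj _ _)).
  + by rewrite be; rewrite eq_sym (negbTE (neq_lift _ _)).
  + by rewrite dotC be (negbTE (neq_lift _ _)).
  + by rewrite gee eqxx.
move=> v vW; rewrite big_ord_recl unlift_none.
have v'W : v - g v e *: e \in (W :&: orthov g <[u]>)%VS.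
  rewrite orthoP memvB ?memvZ//=.
  have ss : g u u = Num.sqrt (g u u) ^+ 2 by rewrite sqr_sqrtr ?dot_ge0.
  rewrite dotBl dotZl /e dotZl dotZr; move: ss s2.
  by move: (Num.sqrt (g u u)) => s -> s0; apply/eqP; field.
rewrite -[LHS](subrK (g v e *: e)) addrC; congr (_ + _).
rewrite {1}(bE _ v'W); apply: eq_bigr => i _; rewrite liftK.
by rewrite dotBl dotZl (dotC e) be mulr0 subr0.
Qed.

Lemma onb_dot n (b : 'I_n -> V) u v : onb b fullv ->
  g u v = \sum_i g u (b i) * g (b i) v.
Proof.
move=> [_ _ bE]; rewrite {1}(bE u (memvf _)) dot_suml.
by apply: eq_bigr => i _; rewrite dotZl.
Qed.

Lemma onb_dot_sqr n (b : 'I_n -> V) u : onb b fullv ->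
  g u u = \sum_i g u (b i) ^+ 2.
Proof.
move=> ob; rewrite (onb_dot _ _ ob).
by apply: eq_bigr => i _; rewrite expr2 (dotC (b i)).
Qed.

Lemma cap_orthov W : (W :&: orthov g W)%VS = 0%VS.
Proof.
apply/eqP; rewrite -subv0; apply/subvP => v; rewrite memv_cap => /andP[vW].
by move=> /mem_orthovP /(_ v vW)/eqP; rewrite dot_eq0 memv0.
Qed.

(** The sum over an orthonormal basis shows that [v] splits along [W] and its orthogonal complement,
    which is what [daddv_pi_add] requires. *)
Lemma ortho_projP W v : ortho_proj g W v \in W /\
  forall w, w \in W -> g (v - ortho_proj g W v) w = 0.
Proof.
split; first exact: memv_pi.
have [b [bW bb bE]] := exists_onb (erefl (\dim W)).
pose p := \sum_i g v (b i) *: b i.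
have pW : p \in W by apply: memv_suml => i _; exact: memvZ.
have vp w : w \in W -> g (v - p) w = 0.
  move=> wW; rewrite (bE w wW) dot_sumr big1// => i _.
  rewrite dotZr dotBl dot_suml (bigD1 i)//= big1 => [|j ji].
    by rewrite dotZl bb eqxx mulr1 addr0 subrr mulr0.
  by rewrite dotZl bb (negbTE ji) mulr0.
have vpO : v - p \in orthov g W.
  by apply/mem_orthovP => w wW; exact: vp.
rewrite /ortho_proj; set q := daddv_pi _ _ _.
have vadd : v \in (W + orthov g W)%VS.
  by rewrite -(subrK p v) addrC memv_add.
have qE : q + daddv_pi (orthov g W) W v = v.
  exact: daddv_pi_add (cap_orthov W) vadd.
move=> w wW; rewrite -{1}qE addrAC subrr add0r.
have := memv_pi (orthov g W) W v.
by move/mem_orthovP; apply.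
Qed.

Lemma ortho_proj_unique W v p : p \in W ->
  (forall w, w \in W -> g (v - p) w = 0) -> ortho_proj g W v = p.
Proof.
move=> pW vp; have [qW vq] := ortho_projP W v.
apply/eqP; rewrite -subr_eq0 -dot_eq0.
set q := ortho_proj g W v in qW vq *.
have qpW : q - p \in W by rewrite memvB.
have -> : g (q - p) (q - p) = g (v - p) (q - p) - g (v - q) (q - p).
  by rewrite -dotBl opprB [_ - p + _]addrC addrA subrK.
by rewrite vp// vq// subrr.
Qed.

Lemma ortho_proj_id W v : v \in W -> ortho_proj g W v = v.
Proof. by move=> vW; apply: ortho_proj_unique => // w _; rewrite subrr dot0l. Qed.

Lemma ortho_proj_in W v : ortho_proj g W v \in W.
Proof. by case: (ortho_projP W v). Qed.

Lemma dot_ortho_projl W u v : v \in W -> g (ortho_proj g W u) v = g u v.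
Proof.
move=> vW; have [_ /(_ v vW)] := ortho_projP W u.
by rewrite dotBl => /eqP; rewrite subr_eq0 => /eqP.
Qed.

Lemma ortho_proj_sym W u v : g (ortho_proj g W u) v = g u (ortho_proj g W v).
Proof.
rewrite dotC -(dot_ortho_projl _ (ortho_proj_in W u)) dotC.
by rewrite (dot_ortho_projl _ (ortho_proj_in W v)).
Qed.

Lemma limg_ortho_proj W : limg (ortho_proj g W) = W.
Proof.
apply/eqP; rewrite eqEsubv; apply/andP; split; apply/subvP => v.
  by move=> /memv_imgP[u _ ->]; exact: ortho_proj_in.
by move=> vW; apply/memv_imgP; exists v; rewrite ?memvf// ortho_proj_id.
Qed.

(* Householder reflection; it is the identity for [z = 0] since [0^-1 = 0]. *)
Lemma exists_reflection x y : g x x = g y y ->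
  exists2 Q : 'End(V), orthogonal_ops g Q &
    Q x = y /\ forall u, g u x = g u y -> Q u = u.
Proof.
move=> xy; have [z zE] : exists z, z = x - y by exists (x - y).
pose f u := u - (2 * g u z / g z z) *: z.
have lf : linear f.
  move=> a u v; rewrite /f dotDl dotZl scalerBr scalerA.
  rewrite addrACA -opprD -scalerDl; congr (_ - _ *: _).
  by rewrite mulrDr mulrDl !mulrA [2 * a]mulrC.
have [Q QE] := exists_lfun lf.
have zz : g z z = 2 * (g x x - g x y).
  by rewrite zE !dotBl !dotBr (dotC y x) -xy; ring.
exists Q; last split.
- apply/isometryP => u v; rewrite !QE /f; have [z0|z0] := eqVneq (g z z) 0.
    by rewrite z0 invr0 !mulr0 !scale0r !subr0.
  rewrite !dotBl !dotBr !dotZl !dotZr (dotC z v); field.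
  by [].
- rewrite QE /f; have [z0|z0] := eqVneq (g z z) 0.
    have /eqP : z == 0 by rewrite -dot_eq0 z0.
    by rewrite zE => /eqP; rewrite subr_eq0 => /eqP ->; rewrite subrr scaler0 subr0.
  have -> : 2 * g x z / g z z = 1.
    by rewrite [g x z](_ : _ = g x x - g x y) -?zz ?mulfV// zE dotBr.
  by rewrite scale1r zE opprB addrC subrK.
- by move=> u uxy; rewrite QE /f zE dotBr uxy subrr mulr0 mul0r scale0r subr0.
Qed.

(** Align the tails by induction, then reflect the image of the first vector onto its target; the
    reflection fixes the tail, which is orthogonal to both. *)
Lemma exists_isometry_onb n (x y : 'I_n -> V) :
  (forall i j, g (x i) (x j) = (i == j)%:R) ->
  (forall i j, g (y i) (y j) = (i == j)%:R) ->
  exists2 Q : 'End(V), orthogonal_ops g Q & forall i, Q (x i) = y i.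
Proof.
elim: n x y => [|n IH] x y xx yy.
  by exists \1%VF => [|[]//]; apply/isometryP => u v; rewrite !id_lfunE.
have [i j|i j|Q /isometryP Qo Qx] := IH (fun i => x (lift ord0 i)) (fun i => y (lift ord0 i)).
- by rewrite xx (inj_eq (@lift_inj _ _)).
- by rewrite yy (inj_eq (@lift_inj _ _)).
have [|Q' /isometryP Q'o [Q'x Q'y]] := @exists_reflection (Q (x ord0)) (y ord0).
  by rewrite Qo xx yy.
exists (Q' \o Q)%VF => [|i].
  by apply/isometryP => u v; rewrite !comp_lfunE Q'o Qo.
rewrite comp_lfunE; case: (unliftP ord0 i) => [j ->|->//].
by rewrite Qx Q'y// -{1}Qx Qo xx yy.
Qed.

End DotTheory.

(** * Adjoints, square roots and inverses as limits *)

Section Adjoint.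
Variables (R : realType) (U V : vectType R).
Variables (gU : {dot U for idfun}) (gV : {dot V for idfun}).
Implicit Types (f : 'Hom(U, V)).

Lemma exists_adj f : exists F : 'Hom(V, U), forall v u, gU (F v) u = gV v (f u).
Proof.
have [b ob] := exists_onb gU (erefl (\dim {:U})).
have lf : linear (fun v : V => \sum_i gV v (f (b i)) *: b i).
  move=> a u v; rewrite scaler_sumr -big_split/=; apply: eq_bigr => i _.
  by rewrite dotDl dotZl scalerA scalerDl.
have [F FE] := exists_lfun lf; exists F => v u; rewrite FE dot_suml.
have [_ _ bE] := ob; rewrite [in RHS](bE u (memvf _)) linear_sum dot_sumr.
by apply: eq_bigr => i _; rewrite linearZ/= dotZl dotZr dotC mulrC.
Qed.

Definition adj f : 'Hom(V, U) := sval (cid (exists_adj f)).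

Lemma adjl f v u : gU (adj f v) u = gV v (f u).
Proof. by rewrite /adj; case: cid. Qed.

Lemma adjr f v u : gU u (adj f v) = gV (f u) v.
Proof. by rewrite dotC adjl dotC. Qed.

Definition gram f : 'End(U) := (adj f \o f)%VF.

Lemma dot_gram f u u' : gU (gram f u) u' = gV (f u) (f u').
Proof. by rewrite comp_lfunE adjl. Qed.

Lemma lker_gram f : lker (gram f) = lker f.
Proof.
apply/eqP; rewrite eqEsubv; apply/andP; split; apply/subvP => u;
  rewrite !memv_ker => /eqP fu.
  by rewrite -(dot_eq0 gV) -dot_gram fu dot0l.
by rewrite comp_lfunE fu linear0.
Qed.

Lemma lker_adj f : lker (adj f) = orthov gV (limg f).
Proof.
apply/eqP; rewrite eqEsubv; apply/andP; split; apply/subvP => v.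
  rewrite memv_ker => /eqP fv; apply/mem_orthovP => _ /memv_imgP[u _ ->].
  by have := adjl f v u; rewrite fv dot0l => /esym.
move=> /mem_orthovP h; rewrite memv_ker; apply/eqP/(dot_inj (g := gU)) => u.
by rewrite adjl dot0l; apply: h; exact: memv_img (memvf _).
Qed.

(** Projections on kernels will be limits of powers; this brings projections on ranges under the
    same method. *)
Lemma ortho_proj_limg f v :
  ortho_proj gV (limg f) v = v - ortho_proj gV (lker (adj f)) v.
Proof.
set p := ortho_proj gV (lker (adj f)) v.
have [pW vp] := ortho_projP gV (lker (adj f)) v; rewrite -/p in pW vp.
set q := ortho_proj gV (limg f) v.
have [qW vq] := ortho_projP gV (limg f) v; rewrite -/q in qW vq.
suff -> : p = v - q by rewrite opprB addrC subrK.
apply: ortho_proj_unique.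
  by rewrite lker_adj; apply/mem_orthovP => w wW; exact: vq.
move=> w; rewrite lker_adj opprB addrC subrK => /mem_orthovP wW.
by rewrite dotC; exact: wW.
Qed.

End Adjoint.

(** * Positive operators and their powers *)

Section Psd.
Variables (R : realType) (V : vectType R) (g : {dot V for idfun}).
Implicit Types (f T : 'End(V)).

Lemma discriminant_le (a b c : R) :
  (forall t, 0 <= a + 2 * t * b + t ^+ 2 * c) -> b ^+ 2 <= a * c.
Proof.
move=> h; have a0 : 0 <= a by have := h 0; rewrite !mulr0 mul0r expr0n mul0r !addr0.
have [c0|c0] := ltP 0 c.
  have cN0 : c != 0 by rewrite gt_eqF.
  have := h (- b / c).
  rewrite (_ : _ + _ = a - b ^+ 2 / c); last by field.
  by rewrite subr_ge0 ler_pdivrMr.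
have [b0|b0] := eqVneq b 0.
  have -> : c = 0.
    apply/eqP; rewrite eq_le c0/=; apply/negPn/negP; rewrite -ltNge => cl.
    have cN0 : c != 0 by rewrite lt_eqF.
    (* The added 1 contributes 2 * s * c = - 2 * (a + 1), which outweighs [a] whatever the size of
       [s]. *)
    have := h ((a + 1) / - c + 1); rewrite leNgt => /negP; apply.
    set s := (a + 1) / - c; have s0 : 0 <= s by rewrite divr_ge0 ?addr_ge0// oppr_ge0.
    have sc : s * c = - (a + 1) by rewrite /s; field.
    rewrite b0 mulr0 addr0.
    have -> : (s + 1) ^+ 2 * c = s * (s * c) + 2 * (s * c) + c by ring.
    by rewrite sc; nra.
  by rewrite b0 expr0n/= mulr0.
(* This [t] makes a + 2 * t * b equal to -1, while the quadratic term is at most 0. *)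
have := h (- (a + 1) / (2 * b)).
have -> : a + 2 * (- (a + 1) / (2 * b)) * b = -1 by field.
move=> h1; exfalso; move: h1; rewrite leNgt => /negP; apply.
by have := sqr_ge0 (- (a + 1) / (2 * b)); nra.
Qed.

Definition psd f := self_adjoint g f /\ forall v, 0 <= g (f v) v.

Lemma psd_CS f u v : psd f -> g (f u) v ^+ 2 <= g (f u) u * g (f v) v.
Proof.
move=> [sf pf]; apply: discriminant_le => t.
have fE : f (u + t *: v) = f u + t *: f v by rewrite linearD linearZ.
have := pf (u + t *: v); rewrite fE !dotDl !dotDr !dotZl !dotZr.
rewrite (sf v u) (dotC g v); lra.
Qed.

Lemma psd_id : psd \1%VF.
Proof. by split=> [u v|v]; rewrite !id_lfunE// dot_ge0. Qed.

Lemma dot_CS u v : g u v ^+ 2 <= g u u * g v v.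
Proof. by have := psd_CS u v psd_id; rewrite !id_lfunE. Qed.

Definition contr f := forall v, g (f v) v <= g v v.

(** Cauchy-Schwarz for the form of [f] at [v] and [f v]; contractivity turns one factor into |f v| ^
    2, which cancels. *)
Lemma psd_contr_sqr f v : psd f -> contr f -> g (f v) (f v) <= g (f v) v.
Proof.
move=> pf cf; have [sf p0] := pf.
have := psd_CS v (f v) pf.
have := cf (f v); have := p0 v; have := dot_ge0 g (f v).
have [->|n0] := eqVneq (g (f v) (f v)) 0; first by [].
move: (g (f v) v) (g (f (f v)) (f v)) n0 => a b n0 n a0 bn h.
have np : 0 < g (f v) (f v) by rewrite lt_neqAle eq_sym n0.
rewrite -(ler_pM2r np) -expr2; apply: le_trans h _.
by rewrite ler_wpM2l.
Qed.

Lemma psd_ker f v : psd f -> g (f v) v = 0 -> f v = 0.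
Proof.
move=> pf fv; apply/eqP; rewrite -(dot_eq0 g).
have := psd_CS v (f v) pf; rewrite fv mul0r.
by rewrite real_exprn_even_le0 ?num_real// => /andP[].
Qed.

Lemma psd_sub1 f : psd f -> contr f -> psd (\1 - f)%VF.
Proof.
move=> [sf pf] cf; split=> [u v|v]; rewrite !add_lfunE !opp_lfunE !id_lfunE.
  by rewrite dotBl dotBr sf.
by rewrite dotBl subr_ge0.
Qed.

Lemma contr_sub1 f : psd f -> contr (\1 - f)%VF.
Proof.
move=> [_ pf] v; rewrite add_lfunE opp_lfunE id_lfunE dotBl.
by rewrite gerBl.
Qed.

Fixpoint lfun_pow f n : 'End(V) := if n is m.+1 then (f \o lfun_pow f m)%VF else \1%VF.

Lemma lfun_powS f n v : lfun_pow f n.+1 v = f (lfun_pow f n v).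
Proof. by rewrite /= comp_lfunE. Qed.

Lemma lfun_powSr f n v : lfun_pow f n.+1 v = lfun_pow f n (f v).
Proof.
elim: n v => [|n IH] v; first by rewrite /= !comp_lfunE !id_lfunE.
by rewrite lfun_powS IH -lfun_powS.
Qed.

Lemma lfun_powD f m n v : lfun_pow f (m + n) v = lfun_pow f m (lfun_pow f n v).
Proof.
elim: m v => [|m IH] v; first by rewrite id_lfunE.
by rewrite addSn !lfun_powS IH.
Qed.

Lemma lfun_pow_self f n : self_adjoint g f -> self_adjoint g (lfun_pow f n).
Proof.
move=> sf; elim: n => [|n IH] u v; first by rewrite !id_lfunE.
by rewrite lfun_powS sf IH -lfun_powSr.
Qed.

Lemma psd_pow f n : psd f -> psd (lfun_pow f n).
Proof.
move=> [sf pf]; split; first exact: lfun_pow_self.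
move=> v; rewrite -(odd_double_half n) -addnn addnA addnC lfun_powD.
rewrite (lfun_pow_self _ sf) addnC.
case: (odd n); last by rewrite addn0 dot_ge0.
by rewrite addn1 lfun_powS.
Qed.

(** Polynomials in [T] with nonnegative coefficients: closed under sums and products and positive
    when [T] is, so that positivity is settled algebraically. *)
Inductive power_cone T : 'End(V) -> Prop :=
| power_cone0 : power_cone T 0
| power_coneS c k f : 0 <= c -> power_cone T f ->
    power_cone T (c *: lfun_pow T k + f).

Lemma power_coneD T f h : power_cone T f -> power_cone T h -> power_cone T (f + h).
Proof.
move=> cf ch; elim: cf => [|c k f' c0 _ IH]; first by rewrite add0r.
by rewrite -addrA; exact: power_coneS.
Qed.

Lemma power_coneZ T c f : 0 <= c -> power_cone T f -> power_cone T (c *: f).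
Proof.
move=> c0; elim=> [|c' k f' c'0 _ IH]; first by rewrite scaler0; exact: power_cone0.
by rewrite scalerDr scalerA; apply: power_coneS => //; exact: mulr_ge0.
Qed.

Lemma power_cone_pow T k : power_cone T (lfun_pow T k).
Proof.
by have := power_coneS k (@ler01 R) (power_cone0 T); rewrite scale1r addr0.
Qed.

Lemma power_cone_comp T f h :
  power_cone T f -> power_cone T h -> power_cone T (f \o h)%VF.
Proof.
move=> cf ch; elim: cf => [|c k f' c0 _ IH].
  by rewrite comp_lfun0l; exact: power_cone0.
rewrite comp_lfunDl; apply: power_coneD => //.
rewrite -comp_lfunZl; apply: power_coneZ => //.
elim: ch => [|c' k' h' c'0 _ IH']; first by rewrite comp_lfun0r; exact: power_cone0.
rewrite comp_lfunDr; apply: power_coneD => //.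
rewrite -comp_lfunZr; apply: power_coneZ => //.
suff -> : (lfun_pow T k \o lfun_pow T k')%VF = lfun_pow T (k + k').
  exact: power_cone_pow.
by apply/lfunP => v; rewrite comp_lfunE lfun_powD.
Qed.

Lemma psd_power_cone T f : psd T -> power_cone T f -> psd f.
Proof.
move=> pT; elim=> [|c k f' c0 _ [sf pf]].
  by split=> [u v|v]; rewrite !zero_lfunE ?dot0l ?dot0r.
have [sk pk] := psd_pow k pT.
split=> [u v|v]; rewrite !add_lfunE !scale_lfunE.
  by rewrite dotDl dotDr dotZl dotZr sk sf.
by rewrite dotDl dotZl addr_ge0// mulr_ge0.
Qed.

End Psd.

(** * Weak convergence and iterative approximation of operators *)

Section WeakConvergence.
Variables (R : realType).

(** Convergence of all matrix entries, which in finite dimension is convergence of operators and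
    carries measurability to the limit. *)
Definition wcvg (U V : vectType R) (g : {dot V for idfun})
    (X : nat -> 'Hom(U, V)) (A : 'Hom(U, V)) : Prop :=
  forall u v, (fun n => g (X n u) v) @ \oo --> g (A u) v.

Section Hom.
Variables (U V : vectType R) (g : {dot V for idfun}).
Implicit Types (X Y : nat -> 'Hom(U, V)) (A B : 'Hom(U, V)).

Lemma wcvg_ex X : (forall u v, cvgn (fun n => g (X n u) v)) ->
  exists A, wcvg g X A.
Proof.
move=> cX; have [b ob] := exists_onb g (erefl (\dim {:V})).
have lf : linear (fun u : U => \sum_i limn (fun n => g (X n u) (b i)) *: b i).
  move=> a u v; rewrite scaler_sumr -big_split/=; apply: eq_bigr => i _.
  rewrite scalerA -scalerDl; congr (_ *: _); apply/cvg_lim => //.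
  under eq_fun do rewrite linearD linearZ/= dotDl dotZl.
  by apply: cvgD; [apply: cvgM; [exact: cvg_cst|exact: cX]|exact: cX].
have [A AE] := exists_lfun lf; exists A => u v.
rewrite AE dot_suml.
rewrite (_ : (fun n => _) = (fun n => \sum_i g (X n u) (b i) * g (b i) v)).
  apply: cvg_big => [|i _]; [exact: add_continuous|rewrite dotZl].
  by apply: cvgM; [exact: cX|exact: cvg_cst].
by apply/funext => n; exact: onb_dot.
Qed.

Lemma wcvg_unique X A B : wcvg g X A -> wcvg g X B -> A = B.
Proof.
move=> XA XB; apply/lfunP => u; apply: (dot_inj (g := g)) => v.
exact: (cvg_unique _ (XA u v) (XB u v)).
Qed.

Lemma wcvg_cst A : wcvg g (fun=> A) A.
Proof. by move=> u v; exact: cvg_cst. Qed.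

Lemma wcvgD X Y A B : wcvg g X A -> wcvg g Y B ->
  wcvg g (fun n => X n + Y n) (A + B).
Proof.
move=> XA YB u v; under eq_fun do rewrite add_lfunE dotDl.
by rewrite add_lfunE dotDl; apply: cvgD; [exact: XA|exact: YB].
Qed.

Lemma wcvgZ c X A : wcvg g X A -> wcvg g (fun n => c *: X n) (c *: A).
Proof.
move=> XA u v; under eq_fun do rewrite scale_lfunE dotZl.
by rewrite scale_lfunE dotZl; apply: cvgM; [exact: cvg_cst|exact: XA].
Qed.

Lemma wcvgB X Y A B : wcvg g X A -> wcvg g Y B ->
  wcvg g (fun n => X n - Y n) (A - B).
Proof.
move=> XA YB; rewrite -[- B]scaleN1r; under eq_fun do rewrite -scaleN1r.
by apply: wcvgD => //; exact: wcvgZ.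
Qed.

Lemma wcvg_shift X A : wcvg g X A -> wcvg g (fun n => X n.+1) A.
Proof. by move=> XA u v; rewrite (cvg_shiftS (fun n => g (X n u) v)); exact: XA. Qed.

End Hom.
Arguments wcvg_cst {U V} g A _ _ _ _.

Lemma wcvg_comp (T U V : vectType R) (gU : {dot U for idfun})
    (gV : {dot V for idfun}) (X : nat -> 'Hom(U, V)) (Y : nat -> 'Hom(T, U)) A B :
  wcvg gV X A -> wcvg gU Y B ->
  wcvg gV (fun n => (X n \o Y n)%VF) (A \o B)%VF.
Proof.
move=> XA YB t v; have [b ob] := exists_onb gU (erefl (\dim {:U})).
have E (M : 'Hom(U, V)) (N : 'Hom(T, U)) :
    gV ((M \o N)%VF t) v = \sum_i gU (N t) (b i) * gV (M (b i)) v.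
  have [_ _ bE] := ob; rewrite comp_lfunE {1}(bE (N t) (memvf _)).
  rewrite linear_sum dot_suml; apply: eq_bigr => i _.
  by rewrite linearZ/= dotZl.
rewrite E; under eq_fun do rewrite E.
apply: cvg_big => [|i _]; first exact: add_continuous.
by apply: cvgM; [exact: YB|exact: XA].
Qed.

Section Monotone.
Variables (V : vectType R) (g : {dot V for idfun}).
Implicit Types (X : nat -> 'End(V)) (A B T Y S : 'End(V)).

Lemma wcvg_self X A : (forall n, self_adjoint g (X n)) -> wcvg g X A ->
  self_adjoint g A.
Proof.
move=> sX XA u v.
have h : (fun n => g (X n u) v) @ \oo --> g u (A v).
  rewrite (_ : (fun n => _) = (fun n => g (X n v) u)); first by rewrite dotC; exact: XA.
  by apply/funext => n; rewrite sX dotC.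
exact: (cvg_unique _ (XA u v) h).
Qed.

Lemma wcvg_psd X A : (forall n, psd g (X n)) -> wcvg g X A -> psd g A.
Proof.
move=> pX XA; split; first by apply: wcvg_self XA => n; case: (pX n).
move=> v; rewrite -(cvg_lim _ (XA v v))//.
apply: limr_ge; first by apply/cvg_ex; eexists; exact: XA.
by apply: nearW => n; case: (pX n).
Qed.

Lemma wcvg_contr X A : (forall n, contr g (X n)) -> wcvg g X A -> contr g A.
Proof.
move=> cX XA v; rewrite -(cvg_lim _ (XA v v))//.
apply: limr_le; first by apply/cvg_ex; eexists; exact: XA.
by apply: nearW => n; exact: cX.
Qed.

(** The quadratic forms are increasing and bounded, hence converge; polarisation recovers the other
    entries. *)
Lemma wcvg_monotone X : (forall n, self_adjoint g (X n)) ->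
  (forall n v, g (X n v) v <= g (X n.+1 v) v) -> (forall n, contr g (X n)) ->
  exists A, wcvg g X A.
Proof.
move=> sX ndX cX; apply: wcvg_ex => u v.
have cq w : cvgn (fun n => g (X n w) w).
  apply: nondecreasing_is_cvgn; first by apply/nondecreasing_seqP => n; exact: ndX.
  by exists (g w w) => _ [n _ <-]; exact: cX.
rewrite (_ : (fun n => _) = (fun n => 4^-1 * (g (X n (u + v)) (u + v) -
    g (X n (u - v)) (u - v)))).
  apply: is_cvgM; first exact: is_cvg_cst.
  by apply: is_cvgB; exact: cq.
apply/funext => n.
have -> : X n (u + v) = X n u + X n v by rewrite linearD.
have -> : X n (u - v) = X n u - X n v by rewrite linearB.
rewrite !dotDl !dotDr !dotNl !dotNr (sX n v u) (dotC g v).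
by field.
Qed.

(** The powers decrease, so they have a limit K. From Y K = K its values are fixed by [Y]; K keeps
    the fixed vectors and is self-adjoint, hence is the orthogonal projection. *)
Lemma wcvg_pow Y : psd g Y -> contr g Y ->
  wcvg g (lfun_pow Y) (ortho_proj g (lker (\1 - Y)%VF)).
Proof.
move=> pY cY; have sY : self_adjoint g Y by case: pY.
have decr n v : g (lfun_pow Y n.+1 v) v <= g (lfun_pow Y n v) v.
  (* Moving half of the factors across reduces the claim to Y <= 1 or Y ^ 2 <= Y at the vector [w],
     according to parity. *)
  have nE : n = (n./2 + (odd n + n./2))%N by rewrite addnCA addnn odd_double_half.
  set w := lfun_pow Y n./2 v.
  have pE x : g (lfun_pow Y n x) v =
      g (lfun_pow Y (odd n) (lfun_pow Y n./2 x)) w.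
    by rewrite {1}nE !lfun_powD (lfun_pow_self _ sY).
  have comm k x : lfun_pow Y k (Y x) = Y (lfun_pow Y k x).
    by rewrite -lfun_powSr lfun_powS.
  rewrite lfun_powSr !pE comm -/w; case: (odd n); last first.
    by rewrite !id_lfunE; exact: cY.
  rewrite /= !comp_lfunE !id_lfunE [leLHS]sY.
  exact: psd_contr_sqr.
have sX n : self_adjoint g (\1 - lfun_pow Y n)%VF.
  move=> u v; rewrite !add_lfunE !opp_lfunE !id_lfunE dotBl dotBr.
  by rewrite (lfun_pow_self n sY).
have [A XA] : exists A, wcvg g (fun n => (\1 - lfun_pow Y n)%VF) A.
  apply: wcvg_monotone => // n v.
    rewrite !add_lfunE !opp_lfunE !id_lfunE !dotBl lerD2l lerN2; exact: decr.
  rewrite !add_lfunE !opp_lfunE !id_lfunE !dotBl gerBl.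
  by case: (psd_pow n pY).
have YK : wcvg g (lfun_pow Y) (\1 - A)%VF.
  have := wcvgB (wcvg_cst g (\1%VF : 'End(V))) XA.
  by under eq_fun do rewrite opprB addrC subrK.
set K := (\1 - A)%VF in YK.
have sK : self_adjoint g K by apply: wcvg_self YK => n; exact: lfun_pow_self.
have YKE : (Y \o K)%VF = K.
  apply: wcvg_unique (wcvg_shift YK).
  exact: wcvg_comp (wcvg_cst g Y) YK.
suff -> : ortho_proj g (lker (\1 - Y)%VF) = K by [].
apply/lfunP => v; apply: ortho_proj_unique.
  by rewrite memv_ker add_lfunE opp_lfunE id_lfunE -comp_lfunE YKE subrr.
move=> w; rewrite memv_ker add_lfunE opp_lfunE id_lfunE subr_eq0 => /eqP wY.
have Kw : K w = w.
  have powid n : lfun_pow Y n w = w.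
    by elim: n => [|n IH]; rewrite ?id_lfunE// lfun_powS IH -wY.
  apply: (dot_inj (g := g)) => z.
  have h : (fun n => g (lfun_pow Y n w) z) @ \oo --> g w z.
    by rewrite (_ : (fun n => _) = (fun=> g w z)); [exact: cvg_cst|apply/funext => n; rewrite powid].
  exact: (cvg_unique _ (YK w z) h).
by rewrite dotBl sK Kw subrr.
Qed.

(** A fixed point of X = (T + X ^ 2) / 2 satisfies (1 - X) ^ 2 = 1 - T, so the iteration computes 1
    - sqrt (1 - T). *)
Fixpoint sqrt_aux T n : 'End(V) :=
  if n is m.+1 then 2^-1 *: (T + (sqrt_aux T m \o sqrt_aux T m))%VF else 0.

Section SqrtAux.
Variable T : 'End(V).
Hypotheses (pT : psd g T) (cT : contr g T).

Let cone_T : power_cone T T.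
Proof.
by have := power_cone_pow T 1; rewrite /= comp_lfun1r.
Qed.

Let half_ge0 : 0 <= 2^-1 :> R. Proof. by rewrite invr_ge0. Qed.

Let cone_sqrt n : power_cone T (sqrt_aux T n).
Proof.
elim: n => [|n IH]; first exact: power_cone0.
by apply: power_coneZ => //; apply: power_coneD => //; exact: power_cone_comp.
Qed.

(** X ^ 2 - Z ^ 2 = (X - Z) X + Z (X - Z) stays in the cone, so increments stay positive. *)
Let cone_sqrtB n : power_cone T (sqrt_aux T n.+1 - sqrt_aux T n).
Proof.
elim: n => [|n IH].
  by rewrite /= comp_lfun0l addr0 subr0; exact: power_coneZ.
rewrite [sqrt_aux T n.+2]/= [sqrt_aux T n.+1 in X in _ - X]/=.
set X := sqrt_aux T n.+1 in IH *; set Z := sqrt_aux T n in IH *.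
have -> : 2^-1 *: (T + (X \o X))%VF - 2^-1 *: (T + (Z \o Z))%VF =
    2^-1 *: (((X - Z) \o X) + (Z \o (X - Z)))%VF.
  rewrite -scalerBr; congr (_ *: _).
  rewrite comp_lfunDl comp_lfunDr comp_lfunNl comp_lfunNr addrACA.
  move: (X \o X)%VF (Z \o X)%VF (Z \o Z)%VF => a b c.
  rewrite opprD [LHS]addrACA subrr add0r [RHS]addrA addrK.
  by [].
apply: power_coneZ => //; apply: power_coneD; apply: power_cone_comp => //.
- exact: (cone_sqrt n.+1).
- exact: (cone_sqrt n).
Qed.

Lemma psd_sqrt_aux n : psd g (sqrt_aux T n).
Proof. exact: psd_power_cone pT (cone_sqrt n). Qed.

Lemma contr_sqrt_aux n : contr g (sqrt_aux T n).
Proof.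
elim: n => [|n IH] v; first by rewrite zero_lfunE dot0l dot_ge0.
rewrite /= scale_lfunE add_lfunE comp_lfunE dotZl dotDl.
have [sX _] := psd_sqrt_aux n; rewrite sX.
have := psd_contr_sqr v (psd_sqrt_aux n) IH.
have := IH v; have := cT v; lra.
Qed.

Lemma wcvg_sqrt_aux : exists A, [/\ wcvg g (sqrt_aux T) A, psd g A, contr g A &
  A = 2^-1 *: (T + (A \o A))%VF].
Proof.
have [A XA] : exists A, wcvg g (sqrt_aux T) A.
  apply: wcvg_monotone => [n|n v|n]; last exact: contr_sqrt_aux.
    by case: (psd_sqrt_aux n).
  have [_ /(_ v)] := psd_power_cone pT (cone_sqrtB n).
  by rewrite add_lfunE opp_lfunE dotBl subr_ge0.
exists A; split=> //.
- exact: wcvg_psd psd_sqrt_aux XA.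
- exact: wcvg_contr contr_sqrt_aux XA.
apply: wcvg_unique (wcvg_shift XA) _.
apply: wcvgZ; apply: wcvgD; first exact: wcvg_cst.
exact (wcvg_comp XA XA).
Qed.

End SqrtAux.

Definition fullv_onb : 'I_(\dim {:V}) -> V :=
  sval (cid (exists_onb g (erefl (\dim {:V})))).

Lemma fullv_onbP : onb g fullv_onb fullv.
Proof. by rewrite /fullv_onb; case: cid. Qed.

Definition dot_trace S : R := \sum_i g (S (fullv_onb i)) (fullv_onb i).

Lemma dot_trace_onb n (b : 'I_n -> V) S : onb g b fullv ->
  \sum_i g (S (b i)) (b i) = dot_trace S.
Proof.
move=> ob; have [_ _ bE] := ob; rewrite /dot_trace.
under eq_bigr do rewrite (onb_dot _ _ fullv_onbP).
rewrite exchange_big/=; apply: eq_bigr => k _.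
have -> : S (fullv_onb k) = \sum_i g (fullv_onb k) (b i) *: S (b i).
  rewrite {1}(bE (fullv_onb k) (memvf _)) linear_sum.
  by apply: eq_bigr => i _; rewrite linearZ.
by rewrite dot_suml; apply: eq_bigr => i _; rewrite dotZl mulrC.
Qed.

(** Cauchy-Schwarz for the form of [S] against each basis vector bounds |S v| ^ 2 by the trace times
    the form at [v]; ordinary Cauchy-Schwarz and a cancellation finish. *)
Lemma psd_le_trace S v : psd g S -> g (S v) v <= dot_trace S * g v v.
Proof.
move=> pS; have [sS p0] := pS.
set q := g (S v) v.
have h : g (S v) (S v) <= dot_trace S * q.
  rewrite (onb_dot_sqr _ fullv_onbP) /dot_trace mulr_suml; apply: ler_sum => i _.
  by rewrite sS dotC; exact: psd_CS.
have q0 : 0 <= q by exact: p0.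
have [->|qN0] := eqVneq q 0.
  rewrite mulr_ge0 ?dot_ge0//.
  by apply: sumr_ge0 => i _; exact: p0.
have qp : 0 < q by rewrite lt_neqAle eq_sym qN0.
rewrite -(ler_pM2r qp) -expr2; apply: le_trans (dot_CS g (S v) v) _.
by rewrite mulrAC ler_wpM2r ?dot_ge0.
Qed.

Lemma dot_trace_ge0 S : psd g S -> 0 <= dot_trace S.
Proof. by move=> [_ p0]; apply: sumr_ge0. Qed.

(** The trace brings [S] below the identity and is invariant under conjugation; the added 1 keeps
    the divisor positive when S = 0. *)
Definition nrm S : 'End(V) := (dot_trace S + 1)^-1 *: S.

Lemma nrm_gt0 S : psd g S -> 0 < dot_trace S + 1.
Proof. by move=> pS; rewrite ltr_wpDl// dot_trace_ge0. Qed.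

Lemma psd_nrm S : psd g S -> psd g (nrm S).
Proof.
move=> pS; have [sS p0] := pS; have c0 := nrm_gt0 pS.
split=> [u v|v]; rewrite !scale_lfunE dotZl ?dotZr ?sS//.
by rewrite -sS mulr_ge0// invr_ge0 ltW.
Qed.

Lemma contr_nrm S : psd g S -> contr g (nrm S).
Proof.
move=> pS v; have c0 := nrm_gt0 pS; rewrite scale_lfunE dotZl mulrC.
rewrite ler_pdivrMr// mulrC; apply: le_trans (psd_le_trace v pS) _.
by rewrite ler_wpM2r ?dot_ge0// lerDl.
Qed.

Lemma lker_nrm S : psd g S -> lker (nrm S) = lker S.
Proof.
move=> pS; have c0 := nrm_gt0 pS; apply/vspaceP => v.
by rewrite !memv_ker scale_lfunE scaler_eq0 invr_eq0 gt_eqF.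
Qed.

Definition ker_approx S n : 'End(V) := lfun_pow (\1 - nrm S)%VF n.

Lemma wcvg_ker_approx S : psd g S ->
  wcvg g (ker_approx S) (ortho_proj g (lker S)).
Proof.
move=> pS; have := wcvg_pow (psd_sub1 (psd_nrm pS) (contr_nrm pS))
  (contr_sub1 (psd_nrm pS)).
by rewrite subKr lker_nrm.
Qed.

Definition sqrt_approx S n : 'End(V) :=
  Num.sqrt (dot_trace S + 1) *: (\1 - sqrt_aux (\1 - nrm S)%VF n)%VF.

(** Taken as the limit of the approximants, from which it inherits measurability and
    equivariance. *)
Definition sqrt_op S : 'End(V) := xget 0 [set A | wcvg g (sqrt_approx S) A].

Lemma sqrt_opP S : psd g S -> [/\ wcvg g (sqrt_approx S) (sqrt_op S),
  psd g (sqrt_op S) & (sqrt_op S \o sqrt_op S)%VF = S].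
Proof.
move=> pS; have c0 := nrm_gt0 pS.
set c := dot_trace S + 1 in c0.
have [A [XA pA cA AE]] := wcvg_sqrt_aux
  (psd_sub1 (psd_nrm pS) (contr_nrm pS)) (contr_sub1 (psd_nrm pS)).
have XS : wcvg g (sqrt_approx S) (Num.sqrt c *: (\1 - A)%VF).
  by apply: wcvgZ; apply: wcvgB => //; exact: wcvg_cst.
have <- : Num.sqrt c *: (\1 - A)%VF = sqrt_op S.
  have XO : wcvg g (sqrt_approx S) (sqrt_op S).
    by apply: (@xgetPex _ 0 [set B | wcvg g (sqrt_approx S) B]); exists (Num.sqrt c *: (\1 - A)%VF).
  exact: wcvg_unique XS XO.
split=> //.
  have [s1 p1] := psd_sub1 pA cA; split=> [u v|v]; rewrite !scale_lfunE.
    by rewrite dotZl dotZr s1.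
  by rewrite dotZl mulr_ge0 ?sqrtr_ge0.
rewrite -comp_lfunZl -comp_lfunZr scalerA -expr2 sqr_sqrtr ?ltW//.
rewrite !(comp_lfunDl, comp_lfunDr, comp_lfunNl, comp_lfunNr, comp_lfun1l, comp_lfun1r).
rewrite opprK.
have AA : (A \o A)%VF = A + A - (\1 - nrm S)%VF.
  have -> : A + A = (\1 - nrm S + (A \o A))%VF.
    rewrite {1 2}AE -scalerDl -[RHS]scale1r; congr (_ *: _); by field.
  by rewrite [RHS]addrC addKr.
rewrite {}AA addrA.
have -> : \1%VF - A - A + (A + A - (\1%VF - nrm S)) = nrm S.
  by rewrite !addrA subrK subrK subKr.
by rewrite /nrm scalerA divff ?scale1r// gt_eqF.
Qed.

Fixpoint neumann Y n : 'End(V) :=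
  if n is m.+1 then neumann Y m + lfun_pow Y m else 0.

Lemma neumannE Y n : (neumann Y n \o (\1 - Y))%VF = (\1 - lfun_pow Y n)%VF.
Proof.
elim: n => [|n IH]; first by rewrite comp_lfun0l subrr.
rewrite /= comp_lfunDl IH comp_lfunDr comp_lfun1r comp_lfunNr.
rewrite (_ : (lfun_pow Y n \o Y)%VF = (Y \o lfun_pow Y n)%VF); last first.
  by apply/lfunP => v; rewrite !comp_lfunE -lfun_powSr lfun_powS.
by rewrite addrA subrK.
Qed.

(** The inverse is the inverse Gram operator composed with the adjoint; the former is replaced by a
    truncated Neumann series. *)
Definition inv_approx (N : 'End(V)) n : 'End(V) :=
  let S := gram g g N in
  ((dot_trace S + 1)^-1 *: neumann (\1 - nrm S) n \o adj g g N)%VF.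

Lemma psd_gram (U : vectType R) (gU : {dot U for idfun}) (f : 'Hom(V, U)) :
  psd g (gram g gU f).
Proof.
split=> [u v|v]; last by rewrite dot_gram dot_ge0.
by rewrite dot_gram [RHS]dotC dot_gram dotC.
Qed.

(** The series telescopes to the inverse up to a power of 1 - [nrm], which tends to the projection
    on a zero kernel. *)
Lemma wcvg_inv N : lker N == 0%VS -> wcvg g (inv_approx N) (N^-1)%VF.
Proof.
move=> kN; set S := gram g g N; have pS : psd g S by exact: psd_gram.
have E n : inv_approx N n = ((\1 - ker_approx S n) \o N^-1)%VF.
  apply/lfunP => w; rewrite -{1}(lker0_lfunVK kN w) !comp_lfunE.
  have <- := neumannE (\1 - nrm S)%VF n.
  rewrite subKr /inv_approx -/S comp_lfunE !scale_lfunE.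
  by rewrite [RHS]linearZ/= /S /gram [in RHS]comp_lfunE.
have -> : (N^-1)%VF = ((\1 - ortho_proj g (lker S)) \o N^-1)%VF.
  apply/lfunP => w; rewrite comp_lfunE add_lfunE opp_lfunE id_lfunE.
  have := ortho_proj_in g (lker S) (N^-1%VF w).
  by rewrite lker_gram (eqP kN) memv0 => /eqP ->; rewrite subr0.
rewrite (funext E); apply: wcvg_comp (wcvg_cst g _).
by apply: wcvgB; [exact: wcvg_cst|exact: wcvg_ker_approx].
Qed.

End Monotone.

End WeakConvergence.

(** * Polar factors *)

Section Isometries.
Variables (R : realType) (E V : vectType R).
Variables (gE : {dot E for idfun}) (g : {dot V for idfun}).
Implicit Types (f U : 'Hom(E, V)) (Q : 'End(V)) (O : 'End(E)) (W : {vspace V}).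

Lemma isometry_inj f : isometry g gE f -> lker f = 0%VS.
Proof.
move=> /isometryP h; apply/eqP; rewrite -subv0; apply/subvP => u.
by rewrite memv_ker memv0 -(dot_eq0 gE) -h => /eqP ->; rewrite dot0l.
Qed.

Lemma isometry_adjK f : isometry g gE f -> (adj gE g f \o f)%VF = \1%VF.
Proof.
move=> /isometryP h; apply/lfunP => u; apply: (dot_inj (g := gE)) => v.
by rewrite comp_lfunE adjl h id_lfunE.
Qed.

Lemma dim_limg_eq f W : (limg f <= W)%VS -> lker f = 0%VS ->
  \dim W = \dim {:E} -> limg f = W.
Proof.
move=> fW kf dW; apply/eqP; rewrite eqEdim fW/=.
by rewrite limg_dim_eq ?dW// kf capv0.
Qed.

(** Transitivity of left composition on isometries: match the images of an orthonormal basis. *)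
Lemma exists_orthogonal_comp U U' : isometry g gE U -> isometry g gE U' ->
  exists2 Q, orthogonal_ops g Q & (Q \o U)%VF = U'.
Proof.
move=> /isometryP iU /isometryP iU'.
have [b [_ bb bE]] := exists_onb gE (erefl (\dim {:E})).
have [i j|i j|Q oQ QE] := @exists_isometry_onb _ _ g _ (U \o b) (U' \o b).
- by rewrite /= iU.
- by rewrite /= iU'.
exists Q => //; apply/lfunP => u; rewrite (bE u (memvf _)) !linear_sum.
by apply: eq_bigr => i _; rewrite !linearZ/= comp_lfunE [Q _]QE.
Qed.

End Isometries.

Section Orthogonal.
Variables (R : realType) (V : vectType R) (g : {dot V for idfun}).
Implicit Types (Q : 'End(V)) (W : {vspace V}).

Lemma exists_orthogonal_img W W' : \dim W = \dim W' ->
  exists2 Q, orthogonal_ops g Q & (Q @: W)%VS = W'.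
Proof.
move=> dW.
have [b [bW bb bE]] := exists_onb g dW.
have [c [cW cc cE]] := exists_onb g (erefl (\dim W')).
have [Q oQ QE] := exists_isometry_onb bb cc; exists Q => //.
apply/eqP; rewrite eqEdim; apply/andP; split.
  apply/subvP => _ /memv_imgP[v /bE -> ->]; rewrite linear_sum memv_suml// => i _.
  by rewrite linearZ/= QE memvZ.
by rewrite limg_dim_eq ?dW// (isometry_inj oQ) capv0.
Qed.

Lemma orthogonal_adjK Q : orthogonal_ops g Q -> (Q \o adj g g Q)%VF = \1%VF.
Proof.
move=> oQ; have kQ : lker Q == 0%VS by rewrite (isometry_inj oQ).
apply/lfunP => v; rewrite -(lker0_lfunVK kQ v) comp_lfunE id_lfunE.
congr (Q _); move: (Q^-1%VF v) => u; rewrite -comp_lfunE.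
by rewrite (isometry_adjK oQ) id_lfunE.
Qed.

Lemma orthogonal_adj Q : orthogonal_ops g Q -> orthogonal_ops g (adj g g Q).
Proof.
move=> oQ; apply/isometryP => u v.
by rewrite adjl -comp_lfunE (orthogonal_adjK oQ) id_lfunE.
Qed.

Lemma ortho_proj_img Q W : orthogonal_ops g Q ->
  ortho_proj g (Q @: W) = (Q \o (ortho_proj g W \o adj g g Q))%VF.
Proof.
move=> oQ; apply/lfunP => v; rewrite !comp_lfunE; apply: ortho_proj_unique.
  by rewrite memv_img// ortho_proj_in.
move=> _ /memv_imgP[w wW ->]; rewrite dotBl -(adjl g g Q).
by rewrite ((isometryP _ _ _).1 oQ) dot_ortho_projl// subrr.
Qed.

End Orthogonal.

(** * Equivariance of the square root *)

Section Conjugation.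
Variables (R : realType) (E : vectType R) (gE : {dot E for idfun}).
Variables (O : 'End(E)).
Hypothesis oO : orthogonal_ops gE O.
Implicit Types S T : 'End(E).

(** Conjugation preserves sums, products, the identity and the trace, hence commutes with every
    approximant of the square root. *)
Let oc T : 'End(E) := (adj gE gE O \o (T \o O))%VF.

Let ocD S T : oc (S + T) = oc S + oc T.
Proof. by rewrite /oc comp_lfunDl comp_lfunDr. Qed.

Let ocZ c T : oc (c *: T) = c *: oc T.
Proof. by rewrite /oc -comp_lfunZl -comp_lfunZr. Qed.

Let oc1 : oc \1 = \1%VF.
Proof. by rewrite /oc comp_lfun1l (isometry_adjK oO). Qed.

Let ocN T : oc (- T) = - oc T.
Proof. by rewrite -scaleN1r ocZ scaleN1r. Qed.

Let oc_comp S T : oc (S \o T)%VF = (oc S \o oc T)%VF.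
Proof.
apply/lfunP => u; rewrite /oc !comp_lfunE; congr (adj gE gE O (S _)).
by rewrite -[RHS]comp_lfunE (orthogonal_adjK oO) id_lfunE.
Qed.

Let oc0 : oc 0 = 0.
Proof. by rewrite /oc comp_lfun0l comp_lfun0r. Qed.

Lemma dot_trace_conj S : dot_trace gE (oc S) = dot_trace gE S.
Proof.
have [b ob] := exists_onb gE (erefl (\dim {:E})); have [_ bb bE] := ob.
have ob' : onb gE (O \o b) fullv.
  have iO := (isometryP _ _ _).1 oO; split=> [i|i j|v _]; first exact: memvf.
    by rewrite /= iO bb.
  have kO : lker O == 0%VS by rewrite (isometry_inj oO).
  rewrite -(lker0_lfunVK kO v); move: (O^-1%VF v) => u.
  rewrite {1}(bE u (memvf _)) linear_sum; apply: eq_bigr => i _.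
  by rewrite linearZ/= iO.
rewrite -(dot_trace_onb _ ob) -(dot_trace_onb _ ob').
by apply: eq_bigr => i _; rewrite /oc !comp_lfunE adjl.
Qed.

Lemma nrm_conj S : nrm gE (oc S) = oc (nrm gE S).
Proof. by rewrite /nrm dot_trace_conj ocZ. Qed.

Lemma sqrt_aux_conj T n : sqrt_aux (oc T) n = oc (sqrt_aux T n).
Proof. by elim: n => [|n IH]; rewrite /= ?oc0// ocZ ocD oc_comp IH. Qed.

Lemma psd_conj S : psd gE S -> psd gE (oc S).
Proof.
move=> [sS pS]; split=> [u v|v]; rewrite /oc !comp_lfunE adjl ?adjr// sS.
Qed.

Lemma sqrt_op_conj S : psd gE S -> sqrt_op gE (oc S) = oc (sqrt_op gE S).
Proof.
move=> pS; have [XS _ _] := sqrt_opP pS.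
have [XO _ _] := sqrt_opP (psd_conj pS).
have XE n : sqrt_approx gE (oc S) n = oc (sqrt_approx gE S n).
  rewrite /sqrt_approx dot_trace_conj nrm_conj.
  have -> : (\1 - oc (nrm gE S))%VF = oc (\1 - nrm gE S)%VF by rewrite ocD ocN oc1.
  rewrite [RHS]ocZ sqrt_aux_conj; congr (_ *: _).
  by rewrite [RHS]ocD ocN oc1.
apply: wcvg_unique XO _; rewrite (funext XE).
exact (wcvg_comp (@wcvg_cst _ _ _ gE (adj gE gE O)) (wcvg_comp XS (@wcvg_cst _ _ _ gE O))).
Qed.

End Conjugation.

Section Polar.
Variables (R : realType) (E V : vectType R).
Variables (gE : {dot E for idfun}) (g : {dot V for idfun}).
Implicit Types (f U : 'Hom(E, V)) (Q : 'End(V)) (O : 'End(E)) (W : {vspace V}).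

Definition polar_pos f : 'End(E) := sqrt_op gE (gram gE g f).

(* Adding the projection on the kernel makes the inverse meaningful for every [f],
   so that both polar factors are everywhere equivariant. *)
Definition polar_reg f : 'End(E) := polar_pos f + ortho_proj gE (lker f).

Definition polar_iso f : 'Hom(E, V) := (f \o (polar_reg f)^-1)%VF.

Lemma polar_pos_psd f : psd gE (polar_pos f).
Proof. by have [] := sqrt_opP (psd_gram gE g f). Qed.

Lemma polar_pos_sqr f : (polar_pos f \o polar_pos f)%VF = gram gE g f.
Proof. by have [] := sqrt_opP (psd_gram gE g f). Qed.

Lemma dot_polar_pos f u v :
  gE (polar_pos f u) (polar_pos f v) = g (f u) (f v).
Proof.
have [s _] := polar_pos_psd f.
by rewrite -(dot_gram gE g) -polar_pos_sqr comp_lfunE [RHS]s.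
Qed.

Lemma lker_polar_pos f : lker (polar_pos f) = lker f.
Proof.
apply/vspaceP => u; rewrite !memv_ker -(dot_eq0 gE) -(dot_eq0 g).
by rewrite dot_polar_pos.
Qed.

(** The positive factor and the kernel projection have orthogonal values at [v], so a zero of the
    sum is a zero of both. *)
Lemma lker_polar_reg f : lker (polar_reg f) == 0%VS.
Proof.
rewrite -subv0; apply/subvP => v; rewrite memv_ker memv0 add_lfunE => /eqP Nv.
set K := ortho_proj gE (lker f) in Nv *.
have [sA _] := polar_pos_psd f.
have AK : gE (polar_pos f v) (K v) = 0.
  have : K v \in lker (polar_pos f) by rewrite lker_polar_pos ortho_proj_in.
  by rewrite sA memv_ker => /eqP ->; rewrite dot0r.
have KK : gE (K v) (K v) = 0.
  by rewrite -[RHS](dot0l gE (K v)) -Nv dotDl AK add0r.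
have K0 : K v = 0 by apply/eqP; rewrite -(dot_eq0 gE) KK.
move: Nv; rewrite K0 addr0 => Av.
have vk : v \in lker f by rewrite -lker_polar_pos memv_ker Av.
by rewrite -K0 /K ortho_proj_id.
Qed.

Lemma polar_iso_reg f : (polar_iso f \o polar_reg f)%VF = f.
Proof.
apply/lfunP => u; rewrite !comp_lfunE lker0_lfunK//; exact: lker_polar_reg.
Qed.

(** Reduces the equivariance of [polar_iso] to checking a factorisation. *)
Lemma polar_iso_unique f U : (U \o polar_reg f)%VF = f -> polar_iso f = U.
Proof.
move=> Uf; apply/lfunP => u.
rewrite -(lker0_lfunVK (lker_polar_reg f) u); move: (_ u) => v.
by rewrite -!comp_lfunE polar_iso_reg Uf.
Qed.

Lemma limg_polar_iso_sub f : (limg (polar_iso f) <= limg f)%VS.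
Proof. by rewrite /polar_iso limg_comp limgS// subvf. Qed.

Lemma polar_compl Q f : orthogonal_ops g Q ->
  [/\ polar_pos (Q \o f)%VF = polar_pos f &
      polar_iso (Q \o f)%VF = (Q \o polar_iso f)%VF].
Proof.
move=> oQ; have iQ := (isometryP _ _ _).1 oQ.
have gE' : gram gE g (Q \o f)%VF = gram gE g f.
  apply/lfunP => u; apply: (dot_inj (g := gE)) => v.
  by rewrite !dot_gram !comp_lfunE iQ.
have kE : lker (Q \o f)%VF = lker f.
  by rewrite -(lker_gram gE g (Q \o f)%VF) gE' lker_gram.
split; first by rewrite /polar_pos gE'.
apply: polar_iso_unique; rewrite /polar_reg kE /polar_pos gE' -comp_lfunA.
by rewrite polar_iso_reg.
Qed.

(** Right composition conjugates the Gram operator and the kernel projection, hence [polar_reg], so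
    one [O] comes out on the right. *)
Lemma polar_iso_compr f O : orthogonal_ops gE O ->
  polar_iso (f \o O)%VF = (polar_iso f \o O)%VF.
Proof.
move=> oO; have iO := (isometryP _ _ _).1 oO.
have OO u : O (adj gE gE O u) = u.
  by rewrite -comp_lfunE (orthogonal_adjK oO) id_lfunE.
have gO : gram gE g (f \o O)%VF = (adj gE gE O \o (gram gE g f \o O))%VF.
  apply/lfunP => u; apply: (dot_inj (g := gE)) => v.
  by rewrite dot_gram !comp_lfunE adjl adjl.
have pO : ortho_proj gE (lker (f \o O)%VF) =
    (adj gE gE O \o (ortho_proj gE (lker f) \o O))%VF.
  apply/lfunP => u; rewrite !comp_lfunE; apply: ortho_proj_unique.
    by rewrite memv_ker comp_lfunE OO -memv_ker ortho_proj_in.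
  move=> w; rewrite memv_ker comp_lfunE -memv_ker => wk.
  by rewrite dotBl adjl -iO dot_ortho_projl// subrr.
apply: polar_iso_unique.
rewrite /polar_reg /polar_pos gO sqrt_op_conj//; last exact: psd_gram.
rewrite pO -comp_lfunDr -comp_lfunDl -/(polar_pos f) -/(polar_reg f).
by apply/lfunP => u; rewrite !comp_lfunE OO lker0_lfunK// lker_polar_reg.
Qed.

Section FullRank.
Variable f : 'Hom(E, V).
Hypothesis f0 : lker f = 0%VS.

Lemma polar_reg_full : polar_reg f = polar_pos f.
Proof.
rewrite /polar_reg f0 [ortho_proj _ _](_ : _ = 0) ?addr0//.
apply/lfunP => v; have := ortho_proj_in gE 0%VS v.
by rewrite memv0 zero_lfunE => /eqP.
Qed.

Lemma polar_iso_pos : f = (polar_iso f \o polar_pos f)%VF.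
Proof. by rewrite -polar_reg_full polar_iso_reg. Qed.

Lemma lker_polar_pos_full : lker (polar_pos f) == 0%VS.
Proof. by rewrite lker_polar_pos f0. Qed.

Lemma polar_iso_isometry : isometry g gE (polar_iso f).
Proof.
apply/isometryP => u v.
rewrite -(lker0_lfunVK lker_polar_pos_full u) -(lker0_lfunVK lker_polar_pos_full v).
by rewrite -![polar_iso f _]comp_lfunE -polar_iso_pos dot_polar_pos.
Qed.

Lemma limg_polar_iso : limg (polar_iso f) = limg f.
Proof.
apply: dim_limg_eq; first exact: limg_polar_iso_sub.
  exact: isometry_inj polar_iso_isometry.
by rewrite limg_dim_eq// f0 capv0.
Qed.

Lemma polar_pos_definite : positive_definite gE (polar_pos f).
Proof.
move=> u u0; have pA := polar_pos_psd f; have [_ p0] := pA.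
rewrite lt_neqAle p0 andbT eq_sym; apply: contra u0 => /eqP Au.
have := psd_ker pA Au => /eqP; rewrite -memv_ker (eqP lker_polar_pos_full).
by rewrite memv0.
Qed.

End FullRank.

Lemma isometry_transitive W U U' : isometry g gE U -> isometry g gE U' ->
  (limg U <= W)%VS -> (limg U' <= W)%VS -> \dim W = \dim {:E} ->
  exists2 O, orthogonal_ops gE O & (U \o O)%VF = U'.
Proof.
move=> iU iU' UW U'W dW.
have UE := dim_limg_eq UW (isometry_inj iU) dW.
have UU' : (U \o (adj gE g U \o U'))%VF = U'.
  apply/lfunP => u; rewrite !comp_lfunE.
  have /memv_imgP[v _ ->] : U' u \in limg U.
    by rewrite UE (subvP U'W)// memv_img ?memvf.
  by congr (U _); rewrite -comp_lfunE (isometry_adjK iU) id_lfunE.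
exists (adj gE g U \o U')%VF => //; apply/isometryP => u v.
rewrite -((isometryP _ _ _).1 iU) -![U (_ _)]comp_lfunE UU'.
exact: ((isometryP _ _ _).1 iU').
Qed.

End Polar.

(** * Measurability of operator-valued maps *)

Section MeasurableHom.
Context d (T : measurableType d) (R : realType).
Implicit Types (D : set T).

Definition mhom (U V : vectType R) (g : {dot V for idfun}) (X : T -> 'Hom(U, V)) :=
  forall u v, measurable_fun setT (fun w => g (X w u) v).

(** Each linear functional is a combination of inner products with a basis, so matrix entries
    generate the same sigma-algebra. *)
Lemma measurable_homP (U V : vectType R) (g : {dot V for idfun})
    (X : T -> borel_hom U V) : measurable_fun setT X <-> mhom g X.
Proof.
split=> [mX u v|mX].
  have lf : linear (fun y => g y v : R^o) by move=> a x y; rewrite dotDl dotZl.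
  have [phi phiE] := exists_lfun lf.
  have -> : (fun w => g (X w u) v) = (fun f : borel_hom U V => phi (f u) : R) \o X.
    by apply/funext => w /=; rewrite phiE.
  apply: measurableT_comp mX => _ Y mY; rewrite setTI.
  by apply: sub_sigma_algebra; exists u, phi, Y.
apply: (@measurability _ _ T (borel_hom U V) setT X (@hom_generators R U V)) => //.
move=> _ [_ [u [phi [Y [mY ->]]]] <-]; rewrite setTI.
have [b ob] := exists_onb g (erefl (\dim {:V})); have [_ _ bE] := ob.
rewrite (_ : _ @^-1` _ =
    (fun w => \sum_i g (X w u) (b i) * (phi (b i) : R)) @^-1` Y).
  rewrite -[_ @^-1` _]setTI.
  suff : measurable_fun setT (fun w => \sum_i g (X w u) (b i) * (phi (b i) : R)).
    by apply.
  by apply: measurable_sum => i; apply: measurable_funM => //; exact: mX.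
apply/funext => w /=; congr Y; rewrite {1}(bE (X w u) (memvf _)) linear_sum.
by apply: eq_bigr => i _; rewrite linearZ.
Qed.

Section Ops.
Variables (S U V : vectType R).
Variables (gS : {dot S for idfun}) (gU : {dot U for idfun}) (g : {dot V for idfun}).

Lemma mhom_cst (f : 'Hom(U, V)) : mhom g (fun=> f).
Proof. by move=> u v; exact: measurable_cst. Qed.

Lemma mhom_comp (X : T -> 'Hom(U, V)) (Y : T -> 'Hom(S, U)) :
  mhom g X -> mhom gU Y -> mhom g (fun w => (X w \o Y w)%VF).
Proof.
move=> mX mY s v; have [b ob] := exists_onb gU (erefl (\dim {:U})).
have [_ _ bE] := ob.
rewrite (_ : (fun w => _) = (fun w => \sum_i gU (Y w s) (b i) * g (X w (b i)) v)).
  by apply: measurable_sum => i; apply: measurable_funM; [exact: mY|exact: mX].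
apply/funext => w; rewrite comp_lfunE {1}(bE (Y w s) (memvf _)).
rewrite linear_sum dot_suml; apply: eq_bigr => i _.
by rewrite linearZ/= dotZl.
Qed.

Lemma mhomD (X Y : T -> 'Hom(U, V)) : mhom g X -> mhom g Y ->
  mhom g (fun w => X w + Y w).
Proof.
move=> mX mY u v; under eq_fun do rewrite add_lfunE dotDl.
by apply: measurable_funD; [exact: mX|exact: mY].
Qed.

Lemma mhomZ (c : T -> R) (X : T -> 'Hom(U, V)) : measurable_fun setT c ->
  mhom g X -> mhom g (fun w => c w *: X w).
Proof.
move=> mc mX u v; under eq_fun do rewrite scale_lfunE dotZl.
by apply: measurable_funM => //; exact: mX.
Qed.

Lemma mhomB (X Y : T -> 'Hom(U, V)) : mhom g X -> mhom g Y ->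
  mhom g (fun w => X w - Y w).
Proof.
move=> mX mY; under eq_fun do rewrite -scaleN1r.
by apply: mhomD => //; apply: mhomZ => //; exact: measurable_cst.
Qed.

Lemma mhom_adj (X : T -> 'Hom(U, V)) : mhom g X -> mhom gU (fun w => adj gU g (X w)).
Proof.
move=> mX v u; under eq_fun do rewrite adjl dotC.
exact: mX.
Qed.

Lemma mhom_wcvg (X : nat -> T -> 'Hom(U, V)) (A : T -> 'Hom(U, V)) :
  (forall n, mhom g (X n)) -> (forall w, wcvg g (X ^~ w) (A w)) -> mhom g A.
Proof.
move=> mX XA u v.
apply: (@measurable_fun_cvg _ _ _ _ (fun n w => g (X n w u) v)) => [n|w _].
  exact: mX.
exact: XA.
Qed.

End Ops.

Lemma mhom_gram (U V : vectType R) (gU : {dot U for idfun}) (g : {dot V for idfun})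
  (X : T -> 'Hom(U, V)) : mhom g X -> mhom gU (fun w => gram gU g (X w)).
Proof. by move=> mX; apply: (mhom_comp (gU := g)) => //; exact: mhom_adj. Qed.

Section Endo.
Variables (V : vectType R) (g : {dot V for idfun}).
Implicit Types (S N : T -> 'End(V)).

Lemma measurable_dot_trace S : mhom g S -> measurable_fun setT (fun w => dot_trace g (S w)).
Proof. by move=> mS; apply: measurable_sum => i; exact: mS. Qed.

Lemma measurable_nrm_factor S : (forall w, psd g (S w)) -> mhom g S ->
  measurable_fun setT (fun w => (dot_trace g (S w) + 1)^-1).
Proof.
move=> pS mS.
(* The power with exponent -1 is measurable and agrees with the inverse on positive numbers. *)
rewrite (_ : (fun w => _) = (@powR R)^~ (-1) \o (fun w => dot_trace g (S w) + 1)).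
  apply: measurableT_comp; first exact: measurable_powR.
  by apply: measurable_funD => //; exact: measurable_dot_trace.
by apply/funext => w /=; rewrite powR_inv1// ltW// nrm_gt0.
Qed.

Lemma mhom_nrm S : (forall w, psd g (S w)) -> mhom g S ->
  mhom g (fun w => nrm g (S w)).
Proof.
by move=> pS mS; apply: mhomZ => //; exact: measurable_nrm_factor.
Qed.

Lemma mhom_pow S n : mhom g S -> mhom g (fun w => lfun_pow (S w) n).
Proof.
move=> mS; elim: n => [|n IH] /=; first exact: mhom_cst.
exact: (mhom_comp (gU := g)).
Qed.

Lemma mhom_sqrt_aux S n : mhom g S -> mhom g (fun w => sqrt_aux (S w) n).
Proof.
move=> mS; elim: n => [|n IH] /=; first exact: mhom_cst.
apply: mhomZ; first exact: measurable_cst.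
by apply: mhomD => //; exact: (mhom_comp (gU := g)).
Qed.

Lemma mhom_sqrt_op S : (forall w, psd g (S w)) -> mhom g S ->
  mhom g (fun w => sqrt_op g (S w)).
Proof.
move=> pS mS.
apply: (@mhom_wcvg _ _ g (fun n w => sqrt_approx g (S w) n)) => [n|w]; last first.
  by have [] := sqrt_opP (pS w).
apply: mhomZ.
  apply: measurableT_comp; first exact: continuous_measurable_fun (@sqrt_continuous R).
  by apply: measurable_funD => //; exact: measurable_dot_trace.
apply: mhomB; first exact: mhom_cst.
apply: mhom_sqrt_aux; apply: mhomB; first exact: mhom_cst.
exact: mhom_nrm.
Qed.

Lemma mhom_ortho_proj_lker (U : vectType R) (gU : {dot U for idfun})
    (X : T -> 'Hom(V, U)) : mhom gU X -> mhom g (fun w => ortho_proj g (lker (X w))).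
Proof.
move=> mX.
apply: (@mhom_wcvg _ _ g (fun n w => ker_approx g (gram g gU (X w)) n)) => [n|w]; last first.
  by rewrite -(lker_gram g gU); exact: wcvg_ker_approx (psd_gram _ _ _).
apply: mhom_pow; apply: mhomB; first exact: mhom_cst.
apply: mhom_nrm; first by move=> w; exact: psd_gram.
exact: mhom_gram.
Qed.

Lemma mhom_inv N : (forall w, lker (N w) == 0%VS) -> mhom g N ->
  mhom g (fun w => (N w)^-1)%VF.
Proof.
move=> kN mN.
apply: (@mhom_wcvg _ _ g (fun n w => inv_approx g (N w) n)) => [n|w]; last first.
  exact: wcvg_inv.
have mG := mhom_gram g mN; have pG w := psd_gram g g (N w).
apply: (mhom_comp (gU := g)); last exact: mhom_adj.
apply: mhomZ; first exact: measurable_nrm_factor.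
elim: n => [|n IH] /=; first exact: mhom_cst.
apply: mhomD => //; apply: mhom_pow; apply: mhomB; first exact: mhom_cst.
exact: mhom_nrm.
Qed.

End Endo.

Section PolarMeasurable.
Variables (E V : vectType R) (gE : {dot E for idfun}) (g : {dot V for idfun}).
Variable X : T -> 'Hom(E, V).
Hypothesis mX : mhom g X.

Lemma mhom_polar_pos : mhom gE (fun w => polar_pos gE g (X w)).
Proof.
apply: mhom_sqrt_op; first by move=> w; exact: psd_gram.
exact: mhom_gram.
Qed.

Lemma mhom_polar_iso : mhom g (fun w => polar_iso gE g (X w)).
Proof.
apply: (mhom_comp (gU := gE)) => //; apply: mhom_inv => [w|].
  exact: lker_polar_reg.
by apply: mhomD; [exact: mhom_polar_pos|exact: mhom_ortho_proj_lker mX].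
Qed.

Lemma mhom_ortho_proj_limg : mhom g (fun w => ortho_proj g (limg (X w))).
Proof.
rewrite (_ : (fun w => _) = (fun w => \1%VF - ortho_proj g (lker (adj gE g (X w))))).
  apply: mhomB; first exact: mhom_cst.
  exact: mhom_ortho_proj_lker (mhom_adj gE mX).
by apply/funext => w; apply/lfunP => v; rewrite (ortho_proj_limg gE) add_lfunE opp_lfunE id_lfunE.
Qed.

End PolarMeasurable.

Lemma measurable_vspaceP (V : vectType R) (g : {dot V for idfun})
    (X : T -> borel_vspace g) :
  measurable_fun setT X <-> mhom g (fun w => ortho_proj g (X w)).
Proof.
split=> [mX|mX].
  apply/(measurable_homP g).
  apply: (@measurableT_comp _ _ _ _ _ _ (ortho_proj g : borel_vspace g -> borel_hom V V)) => //.
  by move=> _ Y mY; apply: sub_sigma_algebra; exists Y.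
apply: (@measurability _ _ T (borel_vspace g) setT X (vspace_generators g)) => //.
move=> _ [_ [Y mY <-] <-]; rewrite !setTI -comp_preimage.
by have /(measurable_homP g) := mX; move=> /(_ measurableT _ mY); rewrite setTI.
Qed.

End MeasurableHom.

(** Apply the hypothesis to the identity, its source carrying the sigma-algebra of the
    coordinates. *)
Lemma generated_by_measurable d (T : measurableType d) (R : realType) (I : finType)
    (e : I -> T -> R) : (forall i, measurable_fun setT (e i)) ->
  (forall d' (T' : measurableType d') (f : T' -> T),
    (forall i, measurable_fun setT (e i \o f)) -> measurable_fun setT f) ->
  generated_by e.
Proof.
move=> me h; set G := [set A | exists i (Y : set R), measurable Y /\ A = e i @^-1` Y].
apply/seteqP; split=> A; last first.
  move: A; apply: smallest_sub; first exact: sigma_algebra_measurable.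
  by move=> _ [i [Y [mY ->]]]; rewrite -[_ @^-1` _]setTI; exact: me.
pose T' := g_sigma_algebraType G.
have := h _ T' (fun x => x); move=> h' mA.
have /(_ measurableT A mA) : measurable_fun setT (fun x : T' => x : T).
  apply: h' => i _ Y mY; rewrite setTI.
  by apply: sub_sigma_algebra; exists i, Y.
by rewrite setTI.
Qed.

Section Coordinates.
Variable R : realType.

Definition hom_coord (E V : vectType R) (gE : {dot E for idfun})
    (g : {dot V for idfun}) (ij : 'I_(\dim {:E}) * 'I_(\dim {:V})) (f : borel_hom E V) : R :=
  g (f (fullv_onb gE ij.1)) (fullv_onb g ij.2).

Definition vspace_coord (V : vectType R) (g : {dot V for idfun})
    (ij : 'I_(\dim {:V}) * 'I_(\dim {:V})) (W : borel_vspace g) : R :=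
  hom_coord g g ij (ortho_proj g W).

Section Hom.
Variables (E V : vectType R) (gE : {dot E for idfun}) (g : {dot V for idfun}).

Lemma measurable_hom_coord ij : measurable_fun setT (hom_coord gE g ij).
Proof. by have /(measurable_homP g) := @measurable_id _ (borel_hom E V) setT; apply. Qed.

Lemma mhom_coord d (T : measurableType d) (X : T -> 'Hom(E, V)) :
  (forall ij, measurable_fun setT (hom_coord gE g ij \o X)) -> mhom g X.
Proof.
move=> mX u v.
have [_ _ bE] := fullv_onbP gE; have [_ _ cE] := fullv_onbP g.
rewrite (_ : (fun w => _) = (fun w => \sum_i \sum_j gE u (fullv_onb gE i) * (g v (fullv_onb g j) *
   hom_coord gE g (i, j) (X w)))).
  apply: measurable_sum => i; apply: measurable_sum => j.
  by do 2 (apply: measurable_funM => //); exact: mX.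
apply/funext => w; rewrite {1}(bE u (memvf _)) linear_sum dot_suml.
apply: eq_bigr => i _; rewrite linearZ/= dotZl -mulr_sumr; congr (_ * _).
rewrite {1}(cE v (memvf _)) dot_sumr.
by apply: eq_bigr => j _; rewrite dotZr.
Qed.

Lemma generated_by_hom_coord : generated_by (hom_coord gE g).
Proof.
apply: generated_by_measurable => [|d' T' f mf]; first exact: measurable_hom_coord.
by apply/(measurable_homP g); exact: mhom_coord.
Qed.

(** The coordinate distance is the Hilbert-Schmidt distance. *)
Lemma hom_coord_sqr (f h : 'Hom(E, V)) :
  \sum_ij (hom_coord gE g ij f - hom_coord gE g ij h) ^+ 2 =
  \sum_i g ((f - h) (fullv_onb gE i)) ((f - h) (fullv_onb gE i)).
Proof.
rewrite -(pair_bigA _ (fun i j => (hom_coord gE g (i, j) f - hom_coord gE g (i, j) h) ^+ 2))/=.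
apply: eq_bigr => i _; rewrite (onb_dot_sqr _ (fullv_onbP g)).
by apply: eq_bigr => j _; rewrite /hom_coord/= -dotBl add_lfunE opp_lfunE.
Qed.

End Hom.

Section Vspace.
Variables (V : vectType R) (g : {dot V for idfun}).

Lemma measurable_vspace_coord ij : measurable_fun setT (@vspace_coord V g ij).
Proof.
have /measurable_vspaceP := @measurable_id _ (borel_vspace g) setT.
by apply.
Qed.

Lemma generated_by_vspace_coord : generated_by (@vspace_coord V g).
Proof.
apply: generated_by_measurable => [|d' T' f mf]; first exact: measurable_vspace_coord.
by apply/measurable_vspaceP; exact: (mhom_coord (gE := g)).
Qed.

End Vspace.

Section Isometric.
Variables (E V : vectType R) (gE : {dot E for idfun}) (g : {dot V for idfun}).

Lemma hom_coord_compl (Q : 'End(V)) (f h : 'Hom(E, V)) : orthogonal_ops g Q ->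
  \sum_ij (hom_coord gE g ij (Q \o f)%VF - hom_coord gE g ij (Q \o h)%VF) ^+ 2 =
  \sum_ij (hom_coord gE g ij f - hom_coord gE g ij h) ^+ 2.
Proof.
move=> /isometryP oQ; rewrite !hom_coord_sqr; apply: eq_bigr => i _.
by rewrite -comp_lfunNr -comp_lfunDr comp_lfunE oQ.
Qed.

(** The squared Hilbert-Schmidt norm is the trace of the Gram operator, which is invariant under
    conjugation. *)
Lemma hom_coord_compr (O : 'End(E)) (f h : 'Hom(E, V)) : orthogonal_ops gE O ->
  \sum_ij (hom_coord gE g ij (f \o O)%VF - hom_coord gE g ij (h \o O)%VF) ^+ 2 =
  \sum_ij (hom_coord gE g ij f - hom_coord gE g ij h) ^+ 2.
Proof.
move=> oO; rewrite !hom_coord_sqr -comp_lfunNl -comp_lfunDl.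
have := dot_trace_conj oO (gram gE g (f - h)); rewrite /dot_trace.
under eq_bigr do rewrite comp_lfunE adjl comp_lfunE dot_gram.
under [RHS]eq_bigr do rewrite dot_gram.
by move=> <-; apply: eq_bigr => i _; rewrite comp_lfunE.
Qed.

End Isometric.

Lemma vspace_coord_img (V : vectType R) (g : {dot V for idfun}) (Q : 'End(V))
    (W W' : {vspace V}) : orthogonal_ops g Q ->
  \sum_ij (vspace_coord ij ((Q @: W)%VS : borel_vspace g) -
           vspace_coord ij ((Q @: W')%VS : borel_vspace g)) ^+ 2 =
  \sum_ij (vspace_coord ij (W : borel_vspace g) - vspace_coord ij (W' : borel_vspace g)) ^+ 2.
Proof.
move=> oQ; rewrite /vspace_coord !ortho_proj_img// (hom_coord_compl _ _ _ oQ).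
exact: (hom_coord_compr _ _ _ (orthogonal_adj oQ)).
Qed.

End Coordinates.

(** * Gaussian random operators *)

Definition rv_of d d' (T : measurableType d) (T' : measurableType d')
    (R : realType) (P : probability T R) (X : T -> T')
    (mX : measurable_fun setT X) : {RV P >-> T'} :=
  HB.pack X (isMeasurableFun.Build _ _ _ _ X mX).

Definition law_of d d' (T : measurableType d) (T' : measurableType d')
    (R : realType) (P : probability T R) (X : T -> T')
    (mX : measurable_fun setT X) : probability T' R := distribution P (rv_of P mX).

Lemma integrable_mul_square d (Omega : measurableType d) (R : realType)
    (P : probability Omega R) (X Y : Omega -> R) :
  measurable_fun setT X -> measurable_fun setT Y ->
  (\int[P]_w (X w * X w)%:E < +oo)%E -> (\int[P]_w (Y w * Y w)%:E < +oo)%E ->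
  P.-integrable setT (fun w => (X w * Y w)%:E).
Proof.
have sq (Z : Omega -> R) : measurable_fun setT Z ->
    (\int[P]_w (Z w * Z w)%:E < +oo)%E -> P.-integrable setT (fun w => (Z w * Z w)%:E).
  move=> mZ Z2; apply/integrableP; split.
    by apply/measurable_EFinP; exact: measurable_funM.
  by under eq_integral do rewrite abse_EFin ger0_norm -?expr2 ?sqr_ge0// expr2.
move=> mX mY X2 Y2.
apply: le_integrable (integrableD measurableT (sq X mX X2) (sq Y mY Y2)) => //.
  by apply/measurable_EFinP; exact: measurable_funM.
move=> w _; rewrite -EFinD !abse_EFin lee_fin.
rewrite [leRHS]ger0_norm; last by rewrite addr_ge0// -expr2 sqr_ge0.
rewrite normrM -!expr2 -(real_normK (num_real (X w))) -(real_normK (num_real (Y w))).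
have := sqr_ge0 (`|X w| - `|Y w|).
have := normr_ge0 (X w); have := normr_ge0 (Y w); nra.
Qed.

Lemma integral_sum_square d (Omega : measurableType d) (R : realType)
    (P : probability Omega R) (I : finType) (X : I -> Omega -> R) (a : I -> R)
    (c : I -> I -> R) :
  (forall i, measurable_fun setT (X i)) ->
  (forall i, \int[P]_w (X i w)%:E = 0)%E ->
  (forall i j, \int[P]_w (X i w * X j w)%:E = (c i j)%:E)%E ->
  (\int[P]_w (\sum_i a i * X i w)%:E = 0)%E /\
  (\int[P]_w ((\sum_i a i * X i w) ^+ 2)%:E =
    (\sum_i \sum_j a i * a j * c i j)%:E)%E.
Proof.
move=> mX EX EXX.
have mXX i j : measurable_fun setT (fun w => X i w * X j w) by exact: measurable_funM.
have iXX i j : P.-integrable setT (fun w => (X i w * X j w)%:E).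
  by apply: integrable_mul_square => //; rewrite EXX ltry.
have i1 : P.-integrable setT (fun=> 1%E : \bar R).
  by apply: finite_measure_integrable_cst.
have iX i : P.-integrable setT (fun w => (X i w)%:E).
  apply: le_integrable (integrableD measurableT i1 (iXX i i)) => //; first exact/measurable_EFinP.
  move=> w _; rewrite -EFinD !abse_EFin lee_fin.
  rewrite [leRHS]ger0_norm; last by rewrite addr_ge0// -expr2 sqr_ge0.
  have := sqr_ge0 (`|X i w| - 1); rewrite -expr2 -(real_normK (num_real (X i w))).
  have := normr_ge0 (X i w); nra.
split.
  under eq_integral do rewrite -sumEFin.
  rewrite integral_sum//= => [|i].
    rewrite big1// => i _; under eq_integral do rewrite EFinM.
    by rewrite integralZl//= EX mule0.
  under eq_fun do rewrite EFinM.
  exact: integrableZl.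
have SE w : ((\sum_i a i * X i w) ^+ 2)%:E =
    (\sum_i \sum_j (a i * a j)%:E * (X i w * X j w)%:E)%E.
  rewrite expr2 mulr_suml -sumEFin; apply: eq_bigr => i _.
  rewrite mulr_sumr -sumEFin; apply: eq_bigr => j _.
  by rewrite -EFinM; congr EFin; ring.
under eq_integral do rewrite SE.
rewrite integral_sum//= => [|i]; last first.
  by apply: integrable_sum => // j _; exact: integrableZl.
rewrite -sumEFin; apply: eq_bigr => i _.
rewrite integral_sum//= => [|j]; last exact: integrableZl.
rewrite -sumEFin; apply: eq_bigr => j _.
by rewrite integralZl//= EXX.
Qed.

Section GaussianHom.
Variables (R : realType) (E V : vectType R).
Variables (gE : {dot E for idfun}) (g : {dot V for idfun}).

(** The form in which the Gaussian condition is used: pairs (b, y), seen as elementary tensors, give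
    a standard family when orthonormal, and each unit tensor has a small-ball bound. *)
Definition gaussian_hom d (Omega : measurableType d) (P : probability Omega R)
    (X : Omega -> 'Hom(E, V)) : Prop :=
  [/\ mhom g X,
    forall (I : finType) (b : I -> E) (y : I -> V),
      (forall i j, gE (b i) (b j) * g (y i) (y j) = (i == j)%:R) ->
      standard_gaussian P (fun i w => g (X w (b i)) (y i)) &
    forall b y eps, gE b b * g y y = 1 -> 0 < eps ->
      (P [set w | (- eps < g (X w b) y < eps)%R] <=
       (normal_peak (Num.sqrt (normal_var R)^-1) * (eps *+ 2))%:E)%E].

Section Law.
Context d (Omega : measurableType d) (P : probability Omega R).
Implicit Types (X : Omega -> 'Hom(E, V)).

Lemma gaussian_hom_intro X :
  let Y (p : E * V) w := g (X w p.1) p.2 in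
  jointly_gaussian P Y -> (forall p, ('E_P[Y p] = 0)%E) ->
  (forall u v y z, ('E_P[(fun w => Y (u, y) w * Y (v, z) w)%R] =
    (gE u v * g y z)%R%:E)%E) -> gaussian_hom P X.
Proof.
move=> Y jY EY EYY.
have gY u y : gaussian P (Y (u, y)).
  have := jY 1%N (fun=> (u, y)) (fun=> 1).
  by congr gaussian; apply/funext => w; rewrite big_ord1 mul1r.
have mX : mhom g X.
  by move=> u v; have [] := gY u v.
split=> // [I b y bb|b y eps by1]; last first.
  apply: (gaussian_small_ball (gY b y)) => //.
    by have := EY (b, y); rewrite unlock.
  by have := EYY b b y y; rewrite unlock by1.
split=> [i|a t]; first exact: mX.
have [] := @integral_sum_square _ _ _ P I (fun i w => g (X w (b i)) (y i)) a
  (fun i j => (i == j)%:R).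
- by move=> i; exact: mX.
- by move=> i; have := EY (b i, y i); rewrite unlock.
- by move=> i j; have := EYY (b i) (b j) (y i) (y j); rewrite unlock bb.
move=> Z1 Z2; rewrite (gaussian_cos _ Z1 Z2).
  congr (gaussian_char _ * _)%:E; apply: eq_bigr => i _.
  rewrite (bigD1 i)//= eqxx mulr1 big1 ?addr0 ?expr2// => j ji.
  by rewrite eq_sym (negbTE ji) mulr0.
(* Joint Gaussianity is stated over ordinals, so the finite index type is enumerated. *)
have := jY #|I| (fun k => (b (enum_val k), y (enum_val k))) (fun k => a (enum_val k)).
congr gaussian; apply/funext => w.
pose F i := a i * g (X w (b i)) (y i).
by rewrite -[LHS](big_enum_val F); exact: eq_bigl.
Qed.

Lemma gaussian_hom_coord X : gaussian_hom P X ->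
  standard_gaussian P (fun ij => hom_coord gE g ij \o X).
Proof.
have [_ eE _] := fullv_onbP gE; have [_ eV _] := fullv_onbP g.
move=> [_ gX _].
apply: (gX _ (fun ij => fullv_onb gE ij.1) (fun ij => fullv_onb g ij.2)) => -[i j] [i' j'].
by rewrite eE eV/= xpair_eqE; case: (i == i'); case: (j == j'); rewrite ?mulr1 ?mulr0.
Qed.

Lemma gaussian_hom_law d' (Omega' : measurableType d') (P' : probability Omega' R)
    X (X' : Omega' -> 'Hom(E, V)) : gaussian_hom P X -> mhom g X' ->
  (forall a t, \int[P']_w (cos (\sum_ij a ij * hom_coord gE g ij (X' w) + t))%:E =
    (gaussian_char (\sum_ij a ij ^+ 2) * cos t)%:E)%E ->
  forall A : set (borel_hom E V), measurable A -> P' (X' @^-1` A) = P (X @^-1` A).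
Proof.
move=> gX mX' cX' A mA; have [mX _ _] := gX.
have mX1 : measurable_fun setT (X : Omega -> borel_hom E V) by apply/(measurable_homP g).
have mX2 : measurable_fun setT (X' : Omega' -> borel_hom E V) by apply/(measurable_homP g).
apply: (@eq_measure_open_box _ _ _ _ (hom_coord gE g) (measurable_hom_coord gE g)
  (generated_by_hom_coord gE g) (law_of P' mX2) (law_of P mX1)) => // [|a b].
  exact: (le_lt_trans (probability_le1 (law_of P' mX2) measurableT) (ltry _)).
rewrite /law_of /distribution /=.
have sX := gaussian_hom_coord gX.
have := @standard_gaussian_box _ _ _ _ _ _ P' _ _
  (fun ij => hom_coord gE g ij \o X') sX _ _ a b.
move=> h; symmetry; apply: h => // ij.
exact: measurableT_comp (measurable_hom_coord gE g ij) mX2.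
Qed.

Lemma gaussian_hom_law_eq X X' : gaussian_hom P X -> gaussian_hom P X' ->
  forall A : set (borel_hom E V), measurable A -> P (X' @^-1` A) = P (X @^-1` A).
Proof.
move=> gX gX'; have [mX' _ _] := gX'; apply: gaussian_hom_law => //.
by have [] := gaussian_hom_coord gX'.
Qed.

(** The operator passes to the test vectors as its adjoint, which keeps the tested tensors
    orthonormal. *)
Lemma gaussian_hom_compl X (Q : 'End(V)) : orthogonal_ops g Q ->
  gaussian_hom P X -> gaussian_hom P (fun w => (Q \o X w)%VF).
Proof.
move=> oQ [mX gX bX]; have /isometryP oQ' := orthogonal_adj oQ.
have QE u y : (fun w => g ((Q \o X w)%VF u) y) = (fun w => g (X w u) (adj g g Q y)).
  by apply/funext => w; rewrite comp_lfunE adjr.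
split=> [|I b y bb|b y eps].
- by apply: (mhom_comp (gU := g)) => //; exact: mhom_cst.
- rewrite (_ : (fun i w => _) = (fun i w => g (X w (b i)) (adj g g Q (y i)))); last first.
    by apply/funext => i; exact: QE.
  by apply: gX => i j; rewrite oQ' bb.
- rewrite -oQ' => h /(bX _ _ _ h); congr (P _ <= _)%E.
  by apply/seteqP; split=> w /=; rewrite comp_lfunE adjr.
Qed.

Lemma gaussian_hom_compr X (O : 'End(E)) : orthogonal_ops gE O ->
  gaussian_hom P X -> gaussian_hom P (fun w => (X w \o O)%VF).
Proof.
move=> /isometryP oO [mX gX bX]; split=> [|I b y bb|b y eps].
- by apply: (mhom_comp (gU := gE)) => //; exact: mhom_cst.
- rewrite (_ : (fun i w => _) = (fun i w => g (X w (O (b i))) (y i))); last first.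
    by apply/funext => i; apply/funext => w; rewrite comp_lfunE.
  by apply: gX => i j; rewrite oO bb.
- rewrite -oO => h /(bX _ _ _ h); congr (P _ <= _)%E.
  by apply/seteqP; split=> w /=; rewrite comp_lfunE.
Qed.

End Law.

End GaussianHom.

(** * Distance of a column to the span of the others *)

Section Residual.
Variables (R : realType) (E V : vectType R).
Variables (gE : {dot E for idfun}) (g : {dot V for idfun}).
Implicit Types (f h : 'Hom(E, V)) (W : {vspace V}).

Let b := fullv_onb gE.

Definition coord_proj (j : 'I_(\dim {:E})) : 'End(E) := ortho_proj gE <[b j]>.

Lemma coord_projE j u : coord_proj j u = gE u (b j) *: b j.
Proof.
have [_ bb _] := fullv_onbP gE; apply: ortho_proj_unique.
  by rewrite memvZ// memv_line.
move=> _ /vlineP[c ->]; rewrite dotBl dotZl !dotZr bb eqxx mulr1.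
by rewrite mulrC subrr.
Qed.

(** It kills the [j]-th basis vector and keeps the others, so [h] composed with it has the span of
    the other columns as range. *)
Definition coord_compl j : 'End(E) := \1%VF - coord_proj j.

Lemma coord_complE j u : coord_compl j u = u - gE u (b j) *: b j.
Proof. by rewrite add_lfunE opp_lfunE id_lfunE coord_projE. Qed.

Lemma coord_compl_onb j i : coord_compl j (b i) = if i == j then 0 else b i.
Proof.
have [_ bb _] := fullv_onbP gE; rewrite coord_complE bb.
by case: eqVneq => [->|_]; rewrite ?scale1r ?subrr// scale0r subr0.
Qed.

Lemma coord_compl_idem j : (coord_compl j \o coord_compl j = coord_compl j)%VF.
Proof.
apply/lfunP => u; rewrite comp_lfunE [coord_compl j u in LHS]coord_complE linearB linearZ/=.
by rewrite coord_compl_onb eqxx scaler0 subr0 coord_complE.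
Qed.

Definition resid_vec j h : V :=
  h (b j) - ortho_proj g (limg (h \o coord_compl j)%VF) (h (b j)).

(** The square of the distance delta_j. *)
Definition resid j h : R := g (resid_vec j h) (resid_vec j h).

Lemma dot_resid_vec j h y : (forall u, g (h (coord_compl j u)) y = 0) ->
  g (resid_vec j h) y = g (h (b j)) y.
Proof.
move=> hy; rewrite dotBl; set p := ortho_proj _ _ _.
have /memv_imgP[u _ ->] : p \in limg (h \o coord_compl j)%VF by exact: ortho_proj_in.
by rewrite comp_lfunE hy subr0.
Qed.

Lemma resid_ge j h y : (forall u, g (h (coord_compl j u)) y = 0) -> g y y = 1 ->
  g (h (b j)) y ^+ 2 <= resid j h.
Proof.
move=> hy y1; rewrite -dot_resid_vec//; apply: le_trans (dot_CS _ _ _) _.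
by rewrite y1 mulr1.
Qed.

(** Pythagoras: [h u] is the [j]-th coordinate of [u] times the residual vector, plus a vector of
    the span of the other columns. *)
Lemma resid_le_dot j h u : gE u (b j) ^+ 2 * resid j h <= g (h u) (h u).
Proof.
set c := gE u (b j); set r := resid_vec j h.
set p := ortho_proj g (limg (h \o coord_compl j)%VF) (h (b j)).
have hb : h (b j) = r + p by rewrite /r /resid_vec subrK.
have [q qL huE] : exists2 q, q \in limg (h \o coord_compl j)%VF & h u = c *: r + q.
  exists (h (coord_compl j u) + c *: p).
    apply: memvD; first by rewrite -comp_lfunE memv_img ?memvf.
    by rewrite memvZ// ortho_proj_in.
  have -> : h (coord_compl j u) = h u - c *: h (b j).
    by rewrite coord_complE linearB linearZ.
  have aux (x y z : V) : x = y + (x - (y + z) + z).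
    by rewrite opprD (addrA x) subrK addrCA subrr addr0.
  by rewrite hb [c *: (r + p)]scalerDr; exact: aux.
have rq : g r q = 0 by case: (ortho_projP g (limg (h \o coord_compl j)%VF) (h (b j))) => _; apply.
rewrite huE !dotDl !dotDr !dotZl !dotZr rq (dotC g q r) rq !mulr0 addr0 add0r.
by rewrite mulrA -expr2 lerDl dot_ge0.
Qed.

Lemma resid_lker h : (forall j, resid j h != 0) -> lker h = 0%VS.
Proof.
move=> r0; apply/eqP; rewrite -subv0; apply/subvP => u; rewrite memv_ker memv0 => /eqP hu.
have [_ _ bE] := fullv_onbP gE; rewrite (bE u (memvf _)) big1// => j _.
have := resid_le_dot j h u; rewrite hu dot0l => le0.
have rp : 0 < resid j h by rewrite lt_neqAle eq_sym r0 dot_ge0.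
suff /eqP -> : gE u (fullv_onb gE j) == 0 by rewrite scale0r.
by rewrite -sqrf_eq0 eq_le sqr_ge0 -(ler_pM2r rp) mul0r le0.
Qed.

Lemma dot_le_resid h u : (forall j, resid j h != 0) ->
  gE u u <= g (h u) (h u) * \sum_j (resid j h)^-1.
Proof.
move=> r0; rewrite (onb_dot_sqr _ (fullv_onbP gE)) mulr_sumr; apply: ler_sum => j _.
have rp : 0 < resid j h by rewrite lt_neqAle eq_sym r0 dot_ge0.
by rewrite ler_pdivlMr//; exact: resid_le_dot.
Qed.

(** The positive factor A satisfies |A v| = |h v|, so the bound of |v| by |h v| in [dot_le_resid] is
    a bound on the inverse of A. *)
Lemma op_norm_polar_pos h : (forall j, resid j h != 0) ->
  op_norm gE (polar_pos gE g h)^-1%VF ^+ 2 <= \sum_j (resid j h)^-1.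
Proof.
move=> r0; have h0 := resid_lker r0; set s := \sum_j _.
have s0 : 0 <= s by apply: sumr_ge0 => j _; rewrite invr_ge0 dot_ge0.
rewrite /op_norm; set N := ((polar_pos gE g h)^-1)%VF; set S := (X in sup X).
have ub : ubound S (Num.sqrt s).
  move=> _ [u /= u1 <-]; rewrite /dnorm ler_sqrt//.
  apply: le_trans (dot_le_resid (N u) r0) _; rewrite -/s -[leRHS]mul1r.
  apply: ler_wpM2r => //.
  rewrite -(dot_polar_pos gE) /N lker0_lfunVK ?lker_polar_pos_full//.
  rewrite -(sqr_sqrtr (dot_ge0 gE u)) -[leRHS](expr1n _ 2).
  by rewrite lerXn2r ?nnegrE ?sqrtr_ge0.
have S0 : S 0.
  exists 0; last by rewrite /dnorm linear0 dot0l sqrtr0.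
  by rewrite /= /dnorm dot0l sqrtr0.
rewrite -(sqr_sqrtr s0) lerXn2r ?nnegrE ?sqrtr_ge0//.
  by apply: ub_le_sup S0; exists (Num.sqrt s).
by apply: ge_sup ub; exists 0.
Qed.

(** The other columns span at most dim E - 1 dimensions, because the composed map kills a basis
    vector; the rest of [W] has room for [n] orthonormal vectors. *)
Lemma limg_coord_compl_onb h j n W : (limg h <= W)%VS ->
  (n + \dim {:E} <= (\dim W).+1)%N ->
  exists y : 'I_n -> V, [/\ forall i, y i \in W,
    forall i k, g (y i) (y k) = (i == k)%:R &
    forall i u, g (h (coord_compl j u)) (y i) = 0].
Proof.
move=> hW nW; set L := limg (h \o coord_compl j)%VF.
have dL : (\dim L < \dim {:E})%N.
  have := limg_ker_dim (h \o coord_compl j)%VF fullv; rewrite -/L.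
  suff k0 : (0 < \dim (fullv :&: lker (h \o coord_compl j)))%N by move: k0; lia.
  rewrite lt0n dimv_eq0; apply/negP => /eqP k0.
  have : b j \in (fullv :&: lker (h \o coord_compl j))%VS.
    by rewrite memv_cap memvf memv_ker comp_lfunE coord_compl_onb eqxx linear0 eqxx.
  have [_ bb _] := fullv_onbP gE.
  rewrite k0 memv0 => /eqP bj0; have := bb j j.
  by rewrite -/b bj0 dot0l eqxx => /eqP; rewrite eq_sym oner_eq0.
have LW : (L <= W)%VS by apply: subv_trans hW; rewrite /L limg_comp limgS// subvf.
have [c [cW cc _]] := exists_onb g (erefl (\dim (W :&: orthov g L))).
have dC : (n <= \dim (W :&: orthov g L))%N.
  have : (W <= L + W :&: orthov g L)%VS.
    apply/subvP => v vW; rewrite -(subrK (ortho_proj g L v) v) addrC.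
    have pL := ortho_proj_in g L v; apply: memv_add => //.
    rewrite memv_cap memvB//=; last exact: (subvP LW).
    by apply/mem_orthovP => w wL; case: (ortho_projP g L v) => _; apply.
  move/dimvS/leq_trans/(_ (dimv_add_leqif _ _).1); move: nW dL; lia.
exists (fun i => c (widen_ord dC i)); split=> [i|i k|i u].
- by have := cW (widen_ord dC i); rewrite memv_cap => /andP[].
- by rewrite cc -val_eqE.
- have := cW (widen_ord dC i); rewrite memv_cap => /andP[_ /mem_orthovP h'].
  by rewrite dotC; apply: h'; rewrite /L -comp_lfunE memv_img ?memvf.
Qed.

End Residual.

Section ResidualLaw.
Variables (R : realType) (E V : vectType R).
Variables (gE : {dot E for idfun}) (g : {dot V for idfun}).

Lemma measurable_resid d (T : measurableType d) (Y : T -> 'Hom(E, V)) j :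
  mhom g Y -> measurable_fun setT (fun w => resid gE g j (Y w)).
Proof.
move=> mY; have ob := fullv_onbP g.
rewrite (_ : (fun w => _) = (fun w => \sum_i (g (resid_vec gE g j (Y w)) (fullv_onb g i)) ^+ 2)).
  apply: measurable_sum => i; apply: measurable_funX.
  under eq_fun do rewrite /resid_vec dotBl.
  apply: measurable_funB; first exact: mY.
  have mY' : mhom g (fun w => (Y w \o coord_compl gE j)%VF).
    by apply: (mhom_comp (gU := gE)) => //; exact: mhom_cst.
  have := mhom_comp (mhom_ortho_proj_limg gE mY') mY.
  move=> /(_ (fullv_onb gE j) (fullv_onb g i)).
  by under eq_fun do rewrite comp_lfunE.
by apply/funext => w; exact: onb_dot_sqr.
Qed.

Context d (Omega : measurableType d) (P : probability Omega R).
Variable X : Omega -> 'Hom(E, V).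
Hypothesis gX : gaussian_hom gE g P X.

Let mX : mhom g X. Proof. by case: gX. Qed.

(** Column [j] comes from the second copy and the others from the first, which makes it independent
    of their span. *)
Let mix j (w : Omega * Omega) : 'Hom(E, V) :=
  ((X w.1 \o coord_compl gE j) + (X w.2 \o coord_proj gE j))%VF.

Let mix_compl j w : (mix j w \o coord_compl gE j = X w.1 \o coord_compl gE j)%VF.
Proof.
apply/lfunP => u; rewrite /mix comp_lfunE add_lfunE !comp_lfunE.
rewrite -[coord_compl gE j (coord_compl gE j u)]comp_lfunE coord_compl_idem.
rewrite [coord_proj _ _ _]coord_projE [gE (coord_compl _ _ _) _](_ : _ = 0).
  by rewrite scale0r linear0 addr0.
have [_ bb _] := fullv_onbP gE.
by rewrite coord_complE dotBl dotZl bb eqxx mulr1 subrr.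
Qed.

Let mix_onb j w : mix j w (fullv_onb gE j) = X w.2 (fullv_onb gE j).
Proof.
have [_ bb _] := fullv_onbP gE.
rewrite /mix add_lfunE !comp_lfunE coord_compl_onb eqxx linear0 add0r.
by rewrite coord_projE bb eqxx scale1r.
Qed.

Let mmix j : mhom g (mix j).
Proof.
have m1 : mhom g (fun w : Omega * Omega => X w.1).
  by move=> u v; exact: (measurableT_comp (mX u v) measurable_fst).
have m2 : mhom g (fun w : Omega * Omega => X w.2).
  by move=> u v; exact: (measurableT_comp (mX u v) measurable_snd).
by apply: mhomD; apply: (mhom_comp (gU := gE)) => //; exact: mhom_cst.
Qed.

Let mix_law j (A : set (borel_hom E V)) : measurable A ->
  (P \x P)%E (mix j @^-1` A) = P (X @^-1` A).
Proof.
move=> mA; apply: (gaussian_hom_law gX (mmix j)) => // a t.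
rewrite -(resample_cos [pred ij | ij.1 == j] (gaussian_hom_coord gX)).
apply: eq_integral => w _; congr (cos (_ + _))%:E; apply: eq_bigr => -[i k] _.
congr (_ * _); rewrite /resample/= /hom_coord/=; case: eqVneq => [->|ij].
  by rewrite mix_onb.
rewrite -{1}[fullv_onb gE i](_ : coord_compl gE j (fullv_onb gE i) = _).
  by rewrite -comp_lfunE mix_compl comp_lfunE coord_compl_onb (negbTE ij).
by rewrite coord_compl_onb (negbTE ij).
Qed.

(* Conditionally on the other columns, the residual of column [j] dominates [n]
   independent standard Gaussian coordinates. *)
Lemma resid_small_ball W j n eps : (n + \dim {:E} <= (\dim W).+1)%N -> 0 < eps ->
  (P [set w | (resid gE g j (ortho_proj g W \o X w)%VF < eps ^+ 2)%R] <=
   ((normal_peak (Num.sqrt (normal_var R)^-1) * (eps *+ 2)) ^+ n)%:E)%E.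
Proof.
move=> nW e0; set p := normal_peak _ * _.
pose A : set (borel_hom E V) := [set f | resid gE g j (ortho_proj g W \o f)%VF < eps ^+ 2].
have mA : measurable A.
  have : measurable_fun setT (fun f : borel_hom E V => resid gE g j (ortho_proj g W \o f)%VF).
    apply: measurable_resid; apply: (mhom_comp (gU := g)); first exact: mhom_cst.
    by apply/measurable_homP; exact: measurable_id.
  move=> /(_ measurableT `]-oo, eps ^+ 2[%classic); rewrite setTI.
  rewrite (_ : _ @^-1` _ = A); first by apply; exact: measurable_itv.
  by apply/seteqP; split=> f /=; rewrite in_itv.
rewrite -[X in (P X <= _)%E]/(X @^-1` A) -(mix_law j mA).
have mmA : measurable (mix j @^-1` A).
  have /(measurable_homP g) := mmix j => /(_ measurableT A mA).
  by rewrite setTI.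
rewrite /product_measure1/= -(integral_prob_cst P (p ^+ n)).
apply: ge0_le_integral => // [|w _]; first exact: measurable_fun_xsection.
have hW : (limg (ortho_proj g W \o X w) <= W)%VS.
  by rewrite -{2}(limg_ortho_proj g W) limg_comp limgS// subvf.
(* These vectors depend on the first copy only, so the entries of the second copy along them are
   standard Gaussian. *)
have [y [yW yy yL]] := limg_coord_compl_onb gE g j hW nW.
have [_ bb _] := fullv_onbP gE; have [_ sX bX] := gX.
pose Y i w' := g (X w' (fullv_onb gE j)) (y i).
have sY : standard_gaussian P Y.
  by apply: sX => i k; rewrite bb eqxx mul1r yy.
have p0 : 0 <= p.
  rewrite mulr_ge0 ?mulrn_wge0 ?(ltW e0)//.
  by rewrite /normal_peak invr_ge0 sqrtr_ge0.
apply: le_trans (standard_gaussian_small_ball sY p0 _) => [|i]; last first.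
  by apply: bX => //; rewrite bb eqxx mul1r yy eqxx.
apply: le_measure; rewrite ?inE.
- exact: measurable_xsection.
- by apply: measurable_open_box; case: sY.
move=> w'; rewrite /xsection/= inE /A/= => rw i.
have mE u : (ortho_proj g W \o mix j (w, w'))%VF (coord_compl gE j u) =
    (ortho_proj g W \o X w)%VF (coord_compl gE j u).
  by rewrite comp_lfunE -[mix _ _ _]comp_lfunE mix_compl !comp_lfunE.
have := @resid_ge _ _ _ gE g j (ortho_proj g W \o mix j (w, w'))%VF (y i).
rewrite [_ (fullv_onb gE j)]comp_lfunE mix_onb ortho_proj_sym ortho_proj_id//.
move=> /(_ _ _)/le_lt_trans/(_ rw) => h.
rewrite -ltr_norml -(ltr_pXn2r (n := 2))// ?nnegrE ?(ltW e0)// real_normK ?num_real//.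
apply: h => [u|]; last by rewrite yy eqxx.
by rewrite mE yL.
Qed.

End ResidualLaw.

(** Integrals of nonnegative functions are suprema over simple functions below them, so monotonicity
    asks for no measurability; the operator norm, an uncountable supremum, is bounded in this
    way. *)
Lemma ge0_le_integral_sub d (T : measurableType d) (R : realType)
    (mu : {measure set T -> \bar R}) (f1 f2 : T -> \bar R) :
  (forall x, 0 <= f1 x)%E -> (forall x, f1 x <= f2 x)%E ->
  (\int[mu]_x f1 x <= \int[mu]_x f2 x)%E.
Proof.
move=> f0 f12; have f20 x : (0 <= f2 x)%E by exact: le_trans (f0 x) (f12 x).
rewrite !ge0_integralTE//; apply: le_ereal_sup => _ [h hf <-].
by exists h => // x; exact: le_trans (hf x) (f12 x).
Qed.

Lemma ae_ge0_le_integral_sub d (T : measurableType d) (R : realType)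
    (mu : {measure set T -> \bar R}) (f1 f2 : T -> \bar R) :
  (forall x, 0 <= f1 x)%E -> (forall x, 0 <= f2 x)%E ->
  measurable_fun setT f2 -> {ae mu, forall x, f1 x <= f2 x}%E ->
  (\int[mu]_x f1 x <= \int[mu]_x f2 x)%E.
Proof.
move=> f10 f20 mf [N [mN N0 subN]].
(* Raising [f2] to infinity on the exceptional null set makes the inequality hold everywhere. *)
pose f3 x := (f2 x + (\d_x N) * +oo)%E.
have d0 x : (0 <= \d_x N * +oo :> \bar R)%E by rewrite mule_ge0.
have mN' : measurable_fun setT (fun x => (\d_x N * +oo)%E : \bar R).
  rewrite (_ : (fun x => _) = (fun x => (\1_N x)%:E * +oo)%E); last first.
    by apply/funext => x; rewrite diracE indicE.
  by apply: emeasurable_funM => //; apply/measurable_EFinP; exact: measurable_indic.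
have mf3 : measurable_fun setT f3 by exact: emeasurable_funD.
have <- : (\int[mu]_x f3 x = \int[mu]_x f2 x)%E.
  apply: ge0_ae_eq_integral => // [x _|]; first by rewrite adde_ge0.
  exists N; split=> // x /= /not_implyP[_ fN]; apply: contrapT => xN; apply: fN.
  by rewrite /f3 diracE memNset// mul0e adde0.
apply: ge0_le_integral_sub => // x; have [xN|xN] := pselect (N x).
  rewrite /f3 diracE mem_set// mul1e addey ?leey// gt_eqF// (lt_le_trans _ (f20 x))//.
have := contra_not (subN x) xN => /contrapT; rewrite /f3 => /le_trans; apply.
by rewrite leeDl.
Qed.

(** * Inverse moments from a cubic tail *)

Section InverseMoment.
Context d (Omega : measurableType d) (R : realType) (P : probability Omega R).
Variables (Y : Omega -> R) (K : R).
Hypotheses (mY : measurable_fun setT Y) (Y0 : forall w, 0 <= Y w).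
Hypothesis tail : forall eps, 0 < eps ->
  (P [set w | (Y w < eps ^+ 2)%R] <= ((K * eps) ^+ 3)%:E)%E.

Let A (k : nat) : set Omega := [set w | Y w < (4^-1) ^+ k].

Let mA k : measurable (A k).
Proof.
rewrite (_ : A k = Y @^-1` `]-oo, (4^-1) ^+ k[%classic).
  by rewrite -[_ @^-1` _]setTI; apply: mY.
by apply/seteqP; split=> w /=; rewrite in_itv.
Qed.

Let PA k : (P (A k) <= (K ^+ 3 * (8^-1) ^+ k)%:E)%E.
Proof.
have := @tail ((2^-1) ^+ k); rewrite exprAC [(2^-1) ^+ 2](_ : _ = 4^-1); last first.
  by rewrite exprVn; congr (_^-1); ring.
rewrite exprMn [(_ ^+ k) ^+ 3]exprAC [(2^-1) ^+ 3](_ : _ = 8^-1); last first.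
  by rewrite exprVn; congr (_^-1); ring.
by apply; rewrite exprn_gt0.
Qed.

(* Dyadic decomposition of the values of [Y] below one. *)
Let inv_le w :
  ((Y w)^-1%:E <= 1 + \sum_(0 <= k <oo) (4 ^+ k.+1)%:E * (\1_(A k) w)%:E)%E.
Proof.
have t0 k : (0 <= (4 ^+ k.+1)%:E * (\1_(A k) w)%:E :> \bar R)%E.
  by rewrite mule_ge0 ?lee_fin// exprn_ge0.
have [Y1|Y1] := leP 1 (Y w).
  rewrite (@le_trans _ _ 1%E)//; first by rewrite lee_fin invf_le1// (lt_le_trans _ Y1).
  by rewrite leeDl// nneseries_ge0.
(* The convention that 0 has inverse 0 settles this case. *)
have [->|Yn0] := eqVneq (Y w) 0.
  by rewrite invr0 adde_ge0// nneseries_ge0.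
have Yp : 0 < Y w by rewrite lt_neqAle eq_sym Yn0 Y0.
have ex : exists n, (4^-1) ^+ n <= Y w.
  exists (Num.bound (Y w)^-1); rewrite exprVn -[leRHS]invrK lef_pV2 ?posrE ?invr_gt0 ?exprn_gt0//.
  apply: le_trans (ltW (archi_boundP _)) _; first by rewrite invr_ge0 ltW.
  set n := Num.bound _; rewrite -natrX ler_nat.
  by apply: ltnW; exact: ltn_expl.
case: (ex_minnP ex) => -[|k] Yk mink.
  by move: Yk; rewrite expr0 leNgt Y1.
have Ak : A k w by rewrite /A/= ltNge; apply/negP => /mink; rewrite ltnn.
apply: le_trans (leeDr _ _) => //; apply: le_trans (@nneseries_lim_ge _ _ xpredT 0%N k.+1 _) => //.
rewrite big_nat_recr//= -[leLHS]add0e leeD ?sume_ge0//.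
rewrite indicE mem_set// mule1 lee_fin -[leRHS]invrK -exprVn.
by rewrite lef_pV2 ?posrE ?exprn_gt0.
Qed.

(** The [k]-th term has expectation at most 4 ^ (k + 1) * K ^ 3 / 8 ^ k, a geometric sequence of
    ratio 1/2. *)
Lemma inverse_moment : (\int[P]_w ((Y w)^-1)%:E < +oo)%E.
Proof.
have K0 : 0 <= K.
  have := le_trans (measure_ge0 P _) (@tail 1 ltr01); rewrite mulr1 lee_fin.
  by rewrite exprn_odd_ge0.
have mt k : measurable_fun setT (fun w => (4 ^+ k.+1)%:E * (\1_(A k) w)%:E : \bar R)%E.
  by apply: emeasurable_funM => //; apply/measurable_EFinP; exact: measurable_indic.
have t0 k w : (0 <= (4 ^+ k.+1)%:E * (\1_(A k) w)%:E :> \bar R)%E.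
  by rewrite mule_ge0 ?lee_fin// exprn_ge0.
have inv0 w : (0 <= (Y w)^-1%:E)%E by rewrite lee_fin invr_ge0.
apply: (le_lt_trans (ge0_le_integral_sub P inv0 inv_le)).
rewrite ge0_integralD//=; last 2 first.
- by move=> w _; exact: nneseries_ge0.
- exact: ge0_emeasurable_sum.
rewrite lte_add_pinfty//; first by rewrite integral_prob_cst ltry.
rewrite integral_nneseries//.
apply: (@le_lt_trans _ _ (8 * K ^+ 3)%:E); last by rewrite ltry.
apply: lime_le; first by apply: is_cvg_nneseries => k _ _; apply: integral_ge0.
apply: nearW => n; apply: (@le_trans _ _ (\sum_(0 <= k < n) (4 * K ^+ 3 * (2^-1) ^+ k)%:E)%E).
  apply: lee_sum => k _; rewrite ge0_integralZl ?lee_fin ?exprn_ge0//; last first.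
    by apply/measurable_EFinP; exact: measurable_indic.
  rewrite integral_indic// setIT; apply: (le_trans (lee_wpmul2l _ (PA k))).
    by rewrite lee_fin exprn_ge0.
  rewrite -EFinM lee_fin [leLHS](_ : _ = 4 * K ^+ 3 * (2^-1) ^+ k)//.
  rewrite [(2^-1) ^+ k](_ : _ = 4 ^+ k * (8^-1) ^+ k); last first.
    by rewrite -exprMn; congr (_ ^+ _); field.
  by rewrite exprS; ring.
rewrite sumEFin lee_fin -mulr_sumr big_mkord.
have -> : \sum_(k < n) (2^-1) ^+ k = 2 * (1 - (2^-1) ^+ n) :> R.
  elim: n => [|n IH]; first by rewrite big_ord0 expr0 subrr mulr0.
  by rewrite big_ord_recr/= IH exprS; field.
have q0 : 0 <= (2^-1) ^+ n :> R by rewrite exprn_ge0.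
have := exprn_ge0 3 K0; nra.
Qed.

End InverseMoment.

Section FullRank.
Variables (R : realType) (E V : vectType R).
Variables (gE : {dot E for idfun}) (g : {dot V for idfun}).
Context d (Omega : measurableType d) (P : probability Omega R).
Variable X : Omega -> 'Hom(E, V).
Hypothesis gX : gaussian_hom gE g P X.

Let mX : mhom g X. Proof. by case: gX. Qed.

(** A single orthonormal direction off the other columns is enough: the residual is below eps ^ 2
    with probability O(eps). *)
Lemma ae_resid W : (\dim {:E} <= \dim W)%N ->
  {ae P, forall w, forall j, resid gE g j (ortho_proj g W \o X w)%VF != 0}.
Proof.
move=> dW.
suff h (j : 'I_(\dim {:E})) : {ae P, forall w, resid gE g j (ortho_proj g W \o X w)%VF != 0}.
  have : {ae P, forall w, forall (n : nat) (hn : (n < \dim {:E})%N),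
      resid gE g (Ordinal hn) (ortho_proj g W \o X w)%VF != 0}.
    apply: ae_foralln => n; have [hn|hn] := pselect (n < \dim {:E})%N.
      apply: filterS (h (Ordinal hn)) => w hw hn'.
      by rewrite (_ : Ordinal hn' = Ordinal hn)//; exact: val_inj.
    by apply: nearW => w hn'.
  by apply: filterS => w hw [n hn]; exact: hw.
set Y := fun w => resid gE g j (ortho_proj g W \o X w)%VF.
have mY : measurable_fun setT Y.
  by apply: measurable_resid; apply: (mhom_comp (gU := g)) => //; exact: mhom_cst.
exists (Y @^-1` [set 0]); split.
- by rewrite -[_ @^-1` _]setTI; apply: mY.
- set q := normal_peak (Num.sqrt (normal_var R)^-1) *+ 2.
  have q0 : 0 <= q by rewrite mulrn_wge0// /normal_peak invr_ge0 sqrtr_ge0.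
  apply/eqP; rewrite eq_le measure_ge0 andbT; apply/lee_addgt0Pr => e e0; rewrite add0e.
  pose eps := e / (q + 1).
  have q1 : 0 < q + 1 by rewrite ltr_wpDl.
  have eps0 : 0 < eps by rewrite divr_gt0.
  have nW : (1 + \dim {:E} <= (\dim W).+1)%N by [].
  have := resid_small_ball gX j nW eps0; rewrite expr1 mulrnAr -mulrnAl -/q => hle.
  apply: le_trans (le_trans _ hle) _.
    apply: le_measure; rewrite ?inE.
    + by rewrite -[_ @^-1` _]setTI; apply: mY.
    + rewrite (_ : [set w | _] = Y @^-1` `]-oo, eps ^+ 2[%classic).
        by rewrite -[_ @^-1` _]setTI; apply: mY.
      by apply/seteqP; split=> w /=; rewrite in_itv.
    + by move=> w; rewrite /Y/= => ->; rewrite exprn_gt0.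
  rewrite lee_fin /eps mulrCA ger_pMr// ler_pdivrMr// mul1r lerDl.
  exact: ler01.
by move=> w /= /negP; rewrite negbK => /eqP.
Qed.

Lemma ae_lker_proj W : (\dim {:E} <= \dim W)%N ->
  {ae P, forall w, lker (ortho_proj g W \o X w)%VF = 0%VS}.
Proof. by move=> dW; apply: filterS (ae_resid dW) => w; exact: resid_lker. Qed.

Lemma ortho_proj_fullv : ortho_proj g fullv = \1%VF.
Proof. by apply/lfunP => v; rewrite ortho_proj_id ?memvf// id_lfunE. Qed.

Hypothesis dEV : (\dim {:E} + 2 <= \dim {:V})%N.

Lemma ae_resid_full : {ae P, forall w, forall j, resid gE g j (X w) != 0}.
Proof.
have : (\dim {:E} <= \dim {:V})%N by lia.
move=> /ae_resid; rewrite ortho_proj_fullv.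
by apply: filterS => w; rewrite comp_lfun1l.
Qed.

Lemma op_norm_moment :
  (\int[P]_w (op_norm gE (polar_pos gE g (X w))^-1%VF ^+ 2)%:E < +oo)%E.
Proof.
have m j : measurable_fun setT (fun w => (resid gE g j (X w))^-1).
  rewrite (_ : (fun w => _) = (@powR R)^~ (-1) \o (fun w => resid gE g j (X w))).
    by apply: measurableT_comp; [exact: measurable_powR|exact: measurable_resid].
  by apply/funext => w /=; rewrite powR_inv1// dot_ge0.
have r0 j w : 0 <= (resid gE g j (X w))^-1 by rewrite invr_ge0 dot_ge0.
apply: (@le_lt_trans _ _ (\int[P]_w (\sum_j (resid gE g j (X w))^-1)%:E)%E).
  apply: ae_ge0_le_integral_sub => [w|w||].
  - by rewrite lee_fin sqr_ge0.
  - by rewrite lee_fin sumr_ge0.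
  - by apply/measurable_EFinP; exact: measurable_sum.
  - by apply: filterS ae_resid_full => w hw; rewrite lee_fin op_norm_polar_pos.
under eq_integral do rewrite -sumEFin.
rewrite ge0_integral_sum//=; last 2 first.
- by move=> j; exact/measurable_EFinP.
- by move=> j w _; rewrite lee_fin.
apply: lte_sum_pinfty => j _.
apply: (@inverse_moment _ _ _ _ _ (normal_peak (Num.sqrt (normal_var R)^-1) *+ 2)).
- exact: measurable_resid.
- by move=> w; exact: dot_ge0.
(* Codimension 2 leaves three orthonormal directions off the span of the other columns, hence the
   cubic tail. *)
move=> eps e0; have nV : (3 + \dim {:E} <= (\dim {:V}).+1)%N by lia.
have := resid_small_ball gX j nV e0; rewrite mulrnAr -mulrnAl.
by rewrite ortho_proj_fullv; under [X in (P X <= _)%E -> _]eq_set do rewrite comp_lfun1l.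
Qed.

End FullRank.

(** * Laws of the range and of the polar factors *)

Section LawKernel.
Context d d1 d2 (Omega : measurableType d) (T1 : measurableType d1)
  (T2 : measurableType d2) (R : realType) (P : probability Omega R).
Variable Z : T1 * Omega -> T2.
Hypothesis mZ : measurable_fun setT Z.

Let mZ1 t : measurable_fun setT (fun w => Z (t, w)).
Proof. exact: measurableT_comp mZ (measurable_pair1 t). Qed.

Definition law_kernel (t : T1) :
  {measure set T2 -> \bar R} := law_of P (mZ1 t).

Let law_kernel_measurable A : measurable A ->
  measurable_fun setT (law_kernel ^~ A).
Proof.
move=> mA; have mZA : measurable (Z @^-1` A) by rewrite -[_ @^-1` _]setTI; exact: mZ.
rewrite [X in measurable_fun _ X](_ : _ = P \o xsection (Z @^-1` A)); first exact: measurable_fun_xsection.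
apply/funext => t; congr (P _); apply/seteqP; split=> w; rewrite /xsection/= inE//.
Qed.

HB.instance Definition _ :=
  isKernel.Build _ _ T1 T2 R (law_kernel) law_kernel_measurable.

Let law_kernel_prob t : law_kernel t setT = 1%E.
Proof. exact: (@probability_setT _ _ _ (law_of P (mZ1 t))). Qed.

HB.instance Definition _ :=
  Kernel_isProbability.Build _ _ T1 T2 R (law_kernel) law_kernel_prob.

End LawKernel.

Lemma ae_law_of d d' (T : measurableType d) (T' : measurableType d') (R : realType)
    (P : probability T R) (X : T -> T') (mX : measurable_fun setT X) (D : set T') :
  measurable D -> {ae P, forall t, D (X t)} -> {ae law_of P mX, forall t, D t}.
Proof.
move=> mD aD; exists (~` D); split => //; first exact: measurableC.
have mXD : measurable (X @^-1` (~` D)).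
  by rewrite -[_ @^-1` _]setTI; apply: mX => //; exact: measurableC.
by move/(measure_negligible mXD): aD.
Qed.

Lemma measure_ae_iff d (T : measurableType d) (R : realType)
    (mu : {measure set T -> \bar R}) (A B : set T) : measurable A -> measurable B ->
  {ae mu, forall t, A t <-> B t} -> mu A = mu B.
Proof.
move=> mA mB AB; rewrite -[A]setIT -[B]setIT -!integral_indic//.
apply: ae_eq_integral => //; try by apply/measurable_EFinP; exact: measurable_indic.
apply: filterS AB => t AB _; rewrite !indicE; congr (_%:R%:E); congr nat_of_bool.
by apply/idP/idP; rewrite !inE => /AB.
Qed.

Section HomSets.
Context d (T : measurableType d) (R : realType) (U V : vectType R).
Variables (gU : {dot U for idfun}) (g : {dot V for idfun}).

Lemma measurable_eq_fun (f h : T -> R) : measurable_fun setT f ->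
  measurable_fun setT h -> measurable [set w | f w = h w].
Proof.
move=> mf mh; rewrite (_ : [set w | _] = (f \- h) @^-1` [set 0]).
  by rewrite -[_ @^-1` _]setTI; apply: (measurable_funB mf mh).
by apply/seteqP; split=> w /= => [->|/eqP]; rewrite ?subrr// subr_eq0 => /eqP.
Qed.

Lemma measurable_eq_hom (X Y : T -> 'Hom(U, V)) : mhom g X -> mhom g Y ->
  measurable [set w | X w = Y w].
Proof.
move=> mX mY; have [_ _ bE] := fullv_onbP gU; have [_ _ cE] := fullv_onbP g.
rewrite (_ : [set w | _] = [set w | forall ij : 'I_(\dim {:U}) * 'I_(\dim {:V}),
    [set w | g (X w (fullv_onb gU ij.1)) (fullv_onb g ij.2) =
             g (Y w (fullv_onb gU ij.1)) (fullv_onb g ij.2)] w]).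
  by apply: measurable_forall_fin => ij; apply: measurable_eq_fun; [exact: mX|exact: mY].
apply/seteqP; split=> w /= => [-> //|h]; apply/lfunP => u.
rewrite (bE u (memvf _)) !linear_sum; apply: eq_bigr => i _; rewrite !linearZ/=.
congr (_ *: _); rewrite [LHS](cE _ (memvf _)) [RHS](cE _ (memvf _)).
by apply: eq_bigr => j _; rewrite (h (i, j)).
Qed.

(** Makes the dimension a measurable function of the subspace. *)
Lemma dim_trace (W : {vspace V}) : dot_trace g (ortho_proj g W) = (\dim W)%:R.
Proof.
have [c [cW cc cE]] := exists_onb g (erefl (\dim W)).
rewrite /dot_trace (eq_bigr (fun i => \sum_k g (c k) (fullv_onb g i) ^+ 2)).
  rewrite exchange_big/= (eq_bigr (fun=> 1)) => [|k _].
    by rewrite big_const_ord iter_addr addr0.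
  by rewrite -(onb_dot_sqr _ (fullv_onbP g)) cc eqxx.
move=> i _; rewrite {1}(cE _ (ortho_proj_in g W _)) dot_suml.
by apply: eq_bigr => k _; rewrite dotZl dot_ortho_projl// expr2 (dotC g (c k)).
Qed.

End HomSets.

Section HaarGaussian.
Variables (R : realType) (E V : vectType R).
Variables (gE : {dot E for idfun}) (g : {dot V for idfun}).
Context d (Omega : measurableType d) (P : probability Omega R).
Variable X : Omega -> 'Hom(E, V).
Hypothesis gX : gaussian_hom gE g P X.
Hypothesis dEV : (\dim {:E} + 2 <= \dim {:V})%N.

Let mX : mhom g X. Proof. by case: gX. Qed.
Let mXh : measurable_fun setT (X : Omega -> borel_hom E V).
Proof. exact/(measurable_homP g). Qed.
Let mid : mhom g (fun f : borel_hom E V => f : 'Hom(E, V)).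
Proof. by apply/measurable_homP; exact: measurable_id. Qed.

Let range w : borel_vspace g := limg (X w).
Let iso w : borel_hom E V := polar_iso gE g (X w).
Let pos w : borel_hom E E := polar_pos gE g (X w).

Let m_limg : measurable_fun setT (fun f : borel_hom E V => limg f : borel_vspace g).
Proof. by apply/measurable_vspaceP; exact: (mhom_ortho_proj_limg gE). Qed.

Let m_iso : measurable_fun setT (fun f : borel_hom E V => polar_iso gE g f : borel_hom E V).
Proof. by apply/(measurable_homP g); exact: mhom_polar_iso. Qed.

Let m_pos : measurable_fun setT (fun f : borel_hom E V => polar_pos gE g f : borel_hom E E).
Proof. by apply/(measurable_homP gE); exact: mhom_polar_pos. Qed.

Lemma measurable_range : measurable_fun setT range.
Proof. exact: measurableT_comp m_limg mXh. Qed.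

Lemma measurable_polar_iso : measurable_fun setT iso.
Proof. exact: measurableT_comp m_iso mXh. Qed.

Lemma measurable_polar_pos : measurable_fun setT pos.
Proof. exact: measurableT_comp m_pos mXh. Qed.

Lemma ae_lker : {ae P, forall w, lker (X w) = 0%VS}.
Proof. by apply: filterS (ae_resid_full gX dEV) => w; exact: resid_lker. Qed.

Lemma ae_dim_range : {ae P, forall w, \dim (limg (X w)) = \dim {:E}}.
Proof. by apply: filterS ae_lker => w h; rewrite limg_dim_eq// h capv0. Qed.

Lemma measurable_grassmannian l :
  measurable (@grassmannian R V l : set (borel_vspace g)).
Proof.
rewrite (_ : grassmannian l = [set W : borel_vspace g | dot_trace g (ortho_proj g W) = l%:R]).
  apply: measurable_eq_fun => //; apply: measurable_dot_trace.
  by apply/measurable_vspaceP; exact: measurable_id.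
by apply/seteqP; split=> W /=; rewrite /grassmannian/= dim_trace;
  [move=> ->|move=> /eqP; rewrite eqr_nat => /eqP].
Qed.

Let law_compl Q A : orthogonal_ops g Q -> measurable A ->
  P ((fun w => (Q \o X w)%VF : borel_hom E V) @^-1` A) = P (X @^-1` A).
Proof. by move=> oQ mA; exact: gaussian_hom_law_eq gX (gaussian_hom_compl oQ gX) _ mA. Qed.

Lemma haar_uniform_range : haar_uniform (T := borel_vspace g)
  (grassmannian (\dim {:E})) (image_action g) (law_of P measurable_range).
Proof.
have inv : invariant_law (T := borel_vspace g)
    (grassmannian (\dim {:E})) (image_action g) (law_of P measurable_range).
  split.
  - exact: (@probability_setT _ _ _ (law_of P measurable_range)).
  - by apply: ae_law_of; [exact: measurable_grassmannian|exact: ae_dim_range].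
  move=> _ A [Q oQ ->] mA.
  have mA' : measurable ((fun f : borel_hom E V => limg f : borel_vspace g) @^-1` A).
    by rewrite -[_ @^-1` _]setTI; exact: m_limg.
  have := law_compl oQ mA'; rewrite /law_of/= /distribution/pushforward/= => <-.
  by congr (P _); apply/seteqP; split=> w /=; rewrite limg_comp.
split=> // nu inu A mA.
apply: (@invariant_law_unique _ _ _ _ (@vspace_coord R V g) (@measurable_vspace_coord R V g)
  (@generated_by_vspace_coord R V g) _ _ _ _ _ _ inv inu) => // [_ [Q oQ ->] W W'|W W' dW dW'].
  exact: vspace_coord_img.
have [Q oQ QW] := exists_orthogonal_img g (etrans dW (esym dW')).
by exists (fun W0 : {vspace V} => (Q @: W0)%VS) => //; exists Q.
Qed.

Definition isometries : set (borel_hom E V) := [set U : 'Hom(E, V) | isometry g gE U].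

Definition left_composition : set (borel_hom E V -> borel_hom E V) :=
  [set h | exists2 Q, orthogonal_ops g Q & h = fun U : 'Hom(E, V) => (Q \o U)%VF].

Lemma isometry_gram (U : 'Hom(E, V)) : isometry g gE U <-> gram gE g U = \1%VF.
Proof.
split=> [iU|gU]; first by rewrite /gram isometry_adjK.
by apply/isometryP => u v; rewrite -(dot_gram gE) gU id_lfunE.
Qed.

Lemma measurable_isometries : measurable isometries.
Proof.
rewrite (_ : isometries = [set U : borel_hom E V | gram gE g U = \1%VF]).
  by apply: (measurable_eq_hom gE); [exact: mhom_gram|exact: mhom_cst].
by apply/seteqP; split=> U /isometry_gram.
Qed.

Lemma left_invariant_unique (mu nu : {measure set (borel_hom E V) -> \bar R}) :
  invariant_law isometries left_composition mu ->
  invariant_law isometries left_composition nu ->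
  forall A, measurable A -> nu A = mu A.
Proof.
apply: (@invariant_law_unique _ _ _ _ (hom_coord gE g) (measurable_hom_coord gE g)
  (generated_by_hom_coord gE g)) => [_ [Q oQ ->] U U'|U U' iU iU'].
  exact: hom_coord_compl.
have [Q oQ QU] := exists_orthogonal_comp iU iU'.
by exists (fun U0 : 'Hom(E, V) => (Q \o U0)%VF) => //; exists Q.
Qed.

Lemma ae_isometry : {ae P, forall w, isometries (iso w)}.
Proof. by apply: filterS ae_lker => w; exact: polar_iso_isometry. Qed.

Lemma left_invariant_iso :
  invariant_law isometries left_composition (law_of P measurable_polar_iso).
Proof.
split.
- exact: (@probability_setT _ _ _ (law_of P measurable_polar_iso)).
- by apply: ae_law_of; [exact: measurable_isometries|exact: ae_isometry].
move=> _ A [Q oQ ->] mA.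
have mA' : measurable ((fun f : borel_hom E V => polar_iso gE g f : borel_hom E V) @^-1` A).
  by rewrite -[_ @^-1` _]setTI; exact: m_iso.
have := law_compl oQ mA'; rewrite /law_of/= /distribution/pushforward/= => <-.
by congr (P _); apply/seteqP; split=> w /=; rewrite (polar_compl _ _ oQ).2.
Qed.

(* Conditionally on an event of the positive factor, the law of the isometric
   factor is still left invariant, hence unchanged. *)
Lemma independent_polar : independent_RV P iso pos.
Proof.
move=> A1 A2 mA1 mA2; set D := pos @^-1` A2.
have mD : measurable D by rewrite -[D]setTI; exact: measurable_polar_pos.
have mU A : measurable A -> measurable (iso @^-1` A).
  by move=> mA; rewrite -[_ @^-1` _]setTI; exact: measurable_polar_iso.
have [D0|D0] := eqVneq (P D) 0%E.
  rewrite D0 mule0; apply/eqP; rewrite eq_le measure_ge0 andbT -D0.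
  by apply: le_measure; rewrite ?inE//; apply: measurableI => //; exact: mU.
pose p := fine (P D).
have pE : P D = p%:E by rewrite /p fineK// fin_num_measure.
have p0 : 0 < p by rewrite -lte_fin -pE lt_neqAle eq_sym D0 measure_ge0.
have pV : 0 <= p^-1 by rewrite invr_ge0 ltW.
(* The conditional probability given [D]. *)
pose mu : {measure set Omega -> \bar R} := mscale (NngNum pV) (mrestr P mD).
have muE S : mu S = (p^-1%:E * P (S `&` D))%E by [].
have mu1 : mu setT = 1%E.
  by rewrite muE setTI pE -EFinM mulVf// gt_eqF.
pose Pc : probability Omega R := unit_measure mu1.
have inv : invariant_law isometries left_composition (law_of Pc measurable_polar_iso).
  split.
  - exact: (@probability_setT _ _ _ (law_of Pc measurable_polar_iso)).
  - apply: ae_law_of; first exact: measurable_isometries.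
    have [N [mN N0 sN]] := ae_isometry; exists N; split=> //.
    rewrite -[LHS]/(mu N) muE (_ : P (N `&` D) = 0%E) ?mule0//.
    apply/eqP; rewrite eq_le measure_ge0 andbT -N0.
    by apply: le_measure; rewrite ?inE//; exact: measurableI.
  move=> _ A [Q oQ ->] mA.
  (* Left composition acts on the isometric factor alone, so invariance of the law of [X] is applied
     to the joint event. *)
  pose S : set (borel_hom E V) :=
    ((fun f : borel_hom E V => polar_iso gE g f : borel_hom E V) @^-1` A) `&`
    ((fun f : borel_hom E V => polar_pos gE g f : borel_hom E E) @^-1` A2).
  have mS : measurable S.
    apply: measurableI; first by rewrite -[_ @^-1` _]setTI; exact: m_iso.
    by rewrite -[_ @^-1` _]setTI; exact: m_pos.
  have h := law_compl oQ mS.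
  rewrite -[LHS]/(mu (iso @^-1` ((fun U : 'Hom(E, V) => (Q \o U)%VF) @^-1` A))).
  rewrite -[RHS]/(mu (iso @^-1` A)) !muE; congr (_ * _)%E.
  rewrite -[RHS]/(P (X @^-1` S)) -h; congr (P _).
  apply/seteqP; split=> w; rewrite /S/= (polar_compl gE (X w) oQ).1;
    by rewrite (polar_compl gE (X w) oQ).2.
have := left_invariant_unique left_invariant_iso inv mA1.
rewrite -[LHS]/(mu (iso @^-1` A1)) -[RHS]/(P (iso @^-1` A1)) muE => <-.
rewrite pE [RHS]muleC muleA -EFinM divff ?mul1e//.
by rewrite gt_eqF.
Qed.

Let measurable_iso_proj W (A : set (borel_hom E V)) : measurable A -> measurable
  ((fun f : borel_hom E V => polar_iso gE g (ortho_proj g W \o f)%VF : borel_hom E V) @^-1` A).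
Proof.
have m : measurable_fun setT
    (fun f : borel_hom E V => polar_iso gE g (ortho_proj g W \o f)%VF : borel_hom E V).
  apply/(measurable_homP g); apply: mhom_polar_iso.
  by apply: (mhom_comp (gU := g)); first exact: mhom_cst.
by move=> mA; rewrite -[_ @^-1` _]setTI; exact: m.
Qed.

(** Evaluated at a fixed subspace, its law is the candidate for the conditional law of the isometric
    factor given that range. *)
Let Zk (p : borel_vspace g * Omega) : borel_hom E V :=
  polar_iso gE g (ortho_proj g p.1 \o X p.2)%VF.

Let mZk : measurable_fun setT Zk.
Proof.
apply/(measurable_homP g); apply: mhom_polar_iso; apply: (mhom_comp (gU := g)).
  by apply/measurable_vspaceP; exact: measurable_fst.
by move=> u v; exact: measurableT_comp (mX u v) measurable_snd.
Qed.

Definition polar_kernel : R.-pker borel_vspace g ~> borel_hom E V := law_kernel P mZk.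

Let polar_kernelE W A : polar_kernel W A =
  P ((fun w => polar_iso gE g (ortho_proj g W \o X w)%VF : borel_hom E V) @^-1` A).
Proof. by []. Qed.

Definition isometries_in W : set (borel_hom E V) :=
  [set U : 'Hom(E, V) | isometry g gE U /\ (limg U <= W)%VS].

Lemma measurable_isometries_in W : measurable (isometries_in W).
Proof.
apply: (measurableI isometries [set U : 'Hom(E, V) | (limg U <= W)%VS]).
  exact: measurable_isometries.
rewrite (_ : [set U | _] = [set U : borel_hom E V | (ortho_proj g W \o U)%VF = U]).
  apply: (measurable_eq_hom gE) => //.
  by apply: (mhom_comp (gU := g)); first exact: mhom_cst.
apply/seteqP; split=> U /= h.
  apply/lfunP => u; rewrite comp_lfunE ortho_proj_id// (subvP h)//.
  by rewrite memv_img ?memvf.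
by rewrite -h limg_comp -{2}(limg_ortho_proj g W) limgS// subvf.
Qed.

Section KernelHaar.
Variable W : {vspace V}.
Hypothesis dW : \dim W = \dim {:E}.

Lemma ae_polar_kernel_in :
  {ae P, forall w, isometries_in W (polar_iso gE g (ortho_proj g W \o X w)%VF) /\
    limg (polar_iso gE g (ortho_proj g W \o X w)%VF) = W}.
Proof.
have dW' : (\dim {:E} <= \dim W)%N by rewrite dW.
apply: filterS (ae_lker_proj gX dW') => w k0.
have iU := polar_iso_isometry gE g k0.
have UW : (limg (polar_iso gE g (ortho_proj g W \o X w)%VF) <= W)%VS.
  apply: subv_trans (limg_polar_iso_sub _ _ _) _.
  by rewrite limg_comp -{2}(limg_ortho_proj g W) limgS// subvf.
by split=> //; exact: dim_limg_eq (isometry_inj iU) dW.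
Qed.

(** Right composition by an orthogonal operator commutes with the projection, passes through
    [polar_iso] and preserves the law of [X]; equal dimensions make the action transitive. *)
Lemma haar_uniform_polar_kernel : haar_uniform (T := borel_hom E V)
  (isometries_in W)
  [set h | exists2 O, orthogonal_ops gE O & h = fun U : 'Hom(E, V) => (U \o O)%VF]
  (polar_kernel W).
Proof.
set act := [set h | _].
have inv : invariant_law (T := borel_hom E V) (isometries_in W) act (polar_kernel W).
  split.
  - exact: prob_kernel.
  - apply: ae_law_of; first exact: measurable_isometries_in.
    by apply: filterS ae_polar_kernel_in => w [].
  move=> _ A [C oC ->] mA; rewrite !polar_kernelE.
  pose S : set (borel_hom E V) :=
    (fun f : borel_hom E V => polar_iso gE g (ortho_proj g W \o f)%VF : borel_hom E V) @^-1` A.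
  have mS : measurable S by exact: measurable_iso_proj.
  have := gaussian_hom_law_eq gX (gaussian_hom_compr oC gX) mS => h.
  rewrite -[RHS]/(P (X @^-1` S)) -h; congr (P _).
  by apply/seteqP; split=> w; rewrite /S/= comp_lfunA polar_iso_compr.
split=> // nu inu A mA.
apply: (@invariant_law_unique _ _ _ _ (hom_coord gE g) (measurable_hom_coord gE g)
  (generated_by_hom_coord gE g) _ _ _ _ _ _ inv inu) => // [_ [C oC ->] U U'|U U' [iU UW] [iU' UW']].
  exact: hom_coord_compr.
have [C oC UC] := isometry_transitive iU iU' UW UW' dW.
by exists (fun U0 : 'Hom(E, V) => (U0 \o C)%VF) => //; exists C.
Qed.

End KernelHaar.

Let kap (f : borel_hom E V) A : \bar R := polar_kernel (limg f : borel_vspace g) A.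

Let mkap A : measurable A -> measurable_fun setT (kap ^~ A).
Proof.
move=> mA; apply: (measurableT_comp (f := fun W => polar_kernel W A)) m_limg.
exact: measurable_kernel.
Qed.

(** The range comes from one copy and the isometry into it from the other; its law is the mixture of
    the kernels. *)
Let Z2 (w : Omega * Omega) : borel_hom E V := Zk (range w.1, w.2).

Let mZ2 : measurable_fun setT Z2.
Proof.
apply: measurableT_comp mZk _; apply: measurable_fun_pair => //.
exact: measurableT_comp measurable_range measurable_fst.
Qed.

Let Z2E A : measurable A ->
  (P \x P)%E (Z2 @^-1` A) = (\int[P]_w kap (X w) A)%E.
Proof.
move=> mA; rewrite /product_measure1/=; apply: eq_integral => w _.
rewrite /kap polar_kernelE; congr (P _).
by apply/seteqP; split=> w'; rewrite /xsection/= inE.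
Qed.

Let integral_law_compl Q (h : borel_hom E V -> \bar R) : orthogonal_ops g Q ->
  measurable_fun setT h -> (forall f, 0 <= h f)%E ->
  (\int[P]_w h (Q \o X w)%VF = \int[P]_w h (X w))%E.
Proof.
move=> oQ mh h0.
have mQ : measurable_fun setT (fun w => (Q \o X w)%VF : borel_hom E V).
  by have [+ _ _] := gaussian_hom_compl oQ gX; move/(measurable_homP g).
pose law Y (mY : measurable_fun setT (Y : Omega -> borel_hom E V)) := law_of P mY.
have lawE Y (mY : measurable_fun setT (Y : Omega -> borel_hom E V)) :
    (\int[law Y mY]_f h f = \int[P]_w h (Y w))%E.
  exact: ge0_integral_distribution.
rewrite -(lawE _ mQ) -(lawE _ mXh).
apply: eq_measure_integral => A mA _.
exact: (law_compl oQ mA).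
Qed.

(** Projecting [Q \o X] on the image of W under [Q] is [Q] after projecting [X] on W; invariance of
    the law of [X] absorbs the inner [Q]. *)
Let kap_compl Q (f : 'Hom(E, V)) (A : set (borel_hom E V)) : orthogonal_ops g Q -> measurable A ->
  kap f ((fun U : 'Hom(E, V) => (Q \o U)%VF) @^-1` A) = kap (Q \o f)%VF A.
Proof.
move=> oQ mA; rewrite /kap !polar_kernelE.
pose S : set (borel_hom E V) := (fun h : borel_hom E V =>
  polar_iso gE g (ortho_proj g (limg (Q \o f)) \o h)%VF : borel_hom E V) @^-1` A.
have mS : measurable S by exact: measurable_iso_proj.
rewrite -[RHS]/(P (X @^-1` S)) -(law_compl oQ mS); congr (P _).
have QE w : (ortho_proj g (limg (Q \o f)) \o (Q \o X w))%VF =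
    (Q \o (ortho_proj g (limg f) \o X w))%VF.
  rewrite limg_comp ortho_proj_img//; apply/lfunP => u; rewrite !comp_lfunE.
  by rewrite -[adj _ _ _ _]comp_lfunE (isometry_adjK oQ) id_lfunE.
by apply/seteqP; split=> w; rewrite /S/= QE (polar_compl _ _ oQ).2.
Qed.

Lemma law_iso_kernel A : measurable A ->
  P (iso @^-1` A) = (\int[P]_w polar_kernel (range w) A)%E.
Proof.
move=> mA; rewrite -[RHS](Z2E mA).
suff inv : invariant_law isometries left_composition (law_of (P \x P)%E mZ2).
  exact/esym/(left_invariant_unique left_invariant_iso inv mA).
split.
- exact: (@probability_setT _ _ _ (law_of (P \x P)%E mZ2)).
- exists (~` isometries); split => //.
    by apply: measurableC; exact: measurable_isometries.
  have mN : measurable (~` isometries) by apply: measurableC; exact: measurable_isometries.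
  rewrite -[LHS]/((P \x P)%E (Z2 @^-1` (~` isometries))) Z2E//.
  have := @ae_eq_integral _ _ _ P setT (cst 0%E) (fun w => kap (X w) (~` isometries)) measurableT.
  rewrite integral0; apply => //; first exact: measurableT_comp (mkap mN) mXh.
  apply: filterS ae_dim_range => w dw _; rewrite /kap polar_kernelE.
  rewrite -[RHS](measure0 P); apply: measure_ae_iff => //.
    by rewrite -[_ @^-1` _]setTI; exact: (measurableT_comp mZk (measurable_pair1 _)).
  apply: filterS (ae_polar_kernel_in dw) => w' [[iU _] _].
  by split=> // /(_ iU).
move=> _ A' [Q oQ ->] mA'.
have mQA : measurable ((fun U : borel_hom E V => (Q \o U)%VF : borel_hom E V) @^-1` A').
  have mQ : measurable_fun setT (fun U : borel_hom E V => (Q \o U)%VF : borel_hom E V).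
    by apply/(measurable_homP g); apply: (mhom_comp (gU := g)) => //; exact: mhom_cst.
  by rewrite -[_ @^-1` _]setTI; exact: mQ.
rewrite -[LHS]/((P \x P)%E (Z2 @^-1` _)) -[RHS]/((P \x P)%E (Z2 @^-1` A')).
rewrite !Z2E// -(integral_law_compl oQ (mkap mA')) => [|f]; last exact: measure_ge0.
by apply: eq_integral => w _; exact: kap_compl.
Qed.

(** The event on the range is rewritten as one on the isometric factor, where [law_iso_kernel]
    applies; under the kernel at W it amounts to the indicator of [A1] at W. *)
Lemma conditional_law_polar : conditional_law P range iso polar_kernel.
Proof.
move=> A1 A2 mA1 mA2.
pose A' : set (borel_hom E V) :=
  ((fun f : borel_hom E V => limg f : borel_vspace g) @^-1` A1) `&` A2.
have mA' : measurable A'.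
  by apply: measurableI => //; rewrite -[_ @^-1` _]setTI; exact: m_limg.
have mr : measurable (range @^-1` A1) by rewrite -[_ @^-1` _]setTI; exact: measurable_range.
have mi A : measurable A -> measurable (iso @^-1` A).
  by move=> mA; rewrite -[_ @^-1` _]setTI; exact: measurable_polar_iso.
have -> : P (range @^-1` A1 `&` iso @^-1` A2) = P (iso @^-1` A').
  apply: measure_ae_iff; [by apply: measurableI => //; exact: mi|exact: mi|].
  apply: filterS ae_lker => w k0; rewrite /A'/= -[limg (iso w)]/(limg (polar_iso gE g (X w))).
  by rewrite limg_polar_iso.
rewrite (law_iso_kernel mA') [RHS]integral_mkcond.
have mk A : measurable A -> measurable_fun setT (fun w => polar_kernel (range w) A).
  by move=> mA; exact: measurableT_comp (mkap mA) mXh.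
apply: ae_eq_integral => //; first exact: mk.
  by apply/(measurable_restrictT _ mr); apply: measurable_funTS; exact: mk.
apply: filterS ae_dim_range => w dw _; rewrite patchE.
have aw := ae_polar_kernel_in dw.
have mZw A : measurable A -> measurable ((fun w' =>
    polar_iso gE g (ortho_proj g (range w) \o X w')%VF : borel_hom E V) @^-1` A).
  move=> mA; rewrite -[_ @^-1` _]setTI.
  exact: (measurableT_comp mZk (measurable_pair1 _)).
case: ifPn; rewrite ?inE ?notin_setE => wA; rewrite !polar_kernelE.
  apply: measure_ae_iff; [exact: mZw|exact: mZw|].
  apply: filterS aw => w' [_ h]; rewrite /A'/= h.
  by split=> [[]|].
rewrite -[RHS](measure0 P); apply: measure_ae_iff; [exact: mZw|exact: measurable0|].
apply: filterS aw => w' [_ h]; rewrite /A'/= h.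
by split=> // -[].
Qed.

End HaarGaussian.

(** The square of the positive factor is the Gram operator; each vector of an orthonormal basis of
    [V] contributes one identity. *)
Lemma polar_pos_sqr_expectation (R : realType) (E V : vectType R)
    (gE : {dot E for idfun}) (g : {dot V for idfun}) d (Omega : measurableType d)
    (P : probability Omega R) (X : Omega -> 'Hom(E, V)) : mhom g X ->
  (forall u v y z, ('E_P[(fun w => g (X w u) y * g (X w v) z)%R] =
    (gE u v * g y z)%R%:E)%E) ->
  has_op_expectation P gE (fun w => (polar_pos gE g (X w) \o polar_pos gE g (X w))%VF)
    ((\dim {:V})%:R *: \1%VF).
Proof.
move=> mX EX u v; have [_ cc _] := fullv_onbP g; set c := fullv_onb g in cc.
rewrite unlock.
have sE w : (gE ((polar_pos gE g (X w) \o polar_pos gE g (X w))%VF u) v)%:E =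
    (\sum_i (g (X w u) (c i) * g (X w v) (c i))%:E)%E.
  rewrite polar_pos_sqr dot_gram (onb_dot _ _ (fullv_onbP g)) sumEFin.
  by congr EFin; apply: eq_bigr => i _; rewrite (dotC g (c i)).
under eq_integral do rewrite sE.
have EXX u' v' y z : (\int[P]_w (g (X w u') y * g (X w v') z)%:E = (gE u' v' * g y z)%:E)%E.
  by have := EX u' v' y z; rewrite unlock.
rewrite integral_sum//= => [|i]; last first.
  by apply: integrable_mul_square; rewrite ?EXX ?ltry//; exact: mX.
under eq_bigr do rewrite EXX cc eqxx mulr1.
rewrite sumEFin scale_lfunE id_lfunE dotZl big_const_ord iter_addr addr0.
by rewrite mulr_natl.
Qed.

Theorem proposition2p7 (R : realType) (V : vectType R) (g : {dot V for idfun})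
    (d l : nat) (hd : \dim {:V} = d) (hl : (l.+1 < d)%N)
    (B : {vspace V}) (hB : \dim B = l)
    (disp : measure_display) (Omega : measurableType disp)
    (P : probability Omega R)
    (F : {RV P >-> borel_hom (subvs_of B) V}) :
  gaussian_sketching P g B (fun w => sketching_operator g (F w)) ->
  haar_grassmann_sketching P g B (fun w => sketching_operator g (F w)).
Proof.
pose gE : {dot (subvs_of B) for idfun} := dot_sub g B.
have FE w : restr B (sketching_operator g (F w)) = F w by exact: sketching_operatorK.
move=> [jF EF EFF].
have gF : gaussian_hom gE g P (F : Omega -> 'Hom(_, _)).
  have := gaussian_hom_intro jF EF EFF.
  by under [X in gaussian_hom _ _ _ X]eq_fun do rewrite FE.
have EFF' u v y z : ('E_P[(fun w => g (F w u) y * g (F w v) z)%R] =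
    (gE u v * g y z)%R%:E)%E.
  by have := EFF u v y z; under [X in expectation _ X]eq_fun do rewrite /= FE.
have mF : mhom g F by case: gF.
have dimB : \dim {:subvs_of B} = \dim B by rewrite dimvf.
(* The hypothesis d > l + 1, read as codimension at least 2. *)
have dEV : (\dim {:subvs_of B} + 2 <= \dim {:V})%N by rewrite dimB hB hd addn2.
have mXi := measurable_range gF; have mU := measurable_polar_iso gF.
have mA := measurable_polar_pos gF.
exists (rv_of P mXi), (rv_of P mU), (rv_of P mA); split.
- split=> [w|]; first by rewrite FE.
  apply: filterS (ae_lker gF dEV) => w k0; rewrite FE; split.
  + exact: polar_iso_pos.
  + by split; [exact: polar_iso_isometry|rewrite limg_polar_iso].
  + by case: (polar_pos_psd gE g (F w)).
  + exact: polar_pos_definite.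
- by rewrite -dimB; exact: (haar_uniform_range gF dEV).
- split.
  + by apply: filterS (ae_dim_range gF dEV) => w; rewrite FE dimB.
  + exists (polar_kernel gF); split; first exact: conditional_law_polar.
    apply: filterS (ae_dim_range gF dEV) => w dw.
    exact: (haar_uniform_polar_kernel gF).
  + exact: independent_polar.
- split; first exact: polar_pos_sqr_expectation.
  by rewrite unlock; exact: op_norm_moment.
Qed.
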